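(* Let $T\in\mathfrak{S}'$. Given $1\le p\le q\le\infty$, if $T\in\mathcal{M}^{q,p}$ then $\sigma_T\in M^{p,q}(\mathbb{R}^{2d})$. Conversely, given $1\le q\le p\le\infty$, if $\sigma_T\in M^{p,q}(\mathbb{R}^{2d})$ then $T\in\mathcal{M}^{q,p}$.
   Context: For $n\in\mathbb{N}$ and $(a,b)\in\mathbb{R}^n\times\mathbb{R}^n$, $(\pi(a,b)f)(t)=e^{2\pi i b\cdot t}f(t-a)$; $V_gf(a,b)=\langle f,\pi(a,b)g\rangle$. Let $\varphi_0(t)=2^{n/4}e^{-\pi|t|^2}$ on $\mathbb{R}^n$. Function modulation spaces: $M^{p,q}(\mathbb{R}^{2d})$ is the space of $f\in\mathscr{S}'(\mathbb{R}^{2d})$ with $\big(\int_{\mathbb{R}^{2d}}\big(\int_{\mathbb{R}^{2d}}|V_{\varphi_0}f(a,b)|^p\,da\big)^{q/p}db\big)^{1/q}<\infty$ (usual modification for infinite exponents). $\mathfrak{S}'$ is the space of continuous linear operators $T:\mathscr{S}(\mathbb{R}^d)\to\mathscr{S}'(\mathbb{R}^d)$. Operator modulation spaces: with $\varphi_0$ the Gaussian on $\mathbb{R}^d$ and $Q_{S_0}T(w,z)=\langle T\pi(w)\varphi_0,\pi(z)\varphi_0\rangle_{\mathscr{S}',\mathscr{S}}$ for $w,z\in\mathbb{R}^{2d}$, the space $\mathcal{M}^{r,s}$ consists of $T\in\mathfrak{S}'$ with $\big(\int_{\mathbb{R}^{2d}}\big(\int_{\mathbb{R}^{2d}}|Q_{S_0}T(w,z)|^r\,dw\big)^{s/r}dz\big)^{1/s}<\infty$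 (usual modification for infinite exponents). Weyl symbol: $\sigma_T\in\mathscr{S}'(\mathbb{R}^{2d})$ is the unique tempered distribution with $\langle Tg,f\rangle_{\mathscr{S}',\mathscr{S}}=\langle\sigma_T,W(f,g)\rangle_{\mathscr{S}',\mathscr{S}}$ for all $f,g\in\mathscr{S}(\mathbb{R}^d)$ (sesquilinear pairings), where $W(f,g)(x,\omega)=\int_{\mathbb{R}^d}f(x+\tfrac t2)\overline{g(x-\tfrac t2)}e^{-2\pi i\omega\cdot t}dt$. *)

(* Defs.v *)
From HB Require Import structures.
From mathcomp Require Import all_boot all_order all_algebra.
From mathcomp Require Import complex.
From mathcomp Require Import all_classical all_reals all_analysis.

Set Implicit Arguments.
Unset Strict Implicit.
Unset Printing Implicit Defensive.

Import Order.TTheory GRing.Theory Num.Theory.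
Import numFieldNormedType.Exports.
Import ComplexField.Normc.

Local Open Scope classical_set_scope.
Local Open Scope complex_scope.
Local Open Scope ring_scope.

Definition measure_rV_display : measure_display.
Proof. exact: default_measure_display. Qed.

Section rV_measurable.
Context {R : realType} {n : nat}.

Definition rV_coord (i : 'I_n) (x : 'rV[R]_n) : measurableTypeR R := x 0 i.

Let rV_set0 : g_sigma_preimage rV_coord set0.
Proof. exact: sigma_algebra0. Qed.

Let rV_setC A : g_sigma_preimage rV_coord A -> g_sigma_preimage rV_coord (~` A).
Proof. exact: sigma_algebraC. Qed.

Let rV_bigcup (F : (set 'rV[R]_n)^nat) :
  (forall i, g_sigma_preimage rV_coord (F i)) ->
  g_sigma_preimage rV_coord (\bigcup_i F i).
Proof. exact: sigma_algebra_bigcup. Qed.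

(* The Borel sigma-algebra of R^n, generated by the coordinates exactly as the
   library does for n.-tuple. *)
HB.instance Definition _ := @isMeasurable.Build measure_rV_display 'rV[R]_n
  (g_sigma_preimage rV_coord) rV_set0 rV_setC rV_bigcup.

Lemma measurable_rV_coord i : measurable_fun [set: 'rV[R]_n] (rV_coord i).
Proof.
move=> _ Y mY; rewrite setTI; apply: sub_sigma_algebra => /=.
rewrite -bigcup_seq/=; exists i => /=; first by rewrite mem_index_enum.
by exists Y => //; rewrite setTI.
Qed.

End rV_measurable.

Lemma measurable_fun_rVP d (T : measurableType d) (R : realType) n
    (f : T -> 'rV[R]_n) :
  (forall i, measurable_fun [set: T] (rV_coord i \o f)) ->
  measurable_fun [set: T] f.
Proof.
move=> mf; apply: (@measurability _ _ _ _ _ _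
  (\big[setU/set0]_(i < n)
    preimage_set_system setT (@rV_coord R n i) measurable)) => //.
move=> _ [A + <-]; rewrite setTI -bigcup_seq /= => -[i _ [B mB <-]].
by have := mf i measurableT B mB; rewrite !setTI.
Qed.

Section lebesgue_rV.
Context {R : realType}.

Definition rV_cons n (p : measurableTypeR R * 'rV[R]_n) : 'rV[R]_n.+1 :=
  row_mx (const_mx p.1 : 'rV_1) p.2.

Definition rV_uncons n (x : 'rV[R]_n.+1) : measurableTypeR R * 'rV[R]_n :=
  (x 0 0, \row_i x 0 (lift 0 i)).

Lemma rV_consE0 n p : @rV_cons n p 0 0 = p.1.
Proof.
rewrite /rV_cons mxE; case: splitP => [j _|j //]; by rewrite mxE.
Qed.

Lemma rV_consES n p i : @rV_cons n p 0 (lift 0 i) = p.2 0 i.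
Proof.
rewrite /rV_cons mxE; case: splitP => [j|j] /=; first by rewrite ord1.
by rewrite /bump leq0n => -[/val_inj ->].
Qed.

Lemma rV_consK n : cancel (@rV_cons n) (@rV_uncons n).
Proof.
move=> [x v]; rewrite /rV_uncons rV_consE0; congr pair.
by apply/rowP => i; rewrite mxE rV_consES.
Qed.

Lemma measurable_rV_cons n : measurable_fun setT (@rV_cons n).
Proof.
apply: measurable_fun_rVP => i.
have [j ->|->] := unliftP 0 i.
  rewrite (_ : _ \o _ = rV_coord j \o snd).
    apply: measurableT_comp; first exact: measurable_rV_coord.
    exact: measurable_snd.
  by apply/funext => p /=; rewrite /rV_coord rV_consES.
rewrite (_ : _ \o _ = fst); first exact: measurable_fst.
by apply/funext => p /=; rewrite /rV_coord rV_consE0.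
Qed.

Lemma measurable_rV_uncons n : measurable_fun setT (@rV_uncons n).
Proof.
apply: measurable_fun_pair; first exact: measurable_rV_coord.
apply: measurable_fun_rVP => i.
rewrite (_ : _ \o _ = rV_coord (lift 0 i)); first exact: measurable_rV_coord.
by apply/funext => p /=; rewrite /rV_coord mxE.
Qed.

Section step.
Variables (n : nat) (m : {sigma_finite_measure set 'rV[R]_n -> \bar R}).

Definition lebesgue_rV_step : set 'rV[R]_n.+1 -> \bar R :=
  pushforward (lebesgue_measure \x m)%E (@rV_cons n).

Let step0 : lebesgue_rV_step set0 = 0%E.
Proof. by rewrite /lebesgue_rV_step /pushforward preimage_set0 measure0. Qed.

Let step_ge0 A : (0 <= lebesgue_rV_step A)%E.
Proof. by rewrite /lebesgue_rV_step /pushforward measure_ge0. Qed.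

Let step_sigma_additive : semi_sigma_additive lebesgue_rV_step.
Proof.
move=> F mF tF mUF; rewrite /lebesgue_rV_step /pushforward preimage_bigcup.
have mp A : measurable A -> measurable (@rV_cons n @^-1` A).
  by move=> mA; rewrite -[X in measurable X]setTI; exact: measurable_rV_cons.
apply: measure_semi_sigma_additive => [k||].
- exact: mp.
- apply/trivIsetP => /= i j _ _ ij; rewrite -preimage_setI.
  by move/trivIsetP : tF => /(_ _ _ _ _ ij) ->//; rewrite preimage_set0.
- by rewrite -preimage_bigcup; exact: mp.
Qed.

HB.instance Definition _ := isMeasure.Build _ _ _ lebesgue_rV_step
  step0 step_ge0 step_sigma_additive.

Let step_sigma_finite : sigma_finite setT lebesgue_rV_step.
Proof.
have /sigma_finiteP[F [TF ndF Foo]] := sigma_finiteT (@lebesgue_measure R).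
have /sigma_finiteP[G [TG ndG Goo]] := sigma_finiteT m.
exists (fun k => @rV_uncons n @^-1` (F k `*` G k)).
  apply/seteqP; split=> // x _; rewrite -preimage_bigcup /=.
  have [i _ Fi] : (\bigcup_i F i) (rV_uncons x).1 by rewrite -TF.
  have [j _ Gj] : (\bigcup_i G i) (rV_uncons x).2 by rewrite -TG.
  exists (maxn i j) => //; split.
    by move: Fi; exact/subsetPset/ndF/leq_maxl.
  by move: Gj; exact/subsetPset/ndG/leq_maxr.
move=> k; have [mF Fk] := Foo k; have [mG Gk] := Goo k; split.
  rewrite -[X in measurable X]setTI; apply: measurable_rV_uncons => //.
  exact: measurableX.
rewrite /lebesgue_rV_step /pushforward -comp_preimage.
rewrite (_ : _ \o _ = id); last by apply/funext => p; exact: rV_consK.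
by rewrite preimage_id product_measure1E// lte_mul_pinfty// ge0_fin_numE.
Qed.

HB.instance Definition _ := Measure_isSigmaFinite.Build _ _ _ lebesgue_rV_step
  step_sigma_finite.

End step.

Fixpoint lebesgue_rV n : {sigma_finite_measure set 'rV[R]_n -> \bar R} :=
  if n is n'.+1 then lebesgue_rV_step (lebesgue_rV n') else \d_(0 : 'rV[R]_0).

(* This box formula characterises Lebesgue measure on R^n. *)
Lemma lebesgue_rV_box n (A : 'I_n -> set (measurableTypeR R)) :
  (forall i, measurable (A i)) ->
  lebesgue_rV n [set x : 'rV[R]_n | forall i, A i (x 0 i)] =
  (\prod_(i < n) lebesgue_measure (A i))%E.
Proof.
elim: n A => [|n IHn] A mA.
  by rewrite big_ord0 /= diracE mem_set//= => -[].
have mB : measurable [set x : 'rV[R]_n | forall i, A (lift 0 i) (x 0 i)].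
  rewrite (_ : mkset _ = \big[setI/setT]_i (rV_coord i @^-1` A (lift 0 i))).
    apply: bigsetI_measurable => i _; rewrite -[X in measurable X]setTI.
    exact: measurable_rV_coord.
  apply/seteqP; split=> x; rewrite -bigcap_seq /= => Ax i.
    by move=> _; exact: Ax.
  by apply: Ax; rewrite /= mem_index_enum.
rewrite big_ord_recl -IHn// -product_measure1E//=.
rewrite /lebesgue_rV_step /pushforward; congr product_measure1.
apply/seteqP; split=> [p Ap|p [Ap0 ApS] i] /=.
  split=> [|i]; first by move: (Ap 0); rewrite rV_consE0.
  by move: (Ap (lift 0 i)); rewrite rV_consES.
by have [j ->|->] := unliftP 0 i; rewrite ?rV_consES ?rV_consE0//; exact: ApS.
Qed.

End lebesgue_rV.

Section schwartz_space.
Context {R : realType} {n : nat}.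
Implicit Types (f g : 'rV[R]_n -> R[i]) (u : ('rV[R]_n -> R[i]) -> R[i]).

Definition cpartial (i : 'I_n) f : 'rV[R]_n -> R[i] := fun x =>
  'D_(delta_mx 0 i) (fun y => complex.Re (f y)) x +i*
  'D_(delta_mx 0 i) (fun y => complex.Im (f y)) x.

Definition cpartials (s : seq 'I_n) f : 'rV[R]_n -> R[i] := foldr cpartial f s.

Definition smooth f := forall (s : seq 'I_n) (x : 'rV[R]_n),
  differentiable (fun y => complex.Re (cpartials s f y)) x /\
  differentiable (fun y => complex.Im (cpartials s f y)) x.

(* [`|x|] is the sup norm on 'rV[R]_n; any other norm on R^n yields the same
   Schwartz space and the same topology. *)
Definition schwartz_seminorm (k : nat) (s : seq 'I_n) f : \bar R :=
  ereal_sup [set ((1 + `|x|) ^+ k * normc (cpartials s f x))%:E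
            | x in [set: 'rV[R]_n]].

Definition schwartz f :=
  smooth f /\ forall k s, (schwartz_seminorm k s f < +oo)%E.

(* Functionals on the Schwartz space are represented by maps on all functions;
   their values outside the Schwartz space are irrelevant, like those of a
   measure on non-measurable sets. *)

(* Continuity for the topology generated by the seminorms above, written out
   on its basic neighbourhoods. *)
Definition schwartz_continuous u :=
  forall f, schwartz f -> forall e : R, 0 < e ->
  exists N : nat, exists2 r : R, 0 < r &
  forall g, schwartz g ->
    (forall k s, (k <= N)%N -> (size s <= N)%N ->
      (schwartz_seminorm k s (fun x => g x - f x)%R < r%:E)%E) ->
    normc (u g - u f) < e.

(* The pairing <u, f> is sesquilinear, hence antilinear in the test function. *)
Definition tempered_distribution u :=
  (forall (c : R[i]) f g, schwartz f -> schwartz g ->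
     u (fun x => c * f x + g x) = conjc c * u f + u g) /\
  schwartz_continuous u.

(* [T g f] stands for <T g, f>.  The last clause is continuity into the space
   of tempered distributions with its weak-* topology. *)
Definition schwartz_operator
    (T : ('rV[R]_n -> R[i]) -> ('rV[R]_n -> R[i]) -> R[i]) :=
  [/\ forall g, schwartz g -> tempered_distribution (T g),
      forall (c : R[i]) g h f, schwartz g -> schwartz h -> schwartz f ->
        T (fun x => c * g x + h x) f = c * T g f + T h f
    & forall f, schwartz f -> schwartz_continuous (T ^~ f)].

End schwartz_space.

Section time_frequency.
Context {R : realType}.

Definition dotr n (x y : 'rV[R]_n) : R := \sum_i x 0 i * y 0 i.

Definition cis (t : R) : R[i] := cos t +i* sin t.

Definition cintegral n (f : 'rV[R]_n -> R[i]) : R[i] :=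
  (\int[lebesgue_rV n]_x complex.Re (f x)) +i*
  (\int[lebesgue_rV n]_x complex.Im (f x)).

Definition tfshift n (a b : 'rV[R]_n) (f : 'rV[R]_n -> R[i]) :
    'rV[R]_n -> R[i] :=
  fun t => cis (2 * pi * dotr b t) * f (t - a).

Definition gaussian n : 'rV[R]_n -> R[i] :=
  fun t => (2 `^ (n%:R / 4) * expR (- pi * dotr t t))%:C.

(* Test functions sit in the antilinear slot: V_g u (a, b) = <u, pi(a, b) g>. *)
Definition stft n (g : 'rV[R]_n -> R[i]) (u : ('rV[R]_n -> R[i]) -> R[i])
    (a b : 'rV[R]_n) : R[i] :=
  u (tfshift a b g).

(* L^p norm in the first variable, then L^q norm in the second one. *)
Definition mixed_norm n (p q : \bar R) (F : 'rV[R]_n -> 'rV[R]_n -> R[i]) :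
    \bar R :=
  Lnorm (lebesgue_rV n) q (fun b =>
    Lnorm (lebesgue_rV n) p (fun a => (normc (F a b))%:E)).

Definition modulation_space n (p q : \bar R)
    (u : ('rV[R]_n -> R[i]) -> R[i]) :=
  tempered_distribution u /\
  (mixed_norm p q (stft (@gaussian n) u) < +oo)%E.

(* Phase space R^2d is 'rV[R]_(d + d), a point being (position, frequency). *)
Definition phase_shift d (w : 'rV[R]_(d + d)) (f : 'rV[R]_d -> R[i]) :
    'rV[R]_d -> R[i] :=
  tfshift (lsubmx w) (rsubmx w) f.

Definition gabor_matrix d
    (T : ('rV[R]_d -> R[i]) -> ('rV[R]_d -> R[i]) -> R[i])
    (w z : 'rV[R]_(d + d)) : R[i] :=
  T (phase_shift w (@gaussian d)) (phase_shift z (@gaussian d)).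

Definition operator_modulation_space d (r s : \bar R)
    (T : ('rV[R]_d -> R[i]) -> ('rV[R]_d -> R[i]) -> R[i]) :=
  schwartz_operator T /\ (mixed_norm r s (gabor_matrix T) < +oo)%E.

Definition wigner d (f g : 'rV[R]_d -> R[i]) : 'rV[R]_(d + d) -> R[i] :=
  fun z => cintegral (fun t =>
    f (lsubmx z + 2^-1 *: t) * conjc (g (lsubmx z - 2^-1 *: t)) *
    cis (- (2 * pi * dotr (rsubmx z) t))).

Definition weyl_symbol d
    (T : ('rV[R]_d -> R[i]) -> ('rV[R]_d -> R[i]) -> R[i])
    (sigma : ('rV[R]_(d + d) -> R[i]) -> R[i]) :=
  tempered_distribution sigma /\
  forall f g, schwartz f -> schwartz g -> T g f = sigma (wigner f g).

End time_frequency.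

(* Main.v *)
(* The cross-Wigner distribution of two time-frequency shifts of the Gaussian,
   by z and by w, is a unimodular constant times C times the time-frequency shift
   of the Gaussian g_2 = exp (- 2 pi |.|^2) by (z + w) / 2 in position and by
   b = J (z - w) in frequency, where J (b_1, b_2) = (b_2, - b_1).  Hence
     |Q T (w, z)| = C |V_{g_2} sigma ((z + w) / 2, J (z - w))|,
   and, after the measure preserving substitutions w = z + J b in one norm and
   a = z + J b / 2 in the other, the two norms are mixed norms of the same
   function |V_{g_2} sigma (z + J b / 2, b)|, taken first in b or first in z.
   Minkowski's inequality compares them.

   That the space M^{p,q} does not change when the window exp (- pi |.|^2) is
   replaced by g_2 is shown one coordinate at a time, without vector-valued
   integrals.  A narrower Gaussian is a limit of averages of modulations of the
   wider one, because cos (x / sqrt N) ^ N tends to exp (- x^2 / 2); a wider one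
   is likewise a limit of averages of translations of the narrower one, by the
   Fourier transform of the Gaussian.  The averages converge pointwise with
   bounded seminorms, hence in the Schwartz space, and the norm inequality
   passes to the limit by Fatou's lemma. *)
Require Import Defs.
From mathcomp Require Import all_boot all_order all_algebra all_fingroup complex.
From mathcomp Require Import all_classical all_reals all_analysis.
From mathcomp Require Import measurable_realfun ess_sup_inf.
From mathcomp Require Import ring lra.

Set Implicit Arguments.
Unset Strict Implicit.
Unset Printing Implicit Defensive.

Import Order.TTheory GRing.Theory Num.Theory.
Import numFieldNormedType.Exports.
Import ComplexField.Normc.

Local Open Scope classical_set_scope.
Local Open Scope complex_scope.
Local Open Scope ring_scope.

(** A tempered distribution is given only as an antilinear functional that is continuous on the
    Schwartz space: it can be applied to finite sums and to limits of sequences, but not under an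
    integral of windows. This dictates the form of the change of window. Convolution with a Gaussian
    is replaced by the average over a symmetric random walk of N + 1 steps of length k / sqrt (N +
    1), a finite sum with weights 2^-(N+1), and a central limit theorem restores the Gaussian. The
    seminorms of a shifted Gaussian grow polynomially in the shift; the exponential moments of the
    walk, bounded uniformly in N, keep the averages bounded. Since the mixed norms are invariant
    under translation in either variable, averaging shifted copies does not increase them.

    The direct half of the theorem needs the widening from g_2 to the standard window, the converse
    half the narrowing. Measurability is also obtained from sequences alone, by rounding the
    arguments to finer and finer grids. *)

(** * Lebesgue measure under translations and signed permutations *)

Section rV_maps.
Context {R : realType}.

Lemma lebesgue_measure_addl (c : R) (A : set (measurableTypeR R)) :
  measurable A ->
  lebesgue_measure ((fun x : measurableTypeR R => c + x : measurableTypeR R)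
    @^-1` A) = lebesgue_measure A.
Proof.
move=> mA.
have mf : measurable_fun [set: measurableTypeR R]
    (fun x : measurableTypeR R => c + x : measurableTypeR R).
  by apply: measurable_funD => //; exact: measurable_cst.
apply/esym.
apply: (@lebesgue_measure_unique _ (pushforward lebesgue_measure
  (fun x : measurableTypeR R => c + x : measurableTypeR R))) => // _ [[a b]] _ <-.
transitivity (lebesgue_measure (`](a - c), (b - c)]%classic : set (measurableTypeR R))); last first.
  congr lebesgue_measure.
  by apply/seteqP; split=> x /=; rewrite !in_itv/= ltrBlDl lerBrDl.
rewrite !lebesgue_measure_itv/= !lte_fin ltrD2r.
by case: ifP => // _; rewrite -!EFinB; congr EFin; lra.
Qed.

Lemma lebesgue_measure_signed_shift (c : R) (b : bool)
    (A : set (measurableTypeR R)) : measurable A ->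
  lebesgue_measure ((fun x : measurableTypeR R =>
    c + (-1) ^+ b * x : measurableTypeR R) @^-1` A) = lebesgue_measure A.
Proof.
move=> mA; case: b; last first.
  rewrite expr0; under eq_fun do rewrite mul1r; exact: lebesgue_measure_addl.
rewrite -[RHS](lebesgue_measure_addl c)//.
rewrite -[RHS]lebesgue_measureN//; last first.
  rewrite -[X in measurable X]setTI.
  have mf : measurable_fun [set: measurableTypeR R]
      (fun x : measurableTypeR R => c + x : measurableTypeR R).
    by apply: measurable_funD => //; exact: measurable_cst.
  exact: mf.
congr lebesgue_measure; apply/seteqP; split=> x /=;
  by rewrite expr1 mulN1r.
Qed.

Definition rV_box n (A : 'I_n -> set (measurableTypeR R)) : set 'rV[R]_n :=
  [set x : 'rV[R]_n | forall i, A i (x 0 i)].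

Lemma measurable_rV_box n (A : 'I_n -> set (measurableTypeR R)) :
  (forall i, measurable (A i)) -> measurable (rV_box A).
Proof.
move=> mA; rewrite (_ : rV_box A = \big[setI/setT]_i (rV_coord i @^-1` A i)).
  apply: bigsetI_measurable => i _; rewrite -[X in measurable X]setTI.
  exact: measurable_rV_coord.
apply/seteqP; split=> x; rewrite -bigcap_seq /= => Ax i.
  by move=> _; exact: Ax.
by apply: Ax; rewrite /= mem_index_enum.
Qed.

(** Boxes are stable under intersection and generate the sigma-algebra, and the cubes of half-side k
    exhaust the space with finite measure. *)
Lemma lebesgue_rV_unique n (m : {measure set 'rV[R]_n -> \bar R}) :
  (forall A : 'I_n -> set (measurableTypeR R), (forall i, measurable (A i)) ->
    m (rV_box A) = lebesgue_rV n (rV_box A)) ->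
  forall X, measurable X -> lebesgue_rV n X = m X.
Proof.
move=> mE X mX.
pose G := [set rV_box A | A in
  [set A : 'I_n -> set (measurableTypeR R) | forall i, measurable (A i)]].
pose g (k : nat) := @rV_box n (fun=> `[- k%:R, k%:R]%classic).
apply: (@measure_unique _ _ _ G g) => //.
- apply/seteqP; split.
    apply: smallest_sub; first exact: smallest_sigma_algebra.
    move=> Y; rewrite -bigcup_seq /= => -[i _ [B mB <-]].
    apply: sub_sigma_algebra; exists (fun j => if j == i then B else setT).
      by move=> j /=; case: ifP.
    apply/seteqP; split=> [x /(_ i)|x [_ Bx] j]; first by rewrite eqxx.
    by case: eqP => [->|].
  apply: smallest_sub; first exact: sigma_algebra_measurable.
  by move=> _ [A mA <-]; exact: measurable_rV_box.
- move=> _ _ [A mA <-] [B mB <-]; exists (fun i => A i `&` B i).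
    by move=> i; apply: measurableI; [exact: mA|exact: mB].
  apply/seteqP; split=> [x AB|x [Ax Bx] i]; last by split.
  by split=> i; have [] := AB i.
- by move=> k; exists (fun=> `[- k%:R, k%:R]%classic) => // i /=.
- apply/seteqP; split=> // x _.
  pose M := \sum_i `|x 0 i|.
  exists (Num.bound M) => // i; rewrite /= in_itv/= -ler_norml.
  apply/ltW/(le_lt_trans _ (archi_boundP _)); last exact: sumr_ge0.
  by rewrite /M (bigD1 i)//= lerDl sumr_ge0.
- by move=> _ [A mA <-]; rewrite mE.
- move=> k; rewrite [ltLHS](lebesgue_rV_box (A := fun=> `[- k%:R, k%:R]%classic))//.
  rewrite ltey_eq; apply/orP; left; elim/big_ind: _ => //.
    exact: fin_numM.
  by move=> i _; rewrite lebesgue_measure_itv; case: ifP.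
Qed.

(** One family of maps for both the translations and the substitution w = z + J b. Preimages of
    boxes are boxes, so invariance of the measure reduces to one variable and requires no
    determinant. *)
Definition signed_perm_shift n (c : 'rV[R]_n) (e : 'I_n -> bool) (s : 'S_n)
  (x : 'rV[R]_n) : 'rV[R]_n := \row_i (c 0 i + (-1) ^+ e i * x 0 (s i)).

Lemma measurable_signed_perm_shift n (c : 'rV[R]_n) e s :
  measurable_fun setT (signed_perm_shift c e s).
Proof.
apply: measurable_fun_rVP => i.
rewrite (_ : _ \o _ = fun x => c 0 i + (-1) ^+ e i * rV_coord (s i) x).
  apply: measurable_funD => //; apply: measurable_funM => //.
  exact: measurable_rV_coord.
by apply/funext => x /=; rewrite /rV_coord mxE.
Qed.

Lemma lebesgue_rV_signed_perm_shift n (c : 'rV[R]_n) e s X : measurable X ->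
  lebesgue_rV n (signed_perm_shift c e s @^-1` X) = lebesgue_rV n X.
Proof.
move=> mX; pose f := signed_perm_shift c e s.
have mf : measurable_fun setT f by exact: measurable_signed_perm_shift.
pose F : {mfun 'rV[R]_n >-> 'rV[R]_n} := mfun_Sub (mem_set mf).
apply/esym; apply: (@lebesgue_rV_unique n (pushforward (lebesgue_rV n) F)) => //.
move=> A mA; rewrite /pushforward/=.
pose aff i (x : measurableTypeR R) : measurableTypeR R := c 0 i + (-1) ^+ e i * x.
have maff i : measurable_fun setT (aff i).
  by apply: measurable_funD => //; apply: measurable_funM.
(* Factor j of the box constrains coordinate [s j] of x, hence factor i of the preimage carries the
   index s^-1 i. *)
have mB i : measurable (aff ((s^-1)%g i) @^-1` A ((s^-1)%g i)).
  by rewrite -[X in measurable X]setTI; exact: maff.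
transitivity
  (lebesgue_rV n (rV_box (fun i => aff ((s^-1)%g i) @^-1` A ((s^-1)%g i)))).
  congr (lebesgue_rV n _).
  apply/seteqP; split=> x /= Ax i; first by have := Ax ((s^-1)%g i); rewrite mxE permKV.
  by have := Ax (s i); rewrite permK mxE.
rewrite !lebesgue_rV_box//.
rewrite (reindex_inj (@perm_inj _ s)) /=; apply: eq_bigr => i _.
by rewrite permK lebesgue_measure_signed_shift.
Qed.

End rV_maps.

(** * Lower limits of extended real sequences *)

Section liminf.
Context {R : realType}.
Local Open Scope ereal_scope.
Implicit Types u v : (\bar R)^nat.

Lemma limn_einfE u : limn_einf u = ereal_sup (range (einfs u)).
Proof. by rewrite limn_einf_lim; apply/cvg_lim => //; exact: cvg_einfs_sup. Qed.

Lemma limn_einf_leP u l :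
  (forall n, einfs u n <= l) -> limn_einf u <= l.
Proof.
by move=> ul; rewrite limn_einfE; apply: ge_ereal_sup => _ [n _ <-].
Qed.

Lemma einfs_le_limn u n : einfs u n <= limn_einf u.
Proof. by rewrite limn_einfE; apply: ereal_sup_ubound; exists n. Qed.

Lemma einfs_leP u n m : (n <= m)%N -> einfs u n <= u m.
Proof. by move=> nm; apply: ereal_inf_lbound; exists m. Qed.

Lemma le_einfs u n l : (forall m, (n <= m)%N -> l <= u m) -> l <= einfs u n.
Proof. by move=> lu; apply: le_ereal_inf_tmp => _ [m /= nm <-]; exact: lu. Qed.

Lemma limn_einf_ge0 u : (forall n, 0 <= u n) -> 0 <= limn_einf u.
Proof. by move=> u0; apply: le_trans (einfs_le_limn u 0); exact: le_einfs. Qed.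

Lemma le_limn_einf u v : (forall n, u n <= v n) -> limn_einf u <= limn_einf v.
Proof.
move=> uv; apply: limn_einf_leP => n; apply: le_trans (einfs_le_limn v n).
by apply: le_einfs => m nm; apply: le_trans (uv m); exact: einfs_leP.
Qed.

Lemma limn_einf_cst (l : \bar R) : limn_einf (fun=> l) = l.
Proof.
apply/eqP; rewrite eq_le; apply/andP; split.
  by apply: limn_einf_leP => n; apply: einfs_leP (leqnn n).
by apply: le_trans (einfs_le_limn _ 0); exact: le_einfs.
Qed.

Lemma le0_poweR (x y : \bar R) (r : R) :
  (0 <= r)%R -> 0 <= x -> x <= y -> x `^ r <= y `^ r.
Proof.
move=> r0 x0 xy; apply: gt0_ler_poweR => //.
  by rewrite in_itv/= x0 leey.
by rewrite in_itv/= (le_trans x0 xy) leey.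
Qed.

(** Monotonicity of powers is enough: the r-th power of a tail infimum bounds the tail of the powers
    from below, and the exponent r^-1 undoes the power. *)
Lemma limn_einf_poweR u (r : R) : (0 < r)%R -> (forall n, 0 <= u n) ->
  (limn_einf u) `^ r <= limn_einf (fun n => u n `^ r).
Proof.
move=> r0 u0; set L := limn_einf (fun n => u n `^ r).
have L0 : 0 <= L by apply: limn_einf_ge0 => n; exact: poweR_ge0.
have -> : L = (L `^ r^-1) `^ r.
  by rewrite -poweRrM mulVf ?gt_eqF// poweRe1.
apply: le0_poweR; [exact: ltW|exact: limn_einf_ge0|].
apply: limn_einf_leP => n.
have e0 : 0 <= einfs u n by exact: le_einfs.
have -> : einfs u n = (einfs u n `^ r) `^ r^-1.
  by rewrite -poweRrM mulfV ?gt_eqF// poweRe1.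
apply: le0_poweR; [by rewrite invr_ge0 ltW|exact: poweR_ge0|].
apply: le_trans (einfs_le_limn _ n).
apply: le_einfs => m nm; apply: le0_poweR => //; first exact: ltW.
exact: einfs_leP.
Qed.

End liminf.

(** * Norms of nonnegative extended-valued functions *)

Section Lnorm_ge0.
Context d (T : measurableType d) {R : realType}.
Variable mu : {measure set T -> \bar R}.
Local Open Scope ereal_scope.
Implicit Types (f g : T -> \bar R) (p : \bar R) (r : R).

Lemma Lnorm_ge0_fin f r : (forall x, 0 <= f x) ->
  Lnorm mu r%:E f = (\int[mu]_x (f x `^ r)) `^ r^-1.
Proof.
by move=> f0; rewrite unlock; under eq_integral do rewrite gee0_abs//.
Qed.

Lemma Lnorm_ge0_pinfty f : (forall x, 0 <= f x) ->
  Lnorm mu +oo f = if mu [set: T] > 0 then ess_sup mu f else 0.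
Proof.
move=> f0; rewrite unlock; case: ifPn => // _; congr ess_sup.
by apply/funext => x /=; rewrite gee0_abs.
Qed.

Lemma measurable_fun_poweR f r : measurable_fun setT f ->
  measurable_fun setT (fun x => f x `^ r).
Proof. exact: (@measurableT_comp _ _ _ _ _ _ (poweR^~ r) _ f (measurable_poweR _)). Qed.

Lemma ae_le_Lnorm f g p : 1 <= p ->
  measurable_fun setT f -> measurable_fun setT g ->
  (forall x, 0 <= f x) -> (forall x, 0 <= g x) ->
  {ae mu, forall x, f x <= g x} -> Lnorm mu p f <= Lnorm mu p g.
Proof.
case: p => [r|_|//]; last first.
  move=> _ _ f0 g0 fg; rewrite !Lnorm_ge0_pinfty//.
  by case: ifPn => // _; exact: le_ess_sup.
rewrite lee_fin => r1 mf mg f0 g0 fg; rewrite !Lnorm_ge0_fin//.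
have r0 : (0 <= r)%R by apply: le_trans r1.
apply: le0_poweR; first by rewrite invr_ge0.
  by apply: integral_ge0 => x _; exact: poweR_ge0.
apply: ae_ge0_le_integral => //.
- by move=> x _; exact: poweR_ge0.
- exact: measurable_fun_poweR.
- by move=> x _; exact: poweR_ge0.
- exact: measurable_fun_poweR.
- by apply: filterS fg => x fgx _; exact: le0_poweR.
Qed.

Lemma le_Lnorm f g p : 1 <= p ->
  measurable_fun setT f -> measurable_fun setT g ->
  (forall x, 0 <= f x) ->
  (forall x, f x <= g x) -> Lnorm mu p f <= Lnorm mu p g.
Proof.
move=> p1 mf mg f0 fg; apply: ae_le_Lnorm => //; last exact: aeW.
by move=> x; apply: le_trans (fg x).
Qed.

Lemma measurable_fun_limn_einf (f : (T -> \bar R)^nat) :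
  (forall n, measurable_fun setT (f n)) ->
  measurable_fun setT (fun x => limn_einf (f ^~ x)).
Proof.
move=> mf; rewrite /limn_einf; apply: measurableT_comp => //.
apply: measurable_fun_limn_esup => n.
by apply: measurableT_comp.
Qed.

(** Fatou's lemma in L^p. For p = +oo the countably many exceptional null sets are united before the
    limit is taken. *)
Lemma Lnorm_limn_einf (f : (T -> \bar R)^nat) p : 1 <= p ->
  (forall n, measurable_fun setT (f n)) -> (forall n x, 0 <= f n x) ->
  Lnorm mu p (fun x => limn_einf (f ^~ x)) <=
  limn_einf (fun n => Lnorm mu p (f n)).
Proof.
case: p => [r|_|//]; last first.
  move=> mf f0; rewrite Lnorm_ge0_pinfty; last first.
    by move=> x; exact: limn_einf_ge0.
  case: ifPn => mu0; last by apply: limn_einf_ge0 => n; exact: Lnorm_ge0.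
  apply/ess_supP.
  have : {ae mu, forall x n, f n x <= ess_sup mu (f n)}.
    by apply/ae_foralln => n; exact: ess_sup_ge.
  apply: filterS => x fx; apply: le_limn_einf => n.
  by rewrite Lnorm_ge0_pinfty// mu0.
rewrite lee_fin => r1 mf f0; have r0 : (0 < r)%R by apply: lt_le_trans r1.
rewrite Lnorm_ge0_fin; last by move=> x; exact: limn_einf_ge0.
have -> : (fun n => Lnorm mu r%:E (f n)) =
    (fun n => (\int[mu]_x (f n x `^ r)) `^ r^-1).
  by apply/funext => n; rewrite Lnorm_ge0_fin.
apply: le_trans (limn_einf_poweR _ _); last 2 first.
- by rewrite invr_gt0.
- by move=> n; apply: integral_ge0 => x _; exact: poweR_ge0.
apply: le0_poweR; first by rewrite invr_ge0 ltW.
  by apply: integral_ge0 => x _; exact: poweR_ge0.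
apply: le_trans (fatou _ _ _ _) => //; last 2 first.
- by move=> n; exact: measurable_fun_poweR.
- by move=> n x _; exact: poweR_ge0.
apply: ge0_le_integral => //.
- by move=> x _; exact: poweR_ge0.
- by apply: measurable_fun_poweR; exact: measurable_fun_limn_einf.
- apply: measurable_fun_limn_einf => n; exact: measurable_fun_poweR.
- by move=> x _; exact: limn_einf_poweR.
Qed.

(** The device by which norm bounds pass from truncations and from walk averages to their limits:
    only a pointwise bound by the lower limit is required, not convergence. *)
Lemma Lnorm_limn_einf_le (f : T -> \bar R) (F : (T -> \bar R)^nat) p l :
  1 <= p -> measurable_fun setT f -> (forall x, 0 <= f x) ->
  (forall n, measurable_fun setT (F n)) -> (forall n x, 0 <= F n x) ->
  (forall x, f x <= limn_einf (F ^~ x)) ->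
  (forall n, Lnorm mu p (F n) <= l) -> Lnorm mu p f <= l.
Proof.
move=> p1 mf f0 mF F0 fF Fl; apply: le_trans (le_Lnorm _ _ _ _ fF) _ => //.
  exact: measurable_fun_limn_einf.
apply: le_trans (Lnorm_limn_einf _ _ _) _ => //.
by rewrite -[leRHS]limn_einf_cst; exact: le_limn_einf.
Qed.

(* Truncations reduce extended-valued statements to real-valued ones. *)
Definition etrunc f n : T -> R := fun x => fine (mine (f x) n%:R%:E).

Lemma etruncE f n x : 0 <= f x -> (etrunc f n x)%:E = mine (f x) n%:R%:E.
Proof.
move=> f0; rewrite /etrunc fineK//; case: (f x) f0 => [r| |]//=.
by rewrite -EFin_min.
Qed.

Lemma etrunc_ge0 f n x : 0 <= f x -> (0 <= etrunc f n x)%R.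
Proof.
by move=> f0; rewrite -lee_fin etruncE// le_min f0 lee_fin ler0n.
Qed.

Lemma etrunc_le f n x : 0 <= f x -> (etrunc f n x)%:E <= f x.
Proof. by move=> f0; rewrite etruncE// ge_min lexx. Qed.

Lemma etrunc_len f n x : 0 <= f x -> (etrunc f n x <= n%:R)%R.
Proof. by move=> f0; rewrite -lee_fin etruncE// ge_min lexx orbT. Qed.

Lemma measurable_etrunc f n : measurable_fun setT f ->
  measurable_fun setT (etrunc f n).
Proof.
move=> mf; apply: measurableT_comp => //.
apply: measurable_mine => //; exact: measurable_cst.
Qed.

Lemma limn_einf_etrunc f x : 0 <= f x ->
  f x <= limn_einf (fun n => (etrunc f n x)%:E).
Proof.
move=> f0; case fx: (f x) f0 => [r| |]// f0.
  pose m := Num.bound r.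
  apply: le_trans (einfs_le_limn _ m); apply: le_einfs => n mn.
  rewrite etruncE fx//= le_min lexx/= lee_fin.
  by rewrite (le_trans (ltW (archi_boundP f0)))// ler_nat.
rewrite leye_eq; apply/eqP/eq_infty => t; pose m := Num.bound `|t|%R.
apply: le_trans (einfs_le_limn _ m); apply: le_einfs => n mn.
rewrite etruncE fx//= lee_fin (le_trans (ler_norm t))//.
by rewrite (le_trans (ltW (archi_boundP (normr_ge0 t))))// ler_nat.
Qed.

(** Minkowski's inequality for real functions is applied to truncations, since min (f + g, n) is at
    most min (f, n) + min (g, n). *)
Lemma Lnorm_triangle f g p : 1 <= p ->
  measurable_fun setT f -> measurable_fun setT g ->
  (forall x, 0 <= f x) -> (forall x, 0 <= g x) ->
  Lnorm mu p (fun x => f x + g x) <= Lnorm mu p f + Lnorm mu p g.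
Proof.
move=> p1 mf mg f0 g0.
have mfg : measurable_fun setT (fun x => f x + g x) by exact: emeasurable_funD.
have fg0 x : 0 <= f x + g x by exact: adde_ge0.
apply: (@Lnorm_limn_einf_le _ (fun n => EFin \o etrunc (fun x => f x + g x) n)) => //.
- by move=> n; apply/measurable_EFinP; exact: measurable_etrunc.
- by move=> n x /=; rewrite lee_fin etrunc_ge0.
- by move=> x; exact: limn_einf_etrunc.
move=> n; apply: (@le_trans _ _ (Lnorm mu p (EFin \o (etrunc f n \+ etrunc g n)%R))).
  apply: le_Lnorm => //.
  - by apply/measurable_EFinP; exact: measurable_etrunc.
  - by apply/measurable_EFinP/measurable_funD; exact: measurable_etrunc.
  - by move=> x /=; rewrite lee_fin etrunc_ge0.
  - move=> x /=; rewrite EFinD !etruncE//.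
    have n0 : 0 <= n%:R%:E :> \bar R by rewrite lee_fin.
    have [fn|fn] := leP (f x) n%:R%:E; have [gn|gn] := leP (g x) n%:R%:E;
      rewrite ge_min ?lexx//; apply/orP; right.
    + by rewrite leeDr.
    + by rewrite leeDl.
    + by rewrite leeDl.
apply: le_trans (eminkowski _ _ _ _) _ => //; try exact: measurable_etrunc.
by apply: leeD; apply: le_Lnorm => // [|x|x] /=;
  rewrite ?lee_fin ?etrunc_ge0 ?etrunc_le//;
  apply/measurable_EFinP; exact: measurable_etrunc.
Qed.

Lemma Lnorm_ge0Z f (k : R) p : 1 <= p -> (0 <= k)%R ->
  measurable_fun setT f -> (forall x, 0 <= f x) ->
  Lnorm mu p (fun x => k%:E * f x) = k%:E * Lnorm mu p f.
Proof.
move=> p1 k0 mf f0.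
have kf0 x : 0 <= k%:E * f x by rewrite mule_ge0.
case: p p1 => [r| _ |//]; last first.
  rewrite !Lnorm_ge0_pinfty//; case: ifPn => mu0; last by rewrite mule0.
  by rewrite -ess_supZl.
rewrite lee_fin => r1; have r0 : (0 < r)%R by apply: lt_le_trans r1.
rewrite !Lnorm_ge0_fin//.
under eq_integral do rewrite poweRM// poweR_EFin.
rewrite ge0_integralZl//; last 3 first.
- exact: measurable_fun_poweR.
- by move=> x _; exact: poweR_ge0.
- by rewrite lee_fin powR_ge0.
rewrite poweRM ?poweR_ge0 ?lee_fin ?powR_ge0//; last first.
  by apply: integral_ge0 => x _; exact: poweR_ge0.
by rewrite -poweR_EFin -poweRrM mulfV ?gt_eqF// poweRe1.
Qed.

Lemma Lnorm_sum (I : Type) (s : seq I) (w : I -> R) (f : I -> T -> \bar R) p :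
  1 <= p -> (forall i, 0 <= w i)%R ->
  (forall i, measurable_fun setT (f i)) -> (forall i x, 0 <= f i x) ->
  Lnorm mu p (fun x => \sum_(i <- s) (w i)%:E * f i x) <=
  \sum_(i <- s) (w i)%:E * Lnorm mu p (f i).
Proof.
move=> p1 w0 mf f0; elim: s => [|i s IHs].
  rewrite big_nil (_ : (fun x => _) = cst 0); last first.
    by apply/funext => x; rewrite big_nil.
  by rewrite Lnorm0// gt_eqF// (lt_le_trans _ p1).
rewrite big_cons.
under eq_fun do rewrite big_cons.
have mwf j : measurable_fun setT (fun x => (w j)%:E * f j x).
  exact: measurable_funeM.
apply: le_trans (Lnorm_triangle _ _ _ _ _) _ => //.
- by apply: emeasurable_sum.
- by move=> x; rewrite mule_ge0 ?lee_fin.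
- by move=> x; apply: sume_ge0 => j _; rewrite mule_ge0 ?lee_fin.
by rewrite Lnorm_ge0Z// leeD2l.
Qed.

Lemma measure_preserving_Lnorm f p (phi : T -> T) : 1 <= p ->
  measurable_fun setT phi ->
  (forall X, measurable X -> mu (phi @^-1` X) = mu X) ->
  measurable_fun setT f -> (forall x, 0 <= f x) ->
  Lnorm mu p (f \o phi) = Lnorm mu p f.
Proof.
move=> p1 mphi phiE mf f0.
have mfphi : measurable_fun setT (f \o phi) by exact: measurableT_comp.
case: p p1 => [r| _ |//]; last first.
  rewrite !Lnorm_ge0_pinfty//=; case: ifPn => // mu0.
  (* The essential supremum depends only on the measures of the superlevel sets, which [phi]
     preserves. *)
  rewrite !ess_supEmu0//; congr ereal_inf; apply/seteqP; split => y /=;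
    rewrite comp_preimage phiE//;
    rewrite -[X in measurable X]setTI; apply: mf => //; exact: emeasurable_itv.
move=> r1; rewrite !Lnorm_ge0_fin//=.
congr (_ `^ _).
pose phi' : {mfun T >-> T} := mfun_Sub (mem_set mphi).
rewrite -(@ge0_integral_pushforward _ _ _ _ _ _ mphi mu setT
  (fun y => f y `^ r))//; last 2 first.
- exact: measurable_fun_poweR.
- by move=> y _; exact: poweR_ge0.
apply: eq_measure_integral => A mA _; exact: phiE.
Qed.

End Lnorm_ge0.

(** * Mixed norms and Minkowski's integral inequality *)

Section mixed_Lnorm.
Context d1 d2 (T1 : measurableType d1) (T2 : measurableType d2) {R : realType}.
Variable m1 : {sigma_finite_measure set T1 -> \bar R}.
Variable m2 : {sigma_finite_measure set T2 -> \bar R}.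
Local Open Scope ereal_scope.

Lemma measurable_Lnorm_l (F : T1 * T2 -> \bar R) p : 1 <= p ->
  measurable_fun setT F -> (forall x, 0 <= F x) ->
  measurable_fun setT (fun u => Lnorm m1 p (fun z => F (z, u))).
Proof.
move=> p1 mF F0; case: p p1 => [r r1| _ |//]; last first.
  under eq_fun do rewrite Lnorm_ge0_pinfty//.
  have [mu0|mu0] := ltP 0 (m1 [set: T1]); last exact: measurable_cst.
  apply: (measurability _ (ErealGenOInfty.measurableE R)) => // _ [_ [y ->] <-].
  (* The essential supremum of a section exceeds y exactly when the section of {F > y} has positive
     measure, and that measure is a measurable function of u. *)
  pose A : set (T1 * T2) := F @^-1` `]y%:E, +oo[.
  have mA : measurable A.
    by rewrite -[X in measurable X]setTI; apply: mF => //; exact: emeasurable_itv.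
  have := measurable_fun_ysection m1 mA.
  move=> /(_ measurableT `]0, +oo[%classic (emeasurable_itv _)).
  have mFu u : measurable_fun setT (fun z => F (z, u)).
    exact: measurableT_comp.
  have secE u : ysection A u = (fun z => F (z, u)) @^-1` `]y%:E, +oo[.
    by apply/seteqP; split => z /=; rewrite /ysection/= inE.
  congr measurable; congr (_ `&` _); apply/seteqP; split=> u /=;
    rewrite !in_itv/= !andbT secE !ltNge; apply: contraNN.
    by move=> /ess_supP/ae_le_measureP => ->.
  move=> mA0; apply/ess_supP/ae_le_measureP => //.
  by apply/eqP; rewrite eq_le measure_ge0 andbT.
under eq_fun do rewrite Lnorm_ge0_fin//.
apply: measurable_fun_poweR.
apply: (@measurable_fun_fubini_tonelli_G _ _ _ _ _ m1 (fun x => F x `^ r)).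
  exact: measurable_fun_poweR.
by move=> x; exact: poweR_ge0.
Qed.

End mixed_Lnorm.

Section Minkowski.
Context d1 d2 (T1 : measurableType d1) (T2 : measurableType d2) {R : realType}.
Variable m1 : {sigma_finite_measure set T1 -> \bar R}.
Variable m2 : {sigma_finite_measure set T2 -> \bar R}.
Local Open Scope ereal_scope.

Lemma measurable_Lnorm_r (F : T1 * T2 -> \bar R) p : 1 <= p ->
  measurable_fun setT F -> (forall x, 0 <= F x) ->
  measurable_fun setT (fun z => Lnorm m2 p (fun u => F (z, u))).
Proof.
move=> p1 mF F0.
apply: (@measurable_Lnorm_l _ _ _ _ _ m2 (fun x => F (x.2, x.1))) => //.
apply: (measurableT_comp mF).
exact: measurable_fun_pair measurable_snd measurable_fst.
Qed.

(** Truncation of f reduces this to real-valued functions. Infinite values of f are allowed because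
    the inequality is applied to arbitrary slices of G in [Minkowski_integral]. *)
Lemma hoelder_ge0 (f : T2 -> \bar R) (g : T2 -> R) (p q : R) :
  measurable_fun setT f -> measurable_fun setT g ->
  (forall x, 0 <= f x) -> (forall x, (0 <= g x)%R) ->
  (0 < p)%R -> (0 < q)%R -> (p^-1 + q^-1 = 1)%R ->
  \int[m2]_x (f x * (g x)%:E) <= Lnorm m2 p%:E f * Lnorm m2 q%:E (EFin \o g).
Proof.
move=> mf mg f0 g0 p0 q0 pq.
have p1 : (1 <= p)%R.
  have : (p^-1 <= 1)%R by rewrite -pq lerDl invr_ge0 ltW.
  by rewrite invf_le1.
have fg0 x : 0 <= f x * (g x)%:E by rewrite mule_ge0// lee_fin.
have mfg : measurable_fun setT (fun x => f x * (g x)%:E).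
  by apply: emeasurable_funM => //; exact/measurable_EFinP.
have -> : \int[m2]_x (f x * (g x)%:E) = Lnorm m2 1 (fun x => f x * (g x)%:E).
  by rewrite Lnorm1; apply: eq_integral => x _; rewrite gee0_abs.
apply: (@Lnorm_limn_einf_le _ _ _ _ _
  (fun n x => (etrunc f n x)%:E * (g x)%:E)) => //.
- move=> n; apply: emeasurable_funM; apply/measurable_EFinP => //.
  exact: measurable_etrunc.
- by move=> n x; rewrite mule_ge0// lee_fin// etrunc_ge0.
- move=> x; have := limn_einf_etrunc (f0 x).
  (* Zeros of g are set apart: there one cannot divide by g, and the product vanishes even where f
     is infinite. *)
  have := g0 x; rewrite le_eqVlt => /predU1P[<- _|gx0].
    by rewrite mule0; apply: limn_einf_ge0 => n; rewrite mule0.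
  move=> fx; rewrite muleC -lee_pdivlMl//; apply: le_trans fx _.
  apply: limn_einf_leP => n; rewrite lee_pdivlMl//.
  apply: le_trans (einfs_le_limn _ n); apply: le_einfs => m nm.
  by rewrite muleC lee_pmul2r//; exact: (einfs_leP (fun n => (etrunc f n x)%:E)).
move=> n.
have := hoelder m2 (measurable_etrunc n mf) mg p0 q0 pq.
rewrite (_ : EFin \o _ = (fun x => (etrunc f n x)%:E * (g x)%:E)); last first.
  by apply/funext => x /=; rewrite EFinM.
move=> /le_trans; apply; apply: lee_wpmul2r; first exact: Lnorm_ge0.
apply: le_Lnorm => //.
- by apply/measurable_EFinP; exact: measurable_etrunc.
- by move=> x /=; rewrite lee_fin etrunc_ge0.
- by move=> x /=; rewrite etrunc_le.
Qed.

(* The truncations [H n] of [H u = \int G (z, u) dz] have finite [L^k] norm, so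
   that Hoelder applied to [\int H * (H n)^(k-1)] can be divided by it. *)
Lemma Minkowski_integral (G : T1 * T2 -> \bar R) (k : R) : (1 <= k)%R ->
  measurable_fun setT G -> (forall x, 0 <= G x) ->
  Lnorm m2 k%:E (fun u => \int[m1]_z G (z, u)) <=
  \int[m1]_z Lnorm m2 k%:E (fun u => G (z, u)).
Proof.
rewrite le_eqVlt => /predU1P[<- mG G0|k1 mG G0].
  rewrite Lnorm1 le_eqVlt; apply/orP; left; apply/eqP.
  transitivity (\int[m2]_u \int[m1]_z G (z, u)).
    by apply: eq_integral => u _; rewrite gee0_abs//; exact: integral_ge0.
  rewrite -(fubini_tonelli G)//; apply: eq_integral => z _.
  by rewrite Lnorm1; apply: eq_integral => u _; rewrite gee0_abs.
have k0 : (0 < k)%R by apply: lt_trans k1.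
pose H u := \int[m1]_z G (z, u).
have H0 u : 0 <= H u by exact: integral_ge0.
have mH : measurable_fun setT H by exact: measurable_fun_fubini_tonelli_G.
have /sigma_finiteP[E [TE ndE Eoo]] := sigma_finiteT m2.
(* Besides being cut at height n, the function is restricted to a set of finite measure; both are
   needed for an integrable k-th power. *)
pose Hn n u := (etrunc H n u * \1_(E n) u)%R.
have mHn n : measurable_fun setT (Hn n).
  apply: measurable_funM; first exact: measurable_etrunc.
  by apply: measurable_indic; have [] := Eoo n.
have Hn0 n u : (0 <= Hn n u)%R by rewrite mulr_ge0// etrunc_ge0.
pose K := \int[m1]_z Lnorm m2 k%:E (fun u => G (z, u)).
apply: (@Lnorm_limn_einf_le _ _ _ _ H (fun n u => (Hn n u)%:E)) => //.
- by rewrite lee_fin ltW.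
- by move=> n; exact/measurable_EFinP.
- move=> u; have [i _ Eu] : (\bigcup_i E i) u by rewrite -TE.
  apply: le_trans (limn_einf_etrunc (H0 u)) _.
  apply: limn_einf_leP => n.
  apply: le_trans (einfs_le_limn _ (maxn n i)); apply: le_einfs => m.
  rewrite geq_max => /andP[nm im].
  rewrite /Hn indicE mem_set ?mulr1; last by move: Eu; exact/subsetPset/ndE.
  exact: (einfs_leP (fun n => (etrunc H n u)%:E)).
move=> n.
pose A := \int[m2]_u ((Hn n u)%:E `^ k).
have A0 : 0 <= A by apply: integral_ge0 => u _; exact: poweR_ge0.
have Afin : A < +oo.
  have [mE En] := Eoo n.
  apply: (@le_lt_trans _ _ (\int[m2]_u (((n%:R `^ k)%R)%:E * (\1_(E n) u)%:E))).
    apply: ge0_le_integral => //.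
    - by move=> u _; exact: poweR_ge0.
    - by apply: measurable_fun_poweR; exact/measurable_EFinP.
    - apply: measurable_funeM; apply/measurable_EFinP; exact: measurable_indic.
    - move=> u _; rewrite /Hn indicE; case: (u \in E n) => /=.
        rewrite mulr1 mule1 lee_fin ge0_ler_powR//; first exact: ltW.
        + by rewrite nnegrE etrunc_ge0.
        + by rewrite nnegrE.
        + exact: etrunc_len.
      by rewrite mulr0 mule0 powR0// gt_eqF.
  rewrite ge0_integralZl//; last first.
    by apply/measurable_EFinP; exact: measurable_indic.
  rewrite integral_indic// setIT lte_mul_pinfty ?lee_fin ?powR_ge0//.
have K0 : 0 <= K by apply: integral_ge0 => z _; exact: Lnorm_ge0.
(* The exponent conjugate to k: since (k - 1) k' = k, the L^k' norm of Hn^(k-1) is A^(1/k'). *)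
pose k' := (k / (k - 1))%R.
have k'0 : (0 < k')%R by rewrite divr_gt0// subr_gt0.
have kk' : (k^-1 + k'^-1 = 1)%R.
  by rewrite /k' invf_div mulrBl mulfV ?gt_eqF// mul1r addrC subrK.
pose h u := (Hn n u `^ (k - 1))%R.
have mh : measurable_fun setT h.
  exact: (measurableT_comp (measurable_powR _)).
have h0 u : (0 <= h u)%R by exact: powR_ge0.
have Lh : Lnorm m2 k'%:E (EFin \o h) = A `^ k'^-1.
  rewrite Lnorm_ge0_fin; last by move=> u; rewrite /= lee_fin.
  congr (_ `^ _); apply: eq_integral => u _.
  rewrite /= -powRrM /k' mulrCA mulfV ?mulr1//.
  by rewrite gt_eqF// subr_gt0.
(* Pointwise Hn^k is at most H Hn^(k-1). Tonelli then brings the integral over u inside, where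
   Hoelder bounds every slice. *)
have AK : A <= K * A `^ k'^-1.
  apply: (@le_trans _ _ (\int[m2]_u (H u * (h u)%:E))).
    apply: ge0_le_integral => //.
    - by move=> u _; exact: poweR_ge0.
    - by apply: measurable_fun_poweR; exact/measurable_EFinP.
    - by apply: emeasurable_funM => //; exact/measurable_EFinP.
    - move=> u _; rewrite poweR_EFin /h.
      have -> : (Hn n u `^ k = Hn n u * Hn n u `^ (k - 1))%R.
        by rewrite mulr_powRB1.
      rewrite EFinM lee_wpmul2r ?lee_fin ?powR_ge0//.
      apply: le_trans (etrunc_le n (H0 u)).
      by rewrite lee_fin /Hn ler_piMr ?etrunc_ge0// indicE lern1 leq_b1.
  pose Gh (x : T1 * T2) := G x * (h x.2)%:E.
  have mGh : measurable_fun setT Gh.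
    apply: emeasurable_funM => //; apply/measurable_EFinP.
    exact: measurableT_comp mh measurable_snd.
  have Gh0 x : 0 <= Gh x by rewrite mule_ge0// lee_fin.
  have -> : \int[m2]_u (H u * (h u)%:E) = \int[m2]_u \int[m1]_z Gh (z, u).
    apply: eq_integral => u _; rewrite /H /Gh/= ge0_integralZr//.
    - exact: measurableT_comp.
    - by rewrite lee_fin.
  rewrite -(fubini_tonelli Gh)//.
  rewrite /K -ge0_integralZr//; last 3 first.
  - by apply: measurable_Lnorm_r => //; rewrite lee_fin ltW.
  - by move=> z _; exact: Lnorm_ge0.
  - exact: poweR_ge0.
  apply: ge0_le_integral => //.
  - by move=> z _; apply: integral_ge0.
  - exact: measurable_fun_fubini_tonelli_F.
  - apply: emeasurable_funM => //.
    by apply: measurable_Lnorm_r => //; rewrite lee_fin ltW.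
  move=> z _; rewrite -Lh; apply: hoelder_ge0 => //.
  exact: measurableT_comp.
rewrite Lnorm_ge0_fin//; last by move=> u; rewrite lee_fin.
rewrite -/A -/K.
have [->|An0] := eqVneq A 0; first by rewrite poweR0r// invr_neq0// gt_eqF.
have Agt0 : 0 < A by rewrite lt_def An0.
have Afn : A \is a fin_num by rewrite ge0_fin_numE.
have Ak'0 : 0 < A `^ k'^-1 by exact: poweR_gt0.
have Ak'fn : A `^ k'^-1 \is a fin_num by rewrite fin_num_poweR.
(* The claim A^(1/k) <= K is multiplied by A^(1/k'); the exponents add up to 1, which turns it into
   [AK]. *)
rewrite -(@lee_pmul2r _ (A `^ k'^-1))//.
rewrite -poweRD ?kk' ?poweRe1//.
by rewrite poweRD_defE kk' oner_eq0.
Qed.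

(** For finite exponents, the integral inequality is applied to F^p with the exponent q / p, at
    least 1, and p-th roots are taken. *)
Theorem Minkowski_mixed (F : T1 * T2 -> \bar R) p q : 1 <= p -> p <= q ->
  measurable_fun setT F -> (forall x, 0 <= F x) ->
  Lnorm m2 q (fun u => Lnorm m1 p (fun z => F (z, u))) <=
  Lnorm m1 p (fun z => Lnorm m2 q (fun u => F (z, u))).
Proof.
move=> p1 pq mF F0.
have q1 : 1 <= q by apply: le_trans pq.
case: q q1 pq => [s s1|_ _|//]; last first.
  pose M z := Lnorm m2 +oo (fun u => F (z, u)).
  have mM : measurable_fun setT M by apply: measurable_Lnorm_r => //; rewrite leey.
  have M0 z : 0 <= M z by exact: Lnorm_ge0.
  rewrite Lnorm_ge0_pinfty; last by move=> u; exact: Lnorm_ge0.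
  case: ifPn => [mu0|_]; last exact: Lnorm_ge0.
  (* The points where F (z, u) <= M z fails. Each section at fixed z is null, so by Tonelli almost
     every section at fixed u is null, which gives the bound almost everywhere in z. *)
  pose A : set (T1 * T2) := [set x | M x.1 < F x].
  have mA : measurable A.
    rewrite -[X in measurable X]setTI; apply: measurable_lte => //.
    exact: (measurableT_comp mM measurable_fst).
  have A0 : \int[m2]_u m1 (ysection A u) = 0.
    transitivity ((m1 \x^ m2)%E A) => //.
    have <- : (m1 \x m2) A = (m1 \x^ m2) A.
      by apply: product_measure_unique => //= ? ? ? ?; rewrite product_measure2E.
    rewrite /product_measure1/=; apply: integral0_eq => z _ /=.
    have : {ae m2, forall u, F (z, u) <= M z}.
      rewrite /M Lnorm_ge0_pinfty// mu0; exact: ess_sup_ge.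
    case=> N [mN N0 NF].
    apply: (@subset_measure0 _ _ _ _ _ N) => //.
      exact: measurable_xsection.
    move=> u; rewrite /xsection/= inE /A/= => MF; apply: NF => /=.
    by apply/negP; rewrite -ltNge.
  apply/ess_supP.
  have : ae_eq m2 setT (fun u => m1 (ysection A u)) (cst 0).
    apply/ae_eq_integral_abs => //; first exact: measurable_fun_ysection.
    by under eq_integral do rewrite gee0_abs//.
  apply: filterS => u /(_ I) mAu.
  apply: ae_le_Lnorm => //; first exact: measurableT_comp.
  exists (ysection A u); split => //; first exact: measurable_ysection.
  move=> z /= /negP; rewrite -ltNge => MF.
  by rewrite /ysection/= inE.
case: p p1 => [r r1|//|//]; last first.
move: r1 s1; rewrite !lee_fin => r1 s1 rs.
have r0 : (0 < r)%R by apply: lt_le_trans r1.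
have s0 : (0 < s)%R by apply: lt_le_trans s1.
pose G x := F x `^ r.
have G0 x : 0 <= G x by exact: poweR_ge0.
have mG : measurable_fun setT G by exact: measurable_fun_poweR.
have k1 : (1 <= s / r)%R by rewrite ler_pdivlMr// mul1r.
have := Minkowski_integral k1 mG G0.
have srN0 : (s / r)%R != 0%R by rewrite gt_eqF// divr_gt0.
rewrite Lnorm_ge0_fin; last by move=> u; exact: integral_ge0.
move=> /(le0_poweR (r := r^-1)) => /(_ _ _)/wrap[]; first by rewrite invr_ge0 ltW.
  exact: poweR_ge0.
rewrite -poweRrM invf_div mulrAC mulfV ?gt_eqF// mul1r.
rewrite (Lnorm_ge0_fin m2 s); last by move=> u; exact: Lnorm_ge0.
under [X in _ -> X `^ _ <= _]eq_integral do
  rewrite Lnorm_ge0_fin// -poweRrM mulrC.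
move=> /le_trans; apply.
rewrite Lnorm_ge0_fin; last by move=> z; exact: Lnorm_ge0.
rewrite le_eqVlt; apply/orP; left; apply/eqP; congr (_ `^ _).
apply: eq_integral => z _; rewrite !Lnorm_ge0_fin//.
rewrite -[RHS]poweRrM invf_div; congr (_ `^ _); last by rewrite mulrC.
apply: eq_integral => u _.
by rewrite /G -poweRrM mulrCA mulfV ?gt_eqF// mulr1.
Qed.

End Minkowski.

(** * Complex moduli, the sup norm and mean values along lines *)

Section normc_facts.
Context {R : realType}.
Implicit Types z w : R[i].

Lemma normc_ge0 z : 0 <= normc z.
Proof. by case: z => a b; exact: sqrtr_ge0. Qed.

Lemma normc_ge_absRe z : `|complex.Re z| <= normc z.
Proof.
by case: z => a b /=; rewrite -sqrtr_sqr ler_wsqrtr// lerDl sqr_ge0.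
Qed.

Lemma normc_ge_absIm z : `|complex.Im z| <= normc z.
Proof.
by case: z => a b /=; rewrite -sqrtr_sqr ler_wsqrtr// lerDr sqr_ge0.
Qed.

Lemma normc_real (a : R) : normc a%:C = `|a|.
Proof. by rewrite /= expr0n addr0 sqrtr_sqr. Qed.

Lemma normc_le_ReIm z : normc z <= `|complex.Re z| + `|complex.Im z|.
Proof.
case: z => a b /=; rewrite -[leRHS]ger0_norm ?addr_ge0// -sqrtr_sqr ler_wsqrtr//.
by rewrite sqrrD !real_normK ?num_real// -addrA lerD2l lerDr mulrn_wge0// mulr_ge0.
Qed.

Lemma normc_sum (I : Type) (s : seq I) (F : I -> R[i]) :
  normc (\sum_(i <- s) F i) <= \sum_(i <- s) normc (F i).
Proof.
elim: s => [|i s IHs]; first by rewrite !big_nil normc0.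
by rewrite !big_cons (le_trans (le_normcD _ _))// lerD2l.
Qed.

Lemma normc_conj z : normc (conjc z) = normc z.
Proof. by case: z => a b /=; rewrite sqrrN. Qed.

Lemma normc_cis (t : R) : normc (cis t) = 1.
Proof. by rewrite /= cos2Dsin2 sqrtr1. Qed.

End normc_facts.

Section rV_norm.
Context {R : realType} {n : nat}.
Implicit Types x y : 'rV[R]_n.

Lemma coord_le_norm x i : `|x 0 i| <= `|x|.
Proof.
have /mapP[j Hj ->] : `|x 0 i| \in [seq `|x v.1 v.2| | v : 'I_1 * 'I_n].
  by apply/mapP; exists (0, i) => //=; rewrite mem_enum.
by rewrite [leRHS]/Num.Def.normr /= mx_normrE; apply/bigmax_geP; right => /=; exists j.
Qed.

Lemma norm_le_coord x (M : R) : 0 <= M -> (forall i, `|x 0 i| <= M) -> `|x| <= M.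
Proof.
move=> M0 xM; rewrite [leLHS]/Num.Def.normr /= mx_normrE; apply/bigmax_leP; split => //.
by move=> [i j] _ /=; rewrite ord1.
Qed.

Lemma norm_delta i : `|delta_mx 0 i : 'rV[R]_n| <= 1.
Proof.
by apply: norm_le_coord => // j; rewrite mxE/= ger0_norm ?ler0n// lern1 leq_b1.
Qed.

Lemma onenorm_gt0 x : 0 < 1 + `|x|.
Proof. by rewrite ltr_pwDl. Qed.

Lemma onenorm_ge1 x : 1 <= 1 + `|x|.
Proof. by rewrite lerDl. Qed.

(** Peetre's inequality: the weight at x is shared between the centre of a shifted Gaussian and the
    distance to it. *)
Lemma onenorm_shift x y : 1 + `|x| <= (1 + `|y|) * (1 + `|x - y|).
Proof.
have : `|x| <= `|y| + `|x - y| by rewrite -{1}(subrK y x) addrC ler_normD.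
have := normr_ge0 y; have := normr_ge0 (x - y); nra.
Qed.

End rV_norm.

Section line_MVT.
Context {R : realType} {n : nat}.
Implicit Types (F : 'rV[R]_n -> R) (x v : 'rV[R]_n).

Lemma MVT_line F x v : (forall y, differentiable F y) ->
  exists2 t : R, 0 <= t <= 1 & F (x + v) - F x = 'D_v F (x + t *: v).
Proof.
move=> dF.
pose f (t : R) := F (x + t *: v).
have df (t : R) : is_derive t (1 : R) f ('D_v F (x + t *: v)).
  have dFt : derivable F (x + t *: v) v by exact: diff_derivable.
  have E : (fun h : R => h^-1 *: ((f \o shift t) (h *: 1) - f t)) =
           (fun h : R => h^-1 *: ((F \o shift (x + t *: v)) (h *: v) - F (x + t *: v))).
    apply/funext => h /=; rewrite /f /shift/=; congr (_ *: (F _ - _)).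
    by rewrite [h *: 1]mulr1 scalerDl addrCA.
  by apply: DeriveDef; rewrite /derivable/derive E.
have cf : {within `[0, 1], continuous f}.
  by apply: derivable_within_continuous => t _; exact: ex_derive.
have [t t01 ft] := MVT_segment (ler01 : 0 <= 1 :> R) (fun t _ => df t) cf.
exists t; first by move: t01; rewrite in_itv.
by move: ft; rewrite /f scale1r scale0r addr0 subr0 mulr1.
Qed.

Lemma derive_coordE F x v : differentiable F x ->
  'D_v F x = \sum_i v 0 i * 'D_(delta_mx 0 i) F x.
Proof.
move=> dF; rewrite deriveE// {1}(row_sum_delta v) linear_sum/=.
by apply: eq_bigr => i _; rewrite linearZ/= deriveE.
Qed.

Lemma Lipschitz_partials F (L : R) : (forall y, differentiable F y) ->
  (forall y i, `|'D_(delta_mx 0 i) F y| <= L) ->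
  forall x y, `|F y - F x| <= n%:R * L * `|y - x|.
Proof.
move=> dF FL x y; have [t _] := MVT_line x (y - x) dF.
rewrite [x + _]addrC subrK => ->; rewrite derive_coordE//.
apply: le_trans (ler_norm_sum _ _ _) _.
apply: (@le_trans _ _ (\sum_(i < n) L * `|y - x|)); last first.
  by rewrite sumr_const card_ord -mulrA mulr_natl.
apply: ler_sum => i _; rewrite normrM mulrC ler_pM//.
exact: coord_le_norm.
Qed.

End line_MVT.

(** * Derivatives of complex-valued functions and the Schwartz space *)

Section smooth_calculus.
Context {R : realType} {n : nat}.
Implicit Types (f g : 'rV[R]_n -> R[i]) (x : 'rV[R]_n).

Definition cdifferentiable f x :=
  differentiable (fun y => complex.Re (f y)) x /\
  differentiable (fun y => complex.Im (f y)) x.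

Lemma complex_eqP (z w : R[i]) :
  complex.Re z = complex.Re w -> complex.Im z = complex.Im w -> z = w.
Proof. by case: z w => ? ? [? ?] /= -> ->. Qed.

Lemma ReM (z w : R[i]) : complex.Re (z * w) =
  complex.Re z * complex.Re w - complex.Im z * complex.Im w.
Proof. by case: z w => ? ? []. Qed.

Lemma ImM (z w : R[i]) : complex.Im (z * w) =
  complex.Re z * complex.Im w + complex.Im z * complex.Re w.
Proof. by case: z w => ? ? []. Qed.

Lemma ReD (z w : R[i]) : complex.Re (z + w) = complex.Re z + complex.Re w.
Proof. by case: z w => ? ? []. Qed.

Lemma ImD (z w : R[i]) : complex.Im (z + w) = complex.Im z + complex.Im w.
Proof. by case: z w => ? ? []. Qed.

Lemma cdifferentiable_cst c x : cdifferentiable (fun=> c) x.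
Proof. by split; exact: differentiable_cst. Qed.

Lemma cdifferentiableD f g x : cdifferentiable f x -> cdifferentiable g x ->
  cdifferentiable (fun y => f y + g y) x.
Proof.
move=> [rf jf] [rg jg]; split; under eq_fun do rewrite ?ReD ?ImD;
  exact: differentiableD.
Qed.

Lemma cdifferentiableM f g x : cdifferentiable f x -> cdifferentiable g x ->
  cdifferentiable (fun y => f y * g y) x.
Proof.
move=> [rf jf] [rg jg]; split.
  under eq_fun do rewrite ReM.
  by apply: differentiableB; exact: differentiableM.
under eq_fun do rewrite ImM.
by apply: differentiableD; exact: differentiableM.
Qed.

Lemma cpartialD i f g x : cdifferentiable f x -> cdifferentiable g x ->
  cpartial i (fun y => f y + g y) x = cpartial i f x + cpartial i g x.
Proof.
move=> [rf jf] [rg jg]; rewrite /cpartial; apply: complex_eqP;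
  rewrite ?ReD ?ImD/=; under eq_fun do rewrite ?ReD ?ImD;
  by rewrite deriveD//; exact: diff_derivable.
Qed.

Lemma cpartialM i f g x : cdifferentiable f x -> cdifferentiable g x ->
  cpartial i (fun y => f y * g y) x = cpartial i f x * g x + f x * cpartial i g x.
Proof.
move=> [rf jf] [rg jg]; rewrite /cpartial; apply: complex_eqP.
  rewrite ReD !ReM/=; under eq_fun do rewrite ReM.
  rewrite deriveB ?deriveM; do ?[exact: diff_derivable];
    do ?[exact/diff_derivable/differentiableM].
  by rewrite /GRing.scale/=; ring.
rewrite ImD !ImM/=; under eq_fun do rewrite ImM.
rewrite deriveD ?deriveM; do ?[exact: diff_derivable];
  do ?[exact/diff_derivable/differentiableM].
by rewrite /GRing.scale/=; ring.
Qed.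

Lemma cpartial_cst i c x : cpartial i (fun=> c) x = 0.
Proof. by rewrite /cpartial !derive_cst. Qed.

Lemma cpartials_lin f g (c : R[i]) s : smooth f -> smooth g ->
  cpartials s (fun x => c * f x + g x) =
  fun x => c * cpartials s f x + cpartials s g x.
Proof.
move=> sf sg; elim: s => //= i s IHs; rewrite -/(cpartials s _) IHs.
apply/funext => x.
have dc : cdifferentiable (fun x => c * cpartials s f x) x.
  by apply: cdifferentiableM; [exact: cdifferentiable_cst|exact: sf].
rewrite cpartialD//.
rewrite cpartialM; [|exact: cdifferentiable_cst|exact: sf].
by rewrite cpartial_cst mul0r add0r.
Qed.

Lemma smooth_lin f g (c : R[i]) : smooth f -> smooth g ->
  smooth (fun x => c * f x + g x).
Proof.
move=> sf sg s x; rewrite cpartials_lin//; apply: cdifferentiableD; last exact: sg.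
by apply: cdifferentiableM; [exact: cdifferentiable_cst|exact: sf].
Qed.

Lemma schwartz_seminorm_leP k s f (C : R) :
  (schwartz_seminorm k s f <= C%:E)%E <->
  forall x, (1 + `|x|) ^+ k * normc (cpartials s f x) <= C.
Proof.
split=> [fC x|fC].
  by rewrite -lee_fin; apply: le_trans fC; apply: ereal_sup_ubound; exists x.
by apply: ge_ereal_sup => _ [x _ <-]; rewrite lee_fin.
Qed.

Lemma schwartzP f : schwartz f <-> smooth f /\
  forall k s, exists C, forall x, (1 + `|x|) ^+ k * normc (cpartials s f x) <= C.
Proof.
split=> -[sf bf]; split => // k s.
  exists (fine (schwartz_seminorm k s f)); apply/schwartz_seminorm_leP.
  rewrite fineK// ge0_fin_numE ?bf//.
  apply: (@le_trans _ _ ((1 + `|0 : 'rV[R]_n|) ^+ k * normc (cpartials s f 0))%:E).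
    by rewrite lee_fin mulr_ge0 ?normc_ge0// exprn_ge0// addr_ge0.
  by apply: ereal_sup_ubound; exists 0.
have [C fC] := bf k s; apply: (@le_lt_trans _ _ C%:E); last exact: ltry.
exact/schwartz_seminorm_leP.
Qed.

Lemma schwartz_lin f g (c : R[i]) : schwartz f -> schwartz g ->
  schwartz (fun x => c * f x + g x).
Proof.
move=> /schwartzP[sf bf] /schwartzP[sg bg]; apply/schwartzP; split.
  exact: smooth_lin.
move=> k s; have [C fC] := bf k s; have [D gD] := bg k s.
exists (normc c * C + D) => x; rewrite cpartials_lin//.
apply: (@le_trans _ _ ((1 + `|x|) ^+ k *
    (normc c * normc (cpartials s f x) + normc (cpartials s g x)))).
  rewrite ler_wpM2l ?exprn_ge0 ?addr_ge0//.
  by rewrite -normcM le_normcD.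
by rewrite mulrDr mulrCA lerD// ler_wpM2l// normc_ge0.
Qed.

Lemma cpartials0 s : cpartials s (fun _ : 'rV[R]_n => 0 : R[i]) = (fun=> 0).
Proof.
elim: s => //= i s IHs; rewrite -/(cpartials s _) IHs.
by apply/funext => x; rewrite cpartial_cst.
Qed.

Lemma smooth0 : smooth (fun _ : 'rV[R]_n => 0 : R[i]).
Proof. by move=> s x; rewrite cpartials0; exact: cdifferentiable_cst. Qed.

Lemma schwartz0 : schwartz (fun _ : 'rV[R]_n => 0 : R[i]).
Proof.
apply/schwartzP; split; first exact: smooth0.
by move=> k s; exists 0 => x; rewrite cpartials0 normc0 mulr0.
Qed.

Lemma schwartz_sum (I : Type) (s : seq I) (w : I -> R[i])
    (F : I -> 'rV[R]_n -> R[i]) : (forall i, schwartz (F i)) ->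
  schwartz (fun x => \sum_(i <- s) w i * F i x).
Proof.
move=> sF; elim: s => [|i s IHs].
  by under eq_fun do rewrite big_nil; exact: schwartz0.
by under eq_fun do rewrite big_cons; exact: schwartz_lin.
Qed.

Lemma cpartials_sum (I : Type) (s : seq I) (w : I -> R[i])
    (F : I -> 'rV[R]_n -> R[i]) t : (forall i, schwartz (F i)) ->
  cpartials t (fun x => \sum_(i <- s) w i * F i x) =
  fun x => \sum_(i <- s) w i * cpartials t (F i) x.
Proof.
move=> sF; elim: s => [|i s IHs].
  under eq_fun do rewrite big_nil; rewrite cpartials0.
  by apply/funext => x; rewrite big_nil.
under eq_fun do rewrite big_cons; rewrite cpartials_lin.
- by apply/funext => x; rewrite big_cons IHs.
- by have [] := sF i.
- by have [] := schwartz_sum s w sF.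
Qed.

End smooth_calculus.

(** * Convergence in the Schwartz space *)

Section schwartz_convergence.
Context {R : realType} {n : nat}.
Implicit Types (f : 'rV[R]_n -> R[i]) (x : 'rV[R]_n).

Lemma deriveZv (F : 'rV[R]_n -> R) (c : R) (v x : 'rV[R]_n) :
  differentiable F x -> 'D_(c *: v) F x = c * 'D_v F x.
Proof. by move=> dF; rewrite !deriveE// linearZ. Qed.

(** A displacement of length at most 1 changes 1 + |x| by a factor of at most 2. *)
Lemma weight_shift k x (c : R) (v : 'rV[R]_n) : 0 <= c <= 1 -> `|v| <= 1 ->
  (1 + `|x|) ^+ k <= 2 ^+ k * (1 + `|x + c *: v|) ^+ k.
Proof.
move=> /andP[c0 c1] v1; rewrite -exprMn lerXn2r ?nnegrE ?mulr_ge0 ?addr_ge0//.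
have : `|x| <= `|x + c *: v| + `|c *: v| by rewrite -{1}(addrK (c *: v) x) ler_normB.
have : `|c *: v| <= 1 by rewrite normrZ ger0_norm// mulr_ile1.
have := normr_ge0 (x + c *: v); lra.
Qed.

(* A Landau--Kolmogorov inequality. *)
Lemma derivative_interpolation (F : 'rV[R]_n -> R) (v : 'rV[R]_n) k
    (d A C : R) : 0 < d <= 1 -> `|v| <= 1 ->
  (forall y, differentiable F y) -> (forall y, differentiable ('D_v F) y) ->
  (forall x, (1 + `|x|) ^+ k * `|F x| <= A) ->
  (forall x, (1 + `|x|) ^+ k * `|'D_v ('D_v F) x| <= C) ->
  forall x, (1 + `|x|) ^+ k * `|'D_v F x| <= (2 ^+ k + 1) / d * A + 2 ^+ k * d * C.
Proof.
move=> /andP[d0 d1] v1 dF dDF FA DDC x.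
have w0 (y : 'rV[R]_n) : 0 <= (1 + `|y|) ^+ k by rewrite exprn_ge0// addr_ge0.
have A0 : 0 <= A by apply: le_trans (FA x); rewrite mulr_ge0.
have C0 : 0 <= C by apply: le_trans (DDC x); rewrite mulr_ge0.
have [t /andP[t0 t1]] := MVT_line x (d *: v) dF; rewrite deriveZv// => Ft.
have [u /andP[u0 u1]] := MVT_line x ((t * d) *: v) dDF; rewrite deriveZv//.
rewrite scalerA -scalerA => Dt.
(* Taylor's formula: the derivative is a difference quotient with step d, controlled by A, minus a
   remainder of size at most d times a second derivative, controlled by C. *)
have -> : 'D_v F x = (F (x + d *: v) - F x) / d -
    t * d * 'D_v ('D_v F) (x + (u * (t * d)) *: v).
  rewrite Ft mulrC mulKf ?gt_eqF//.
  by move: Dt; rewrite !scalerA => <-; rewrite opprB addrC subrK.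
set y := x + (u * (t * d)) *: v; set z := x + d *: v.
have wz : (1 + `|x|) ^+ k <= 2 ^+ k * (1 + `|z|) ^+ k.
  by apply: weight_shift => //; rewrite ltW.
have td1 : t * d <= 1 by rewrite mulr_ile1// ltW.
have td0 : 0 <= t * d by rewrite mulr_ge0// ltW.
have wy : (1 + `|x|) ^+ k <= 2 ^+ k * (1 + `|y|) ^+ k.
  by apply: weight_shift => //; rewrite mulr_ge0//= mulr_ile1.
have k0 : 0 <= 2 ^+ k :> R by rewrite exprn_ge0.
have b1 : (1 + `|x|) ^+ k * `|F z| <= 2 ^+ k * A.
  apply: le_trans (ler_wpM2r _ wz) _ => //.
  by rewrite -mulrA ler_wpM2l.
have b2 : (1 + `|x|) ^+ k * `|'D_v ('D_v F) y| <= 2 ^+ k * C.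
  apply: le_trans (ler_wpM2r _ wy) _ => //.
  by rewrite -mulrA ler_wpM2l.
have dV0 : 0 <= d^-1 by rewrite invr_ge0 ltW.
apply: (@le_trans _ _ ((1 + `|x|) ^+ k *
  ((`|F z| + `|F x|) / d + t * d * `|'D_v ('D_v F) y|))).
  rewrite ler_wpM2l//; apply: le_trans (ler_normB _ _) _; apply: lerD.
    by rewrite normrM (ger0_norm dV0) ler_wpM2r// ler_normB.
  by rewrite normrM (ger0_norm td0).
rewrite mulrDr mulrA mulrDr; apply: lerD.
  rewrite [leRHS]mulrAC ler_wpM2r// mulrDl mul1r.
  by apply: lerD.
rewrite mulrCA; apply: (@le_trans _ _ (t * d * (2 ^+ k * C))).
  exact: ler_wpM2l.
rewrite (_ : t * d * _ = 2 ^+ k * d * C * t); last by ring.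
rewrite ler_piMr// !mulr_ge0//; exact: ltW.
Qed.

Section vanishing.
Variable g : nat -> 'rV[R]_n -> R[i].
Hypothesis sg : forall N, smooth (g N).
Hypothesis bg : forall k s, exists C, forall N x,
  (1 + `|x|) ^+ k * normc (cpartials s (g N) x) <= C.
Hypothesis g0 : forall x, normc (g N x) @[N --> \oo] --> (0 : R).

(** Outside the ball of radius C1 / e, the bound with weight k + 1 gives C1 / (1 + |x|), at most e.
    Inside, compactness and equicontinuity make the pointwise convergence uniform. *)
Let vanishing_nil k (e : R) : 0 < e ->
  \forall N \near \oo, forall x, (1 + `|x|) ^+ k * normc (g N x) <= e.
Proof.
move=> e0; have [C1 gC1] := bg k.+1 [::].
have [L gL] : exists L, forall N i y,
    `|complex.Re (cpartial i (g N) y)| <= L /\ `|complex.Im (cpartial i (g N) y)| <= L.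
  have [C gC] := choice (fun i => bg 0 [:: i]).
  exists (\sum_i `|C i|) => N i y.
  have cg : normc (cpartial i (g N) y) <= \sum_i `|C i|.
    have := gC i N y; rewrite expr0 mul1r => /le_trans; apply.
    apply: le_trans (ler_norm _) _.
    by rewrite (bigD1 i)//= lerDl sumr_ge0.
  by split; apply: le_trans cg; [exact: normc_ge_absRe|exact: normc_ge_absIm].
have C10 : 0 <= C1.
  by apply: le_trans (gC1 0%N 0); rewrite mulr_ge0 ?normc_ge0// exprn_ge0// addr_ge0.
pose rho := C1 / e.
have rho0 : 0 <= rho by rewrite divr_ge0// ltW.
pose K := [set x : 'rV[R]_n | `|x| <= rho].
have cK : compact K.
  apply: bounded_closed_compact.
    by apply: (filterS _ (nbhs_pinfty_ge (num_real rho))) => M rM x /= /le_trans; exact.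
  rewrite (_ : K = (fun x : 'rV[R]_n => `|x|) @^-1` [set t : R | t <= rho])//.
  apply: preimage_closed; last exact: closed_le.
  by move=> x _; exact: norm_continuous.
(* On the ball the weight is at most (1 + rho)^k. *)
pose e' := e / (1 + rho) ^+ k.
have e'0 : 0 < e' by rewrite divr_gt0// exprn_gt0// ltr_pwDl.
have /compact_near_coveringP ncK := cK.
have near_K : \forall N \near \oo, K `<=` [set x | normc (g N x) <= e'].
  apply: (ncK _ \oo (fun N x => normc (g N x) <= e')) => x Kx.
  (* A Lipschitz constant common to all N, from the bounded first derivatives of the real and
     imaginary parts; the summand 1 keeps it positive, as it is a divisor below. *)
  pose L' := n%:R * `|L| * 2 + 1.
  have L'0 : 0 < L' by rewrite ltr_wpDl// !mulr_ge0.
  have lip N (y : 'rV[R]_n) : normc (g N y) <= normc (g N x) + L' * `|y - x|.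
    apply: (@le_trans _ _ (normc (g N x) + normc (g N y - g N x))).
      by rewrite -[X in normc X <= _](subrKC (g N x)) le_normcD.
    rewrite lerD2l; apply: le_trans (normc_le_ReIm _) _.
    have dR z : differentiable (fun w => complex.Re (g N w)) z by have [] := sg N [::] z.
    have dI z : differentiable (fun w => complex.Im (g N w)) z by have [] := sg N [::] z.
    have bR z i : `|'D_(delta_mx 0 i) (fun w => complex.Re (g N w)) z| <= `|L|.
      by apply: le_trans (ler_norm L); have [] := gL N i z.
    have bI z i : `|'D_(delta_mx 0 i) (fun w => complex.Im (g N w)) z| <= `|L|.
      by apply: le_trans (ler_norm L); have [] := gL N i z.
    have := Lipschitz_partials dR bR x y; have := Lipschitz_partials dI bI x y.
    rewrite /= ReD ImD.
    have -> : complex.Re (- g N x) = - complex.Re (g N x) by case: (g N x).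
    have -> : complex.Im (- g N x) = - complex.Im (g N x) by case: (g N x).
    by have := normr_ge0 (y - x); rewrite /L'; nra.
  have gx : \forall N \near \oo, normc (g N x) <= e' / 2.
    have /cvgrPdist_le/(_ (e' / 2)) := g0 x.
    rewrite divr_gt0// => /(_ isT); apply: filterS => N.
    by rewrite sub0r normrN ger0_norm// normc_ge0.
  have xx' : \forall x' \near x, `|x' - x| <= e' / 2 / L'.
    have ee : 0 < e' / 2 / L' by apply: divr_gt0 => //; exact: divr_gt0.
    have := nbhsx_ballx x _ ee; apply: filterS => x'.
    by rewrite -ball_normE /= distrC => /ltW.
  exists ([set x' : 'rV[R]_n | `|x' - x| <= e' / 2 / L'],
    [set N | normc (g N x) <= e' / 2]); first by split.
  move=> [x' N] /= [hx' hN]; apply: le_trans (lip _ _) _.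
  by rewrite (splitr e'); apply: lerD => //; rewrite mulrC -ler_pdivlMr.
near=> N => x.
have [xr|xr] := leP (`|x|) rho.
  have : normc (g N x) <= e' by move: x xr; near: N.
  rewrite /e' ler_pdivlMr ?exprn_gt0 ?ltr_pwDl// => /(le_trans _); apply.
  rewrite mulrC ler_wpM2l ?normc_ge0// lerXn2r ?nnegrE ?addr_ge0//.
  by rewrite lerD2l.
have := gC1 N x; rewrite /= exprS -mulrA => gCx.
rewrite -(ler_pM2l (onenorm_gt0 x)); apply: le_trans gCx _.
rewrite mulrC -ler_pdivrMl// mulrC -/rho ltW// (lt_le_trans xr)//.
by rewrite lerDr.
Unshelve. all: by end_near. Qed.

(** Induction on the order: by [derivative_interpolation], a derivative is small when the one below
    it is small and the one above it is bounded. *)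
Lemma vanishing_partials s k (e : R) : 0 < e ->
  \forall N \near \oo, forall x,
    (1 + `|x|) ^+ k * normc (cpartials s (g N) x) <= e.
Proof.
elim: s k e => [|i s IHs] k e e0; first exact: vanishing_nil.
have [C gC] := bg k [:: i, i & s].
have C0 : 0 <= C.
  by apply: le_trans (gC 0%N 0); rewrite mulr_ge0 ?normc_ge0// exprn_ge0// addr_ge0.
have k0 : 0 < 2 ^+ k :> R by rewrite exprn_gt0.
have C1 : 0 < C + 1 by rewrite ltr_wpDl.
(* First d is fixed so that the bounded second-order term is at most e / 4, then A so that the other
   term equals e / 4. The total e / 2 serves once for the real and once for the imaginary part. *)
pose d : R := Num.min 1 (e / 4 / (2 ^+ k * (C + 1))).
have d01 : 0 < d <= 1.
  by rewrite lt_min ltr01/= ge_min lexx/= andbT !divr_gt0// mulr_gt0.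
have d0 : 0 < d by case/andP: d01.
pose A := e / 4 * d / (2 ^+ k + 1).
have A0 : 0 < A by rewrite !divr_gt0// ?mulr_gt0 ?divr_gt0// ltr_wpDl// ltW.
have key : (2 ^+ k + 1) / d * A + 2 ^+ k * d * C <= e / 2.
  have -> : (2 ^+ k + 1) / d * A = e / 4.
    by rewrite /A; field; apply/andP; split; rewrite gt_eqF.
  have : 2 ^+ k * d * C <= e / 4.
    apply: (@le_trans _ _ (d * (2 ^+ k * (C + 1)))).
      rewrite mulrAC [leRHS]mulrC ler_wpM2r ?(ltW d0)// ler_wpM2l ?(ltW k0)//.
      by rewrite lerDl.
    by rewrite -ler_pdivlMr ?mulr_gt0// ge_min lexx orbT.
  by lra.
near=> N => x.
have gA : forall x, (1 + `|x|) ^+ k * normc (cpartials s (g N) x) <= A.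
  by near: N; exact: IHs.
have w0 (y : 'rV[R]_n) : 0 <= (1 + `|y|) ^+ k by rewrite exprn_ge0// addr_ge0.
have bR : (1 + `|x|) ^+ k * `|complex.Re (cpartials (i :: s) (g N) x)| <= e / 2.
  apply: le_trans key.
  apply: (derivative_interpolation
    (F := fun y => complex.Re (cpartials s (g N) y)) d01 (norm_delta i)).
  - by move=> y; have [] := sg N s y.
  - by move=> y; have [] := sg N (i :: s) y.
  - by move=> y; apply: le_trans (gA y); rewrite ler_wpM2l// normc_ge_absRe.
  - move=> y; apply: le_trans (gC N y); rewrite ler_wpM2l//.
    exact: (normc_ge_absRe (cpartials [:: i, i & s] (g N) y)).
have bI : (1 + `|x|) ^+ k * `|complex.Im (cpartials (i :: s) (g N) x)| <= e / 2.
  apply: le_trans key.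
  apply: (derivative_interpolation
    (F := fun y => complex.Im (cpartials s (g N) y)) d01 (norm_delta i)).
  - by move=> y; have [] := sg N s y.
  - by move=> y; have [] := sg N (i :: s) y.
  - by move=> y; apply: le_trans (gA y); rewrite ler_wpM2l// normc_ge_absIm.
  - move=> y; apply: le_trans (gC N y); rewrite ler_wpM2l//.
    exact: (normc_ge_absIm (cpartials [:: i, i & s] (g N) y)).
apply: (@le_trans _ _ ((1 + `|x|) ^+ k *
  (`|complex.Re (cpartials (i :: s) (g N) x)| +
   `|complex.Im (cpartials (i :: s) (g N) x)|))).
  by rewrite ler_wpM2l// normc_le_ReIm.
by rewrite mulrDr (splitr e) lerD.
Unshelve. all: by end_near. Qed.

End vanishing.

(* Bounded sequences of Schwartz functions converge as soon as they do so
   pointwise: the Schwartz space is a Montel space. *)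
Lemma tempered_cvg (u : ('rV[R]_n -> R[i]) -> R[i])
    (F : nat -> 'rV[R]_n -> R[i]) f :
  tempered_distribution u -> (forall N, schwartz (F N)) -> schwartz f ->
  (forall k s, exists C, forall N x,
    (1 + `|x|) ^+ k * normc (cpartials s (F N) x) <= C) ->
  (forall x, normc (F N x - f x) @[N --> \oo] --> (0 : R)) ->
  normc (u (F N) - u f) @[N --> \oo] --> (0 : R).
Proof.
move=> [_ cu] sF sf bF Ff.
pose g N x := F N x - f x.
have gE N : g N = fun x => -1 * f x + F N x.
  by apply/funext => x; rewrite mulN1r addrC.
have sg N : smooth (g N).
  by rewrite gE; apply: smooth_lin; [have [] := sf|have [] := sF N].
have bg k s : exists C, forall N x, (1 + `|x|) ^+ k * normc (cpartials s (g N) x) <= C.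
  have [C FC] := bF k s; have /schwartzP[sf' /(_ k s)[D fD]] := sf.
  exists (D + C) => N x; rewrite gE cpartials_lin//; last by have [] := sF N.
  have w0 (y : 'rV[R]_n) : 0 <= (1 + `|y|) ^+ k by rewrite exprn_ge0// addr_ge0.
  apply: le_trans (ler_wpM2l (w0 x) (le_normcD _ _)) _.
  by rewrite mulN1r normcN mulrDr lerD.
apply/cvgrPdist_lt => e e0.
have [M [r r0 ur]] := cu f sf e e0.
have r2 : 0 < r / 2 by rewrite divr_gt0.
pose small N (k : nat) (s : seq 'I_n) :=
  forall x, (1 + `|x|) ^+ k * normc (cpartials s (g N) x) <= r / 2.
have fin : \forall N \near \oo, forall k s, (k <= M)%N -> (size s <= M)%N -> small N k s.
  (* The finitely many seminorms that matter are indexed by a finite type, so that their thresholds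
     can be intersected. *)
  have : \forall N \near \oo, forall (a : 'I_M.+1 * {b : 'I_M.+1 & b.-tuple 'I_n}),
      small N a.1 (tagged a.2).
    by apply: filter_forall => a; exact: vanishing_partials.
  apply: filterS => N H k s kM sM.
  have := H (Ordinal (kM : (k < M.+1)%N),
    Tagged (fun b : 'I_M.+1 => b.-tuple 'I_n)
      (in_tuple s : (Ordinal (sM : (size s < M.+1)%N)).-tuple 'I_n)).
  by [].
apply: filterS fin => N H; rewrite sub0r normrN ger0_norm ?normc_ge0//.
apply: ur; first exact: sF.
move=> k s kM sM; apply: (@le_lt_trans _ _ (r / 2)%:E).
  by apply/schwartz_seminorm_leP; exact: H.
by rewrite lte_fin ltr_pdivrMr// ltr_pMr// ltr1n.
Qed.

End schwartz_convergence.

(** * Time-frequency shifts of Gaussians *)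

Section derivatives.
Context {R : realType} {n : nat}.
Implicit Types (F : 'rV[R]_n -> R) (x v : 'rV[R]_n).

(** Phases and Gaussian exponents are at most quadratic along a line, so their directional
    derivatives can be read off from the coefficient of h. *)
Lemma derive_quadratic F x v (c e : R) :
  (forall h : R, F (h *: v + x) = F x + h * c + h ^+ 2 * e) -> 'D_v F x = c.
Proof.
move=> Fh; apply/cvg_lim => //.
have : (fun h : R => c + h * e) @ 0^' --> c.
  rewrite -[X in _ --> X]addr0 -[X in _ --> _ + X](mul0r e).
  apply: cvgD; first exact: cvg_cst.
  by apply: cvgMl; apply: cvg_within.
apply: cvg_trans; apply: near_eq_cvg.
near=> h; have h0 : h != 0 by near: h; exact: nbhs_dnbhs_neq.
rewrite /= Fh /GRing.scale/=; field.
exact: h0.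
Unshelve. all: by end_near. Qed.

Lemma derive_comp_real (h : R -> R) F x v :
  derivable h (F x) 1 -> differentiable F x ->
  'D_v (fun y => h (F y)) x = 'D_1 h (F x) * 'D_v F x.
Proof.
move=> dh dF; have dh' : differentiable h (F x) by apply/derivable1_diffP.
rewrite deriveE; last exact: (differentiable_comp dF dh').
rewrite (diff_comp dF dh') /comp/= deriv1E// -deriveE//.
by rewrite derive1E /GRing.scale/= mulrC.
Qed.

Lemma differentiable_comp_real (h : R -> R) F x :
  derivable h (F x) 1 -> differentiable F x -> differentiable (fun y => h (F y)) x.
Proof. by move=> /derivable1_diffP dh dF; exact: (differentiable_comp dF dh). Qed.

Lemma differentiable_sum_fun (I : Type) (s : seq I) (f : I -> 'rV[R]_n -> R) x :
  (forall i, differentiable (f i) x) ->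
  differentiable (fun y => \sum_(i <- s) f i y) x.
Proof.
move=> df; elim: s => [|i s IHs].
  by under eq_fun do rewrite big_nil; exact: differentiable_cst.
by under eq_fun do rewrite big_cons; exact: differentiableD.
Qed.

Lemma differentiable_rV_coord i x : differentiable (fun y : 'rV[R]_n => y 0 i) x.
Proof. exact: differentiable_coord. Qed.

End derivatives.

Section gaussian_shifts.
Context {R : realType} {n : nat}.
Implicit Types (a b t x : 'rV[R]_n) (s : 'I_n -> R).

(** Each coordinate has its own weight because the window is changed one coordinate at a time. *)
Definition wquad s t : R := \sum_i s i * t 0 i ^+ 2.

Definition gauss s : 'rV[R]_n -> R[i] := fun t => (expR (- pi * wquad s t))%:C.

Lemma differentiable_phase b x :
  differentiable (fun t => 2 * pi * dotr b t) x.
Proof.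
apply: differentiableM; first exact: differentiable_cst.
apply: differentiable_sum_fun => i; apply: differentiableM.
  exact: differentiable_cst.
exact: differentiable_rV_coord.
Qed.

Lemma derive_phase b x i :
  'D_(delta_mx 0 i) (fun t => 2 * pi * dotr b t) x = 2 * pi * b 0 i.
Proof.
apply: (derive_quadratic (e := 0)) => h.
rewrite mulr0 addr0 mulrCA -mulrDr; congr (_ * _).
rewrite /dotr (bigD1 i)//= [in RHS](bigD1 i)//= !mxE !eqxx /= mulr1.
rewrite [h + _]addrC mulrDr -!addrA; congr (_ + _); rewrite addrC mulrC; congr (_ + _).
by apply: eq_bigr => j ji; rewrite !mxE (negbTE ji) andbF mulr0 add0r.
Qed.

Lemma differentiable_wquad s a x :
  differentiable (fun t => - pi * wquad s (t - a)) x.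
Proof.
apply: differentiableM; first exact: differentiable_cst.
apply: differentiable_sum_fun => i; apply: differentiableM.
  exact: differentiable_cst.
under eq_fun do rewrite expr2 !mxE.
by apply: differentiableM; apply: differentiableB;
  [exact: differentiable_rV_coord|exact: differentiable_cst|
   exact: differentiable_rV_coord|exact: differentiable_cst].
Qed.

Lemma derive_wquad s a x i :
  'D_(delta_mx 0 i) (fun t => - pi * wquad s (t - a)) x =
  - (2 * pi * s i) * (x - a) 0 i.
Proof.
apply: (derive_quadratic (e := - pi * s i)) => h.
rewrite /wquad (bigD1 i)//= [in RHS](bigD1 i)//= !mxE !eqxx /= mulr1.
under eq_bigr => j ji do rewrite !mxE (negbTE ji) andbF mulr0 add0r.
under [in RHS]eq_bigr => j ji do rewrite !mxE.
by ring.
Qed.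

Lemma tfshift_gauss_cdifferentiable s a b x :
  cdifferentiable (tfshift a b (gauss s)) x.
Proof.
apply: cdifferentiableM.
  split=> /=.
    apply: (differentiable_comp_real (h := cos)); first exact: derivable_cos.
    exact: differentiable_phase.
  apply: (differentiable_comp_real (h := sin)); first exact: derivable_sin.
  exact: differentiable_phase.
split=> /=; last exact: differentiable_cst.
apply: (differentiable_comp_real (h := expR)); first exact: derivable_expR.
exact: differentiable_wquad.
Qed.

Lemma cpartial_tfshift_gauss s a b x i :
  cpartial i (tfshift a b (gauss s)) x =
  ((- (2 * pi * s i))%:C * ((x - a) 0 i)%:C + (0 +i* (2 * pi)) * (b 0 i)%:C) *
  tfshift a b (gauss s) x.
Proof.
have dp := differentiable_phase b x; have dq := differentiable_wquad s a x.
rewrite [LHS]cpartialM; last 2 first.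
- split=> /=.
    by apply: (differentiable_comp_real (h := cos)); first exact: derivable_cos.
  by apply: (differentiable_comp_real (h := sin)); first exact: derivable_sin.
- split=> /=; last exact: differentiable_cst.
  by apply: (differentiable_comp_real (h := expR)); first exact: derivable_expR.
rewrite /cpartial /=.
rewrite (derive_comp_real (h := cos) _ _ dp); last exact: derivable_cos.
rewrite (derive_comp_real (h := sin) _ _ dp); last exact: derivable_sin.
rewrite (derive_comp_real (h := expR) _ _ dq); last exact: derivable_expR.
rewrite derive_cst !derive_val derive_phase derive_wquad.
rewrite /tfshift /gauss /cis; apply: complex_eqP;
  rewrite ?ReM ?ImM ?ReD ?ImD ?ReM ?ImM /=; ring.
Qed.

End gaussian_shifts.

Section gaussian_seminorms.
Context {R : realType} {n : nat}.
Implicit Types (a b t x : 'rV[R]_n) (s : 'I_n -> R).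

(* Polynomials in [t - a] and [b]: the prefactors of the derivatives of
   [tfshift a b (gauss s)], with coefficients independent of [a] and [b]. *)
Inductive prefactor : ('rV[R]_n -> 'rV[R]_n -> 'rV[R]_n -> R[i]) -> Prop :=
| prefactor_cst c : prefactor (fun _ _ _ => c)
| prefactor_pos i : prefactor (fun a _ t => ((t - a) 0 i)%:C)
| prefactor_freq i : prefactor (fun _ b _ => (b 0 i)%:C)
| prefactorD P Q : prefactor P -> prefactor Q ->
    prefactor (fun a b t => P a b t + Q a b t)
| prefactorM P Q : prefactor P -> prefactor Q ->
    prefactor (fun a b t => P a b t * Q a b t).

Lemma prefactor_cdifferentiable P a b t :
  prefactor P -> cdifferentiable (P a b) t.
Proof.
elim=> [c|i|i|P1 P2 _ d1 _ d2|P1 P2 _ d1 _ d2].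
- exact: cdifferentiable_cst.
- split=> /=; last exact: differentiable_cst.
  under eq_fun do rewrite !mxE.
  by apply: differentiableB; [exact: differentiable_rV_coord|exact: differentiable_cst].
- exact: cdifferentiable_cst.
- exact: cdifferentiableD.
- exact: cdifferentiableM.
Qed.

Lemma prefactor_cpartial P i : prefactor P ->
  exists2 Q, prefactor Q & forall a b t, cpartial i (P a b) t = Q a b t.
Proof.
elim=> [c|j|j|P1 P2 p1 [Q1 q1 E1] p2 [Q2 q2 E2]|P1 P2 p1 [Q1 q1 E1] p2 [Q2 q2 E2]].
- exists (fun _ _ _ => 0); first exact: prefactor_cst.
  by move=> a b t; rewrite cpartial_cst.
- exists (fun _ _ _ => ((j == i)%:R : R)%:C); first exact: prefactor_cst.
  move=> a b t; rewrite /cpartial /= derive_cst; congr (_ +i* _).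
  by apply: (derive_quadratic (e := 0)) => h; rewrite !mxE/=; ring.
- exists (fun _ _ _ => 0); first exact: prefactor_cst.
  by move=> a b t; rewrite cpartial_cst.
- exists (fun a b t => Q1 a b t + Q2 a b t); first exact: prefactorD.
  by move=> a b t; rewrite cpartialD ?E1 ?E2//; exact: prefactor_cdifferentiable.
- exists (fun a b t => Q1 a b t * P2 a b t + P1 a b t * Q2 a b t).
    by apply: prefactorD; exact: prefactorM.
  by move=> a b t; rewrite cpartialM ?E1 ?E2//; exact: prefactor_cdifferentiable.
Qed.

Lemma prefactor_bound P : prefactor P -> exists C m, 0 <= C /\ forall a b t,
  normc (P a b t) <= C * ((1 + `|b|) * (1 + `|t - a|)) ^+ m.
Proof.
have X1 a b t : 1 <= (1 + `|b|) * (1 + `|t - a|).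
  by rewrite -[1]mulr1 ler_pM// ?mulr1 onenorm_ge1.
have mono a b t (C : R) m m' : 0 <= C -> (m <= m')%N ->
    C * ((1 + `|b|) * (1 + `|t - a|)) ^+ m <= C * ((1 + `|b|) * (1 + `|t - a|)) ^+ m'.
  by move=> C0 mm'; rewrite ler_wpM2l// ler_weXn2l.
elim=> [c|i|i|P1 P2 _ [C1 [m1 [C10 B1]]] _ [C2 [m2 [C20 B2]]]|
  P1 P2 _ [C1 [m1 [C10 B1]]] _ [C2 [m2 [C20 B2]]]].
- exists (normc c), 0%N; split; first exact: normc_ge0.
  by move=> a b t; rewrite expr0 mulr1.
- exists 1, 1%N; split => // a b t; rewrite normc_real mul1r expr1.
  apply: le_trans (coord_le_norm _ _) _.
  by have := normr_ge0 (t - a); have := normr_ge0 b; nra.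
- exists 1, 1%N; split => // a b t; rewrite normc_real mul1r expr1.
  apply: le_trans (coord_le_norm _ _) _.
  by have := normr_ge0 (t - a); have := normr_ge0 b; nra.
- exists (C1 + C2), (m1 + m2)%N; split; first exact: addr_ge0.
  move=> a b t; apply: le_trans (le_normcD _ _) _; rewrite mulrDl lerD//.
    by apply: le_trans (B1 a b t) _; apply: mono => //; rewrite leq_addr.
  by apply: le_trans (B2 a b t) _; apply: mono => //; rewrite leq_addl.
- exists (C1 * C2), (m1 + m2)%N; split; first exact: mulr_ge0.
  by move=> a b t; rewrite normcM exprD mulrACA ler_pM// normc_ge0.
Qed.

Lemma cpartials_tfshift_gauss s l : exists2 P, prefactor P &
  forall a b, cpartials l (tfshift a b (gauss s)) =
    fun t => P a b t * tfshift a b (gauss s) t.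
Proof.
elim: l => [|i l [P pP E]].
  exists (fun _ _ _ => 1); first exact: prefactor_cst.
  by move=> a b; apply/funext => t; rewrite mul1r.
have [Q pQ EQ] := prefactor_cpartial i pP.
exists (fun a b t => Q a b t + P a b t *
    ((- (2 * pi * s i))%:C * ((t - a) 0 i)%:C + (0 +i* (2 * pi)) * (b 0 i)%:C)).
  apply: prefactorD => //; apply: prefactorM => //.
  apply: prefactorD; apply: prefactorM; try exact: prefactor_cst.
    exact: prefactor_pos.
  exact: prefactor_freq.
move=> a b; rewrite /= -/(cpartials l _) E; apply/funext => t.
rewrite cpartialM; last 2 first.
- exact: prefactor_cdifferentiable.
- exact: tfshift_gauss_cdifferentiable.
by rewrite EQ cpartial_tfshift_gauss [RHS]mulrDl mulrA.
Qed.

Lemma smooth_tfshift_gauss s a b : smooth (tfshift a b (gauss s)).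
Proof.
move=> l x; have [P pP E] := cpartials_tfshift_gauss s l; rewrite E.
apply: cdifferentiableM; first exact: prefactor_cdifferentiable.
exact: tfshift_gauss_cdifferentiable.
Qed.

Lemma normc_tfshift (f : 'rV[R]_n -> R[i]) a b x :
  normc (tfshift a b f x) = normc (f (x - a)).
Proof. by rewrite normcM normc_cis mul1r. Qed.

Lemma sqr_norm_le x : `|x| ^+ 2 <= \sum_i x 0 i ^+ 2.
Proof.
have S0 : 0 <= \sum_i x 0 i ^+ 2 by apply: sumr_ge0 => i _; exact: sqr_ge0.
have : `|x| <= Num.sqrt (\sum_i x 0 i ^+ 2).
  apply: norm_le_coord; first exact: sqrtr_ge0.
  move=> i; rewrite -sqrtr_sqr ler_wsqrtr// (bigD1 i)//= lerDl sumr_ge0//.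
  by move=> j _; exact: sqr_ge0.
by rewrite -(@ler_pXn2r _ 2)// ?nnegrE ?sqrtr_ge0// sqr_sqrtr.
Qed.

Lemma expr_le_expR (r : R) k : 0 <= r -> r ^+ k <= k`!%:R * expR r.
Proof.
move=> r0; rewrite -ler_pdivrMl ?ltr0n ?fact_gt0// mulrC.
case: k => [|k]; first by rewrite expr0 fact0 divr1 -expR0 ler_expR.
by apply: le_trans (expR_ge1Dxn k r0); rewrite lerDr.
Qed.

Lemma gaussian_decay (c : R) k : 0 < c -> exists2 C, 0 <= C &
  forall r : R, 0 <= r -> (1 + r) ^+ k * expR (- c * r ^+ 2) <= C.
Proof.
(* The factor (1 + r)^k is at most k! exp (1 + r), and r - c r^2 is at most 1 / (4 c) by completing
   the square. *)
move=> c0; exists (k`!%:R * expR (1 + (4 * c)^-1)).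
  by rewrite mulr_ge0 ?ler0n// expR_ge0.
move=> r r0; apply: (@le_trans _ _ (k`!%:R * expR (1 + r) * expR (- c * r ^+ 2))).
  by rewrite ler_wpM2r ?expR_ge0// expr_le_expR// addr_ge0.
rewrite -mulrA -expRD ler_wpM2l ?ler0n// ler_expR -addrA lerD2l.
have : 0 <= c * (r - (2 * c)^-1) ^+ 2 by rewrite mulr_ge0 ?sqr_ge0// ltW.
have -> : c * (r - (2 * c)^-1) ^+ 2 = c * r ^+ 2 - r + (4 * c)^-1.
  by field; rewrite gt_eqF.
by rewrite mulNr; lra.
Qed.

Lemma normc_gauss_le s (c : R) y : 0 <= c -> (forall i, c <= s i) ->
  normc (gauss s y) <= expR (- (pi * c) * `|y| ^+ 2).
Proof.
move=> c0 cs; rewrite normc_real ger0_norm ?expR_ge0// ler_expR !mulNr lerN2.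
rewrite -mulrA ler_wpM2l ?pi_ge0//.
apply: (@le_trans _ _ (c * \sum_i y 0 i ^+ 2)).
  by rewrite ler_wpM2l// sqr_norm_le.
by rewrite mulr_sumr; apply: ler_sum => i _; rewrite ler_wpM2r// sqr_ge0.
Qed.

(** The Gaussian absorbs every power of 1 + |x - a|, so only polynomial growth in the shift remains.
    This growth is what the moments of the walks have to control. *)
Lemma tfshift_gauss_seminorm s (c : R) k l : 0 < c -> (forall i, c <= s i) ->
  exists C m, 0 <= C /\ forall a b x,
    (1 + `|x|) ^+ k * normc (cpartials l (tfshift a b (gauss s)) x) <=
    C * ((1 + `|a|) * (1 + `|b|)) ^+ m.
Proof.
move=> c0 cs; have [P pP E] := cpartials_tfshift_gauss s l.
have [C [m [C0 PC]]] := prefactor_bound pP.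
have pc0 : 0 < pi * c by rewrite mulr_gt0// pi_gt0.
have [D D0 gD] := gaussian_decay (k + m) pc0.
exists (C * D), (k + m)%N; split; first exact: mulr_ge0.
move=> a b x; rewrite E normcM normc_tfshift.
have a1 := onenorm_ge1 a; have b1 := onenorm_ge1 b.
pose A := 1 + `|a|; pose B := 1 + `|b|; pose Y := 1 + `|x - a|.
have Y1 : 1 <= Y by exact: onenorm_ge1.
have A0 : 0 <= A by rewrite addr_ge0.
have B0 : 0 <= B by rewrite addr_ge0.
have Y0 : 0 <= Y by rewrite addr_ge0.
have xAY : (1 + `|x|) ^+ k <= A ^+ k * Y ^+ k.
  by rewrite -exprMn lerXn2r ?nnegrE ?mulr_ge0 ?addr_ge0// onenorm_shift.
apply: (@le_trans _ _ (A ^+ k * Y ^+ k *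
  (C * (B * Y) ^+ m * expR (- (pi * c) * `|x - a| ^+ 2)))).
  rewrite ler_pM// ?exprn_ge0 ?addr_ge0// ?mulr_ge0 ?normc_ge0//.
  by rewrite ler_pM ?normc_ge0//; apply: normc_gauss_le => //; exact: ltW.
have -> : A ^+ k * Y ^+ k * (C * (B * Y) ^+ m * expR (- (pi * c) * `|x - a| ^+ 2)) =
   C * (Y ^+ (k + m) * expR (- (pi * c) * `|x - a| ^+ 2)) * (A ^+ k * B ^+ m).
  by rewrite exprMn exprD; ring.
apply: ler_pM.
- by rewrite !mulr_ge0 ?exprn_ge0 ?expR_ge0.
- by rewrite !mulr_ge0 ?exprn_ge0.
- by rewrite ler_wpM2l// gD.
by rewrite exprMn ler_pM ?exprn_ge0// ler_weXn2l// ?leq_addr ?leq_addl.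
Qed.

Lemma schwartz_tfshift_gauss s (c : R) a b : 0 < c -> (forall i, c <= s i) ->
  schwartz (tfshift a b (gauss s)).
Proof.
move=> c0 cs; apply/schwartzP; split; first exact: smooth_tfshift_gauss.
move=> k l; have [C [m [_ B]]] := tfshift_gauss_seminorm k l c0 cs.
by eexists => x; exact: B.
Qed.

End gaussian_seminorms.

(** * Continuity and measurability of the short-time Fourier transform *)

Section stft_measurable.
Context {R : realType} {n : nat}.
Implicit Types (a b t x : 'rV[R]_n) (s : 'I_n -> R).

Lemma Re_tfshift_gauss s a b x : complex.Re (tfshift a b (gauss s) x) =
  cos (2 * pi * dotr b x) * expR (- pi * wquad s (x - a)).
Proof. by rewrite ReM /= mulr0 subr0. Qed.

Lemma Im_tfshift_gauss s a b x : complex.Im (tfshift a b (gauss s) x) =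
  sin (2 * pi * dotr b x) * expR (- pi * wquad s (x - a)).
Proof. by rewrite ImM /= mulr0 add0r. Qed.

Lemma cvg_sum_fun (I : Type) (r : seq I) (f : I -> nat -> R) (l : I -> R) :
  (forall i, f i N @[N --> \oo] --> l i) ->
  \sum_(i <- r) f i N @[N --> \oo] --> \sum_(i <- r) l i.
Proof.
move=> fl; elim: r => [|i r IHr].
  by rewrite big_nil; under eq_fun do rewrite big_nil; exact: cvg_cst.
by rewrite big_cons; under eq_fun do rewrite big_cons; exact: cvgD.
Qed.

Lemma tfshift_gauss_cvg s (a_ b_ : nat -> 'rV[R]_n) a b x :
  (forall i, a_ N 0 i @[N --> \oo] --> a 0 i) ->
  (forall i, b_ N 0 i @[N --> \oo] --> b 0 i) ->
  normc (tfshift (a_ N) (b_ N) (gauss s) x - tfshift a b (gauss s) x)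
    @[N --> \oo] --> (0 : R).
Proof.
move=> ca cb.
have cth : 2 * pi * dotr (b_ N) x @[N --> \oo] --> 2 * pi * dotr b x.
  apply: cvgMr; apply: cvg_sum_fun => i.
  by apply: cvgMl; exact: cb.
have cq : expR (- pi * wquad s (x - a_ N)) @[N --> \oo] --> expR (- pi * wquad s (x - a)).
  apply: continuous_cvg; first exact: continuous_expR.
  apply: cvgMr; apply: cvg_sum_fun => i; apply: cvgMr.
  have cai : (x - a_ N) 0 i @[N --> \oo] --> (x - a) 0 i.
    rewrite !mxE; under eq_fun do rewrite !mxE.
    by apply: cvgB; [exact: cvg_cst|exact: ca].
  by rewrite expr2; under eq_fun do rewrite expr2; exact: cvgM.
pose D N := tfshift (a_ N) (b_ N) (gauss s) x - tfshift a b (gauss s) x.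
have DR : complex.Re (D N) @[N --> \oo] --> 0.
  rewrite -(subrr (complex.Re (tfshift a b (gauss s) x))).
  under eq_fun do rewrite ReD.
  apply: cvgD; last first.
    rewrite (_ : - _ = complex.Re (- tfshift a b (gauss s) x)); last first.
      by case: (tfshift _ _ _ _).
    exact: cvg_cst.
  rewrite Re_tfshift_gauss; under eq_fun do rewrite Re_tfshift_gauss.
  by apply: cvgM => //; apply: continuous_cvg; first exact: continuous_cos.
have DI : complex.Im (D N) @[N --> \oo] --> 0.
  rewrite -(subrr (complex.Im (tfshift a b (gauss s) x))).
  under eq_fun do rewrite ImD.
  apply: cvgD; last first.
    rewrite (_ : - _ = complex.Im (- tfshift a b (gauss s) x)); last first.
      by case: (tfshift _ _ _ _).
    exact: cvg_cst.
  rewrite Im_tfshift_gauss; under eq_fun do rewrite Im_tfshift_gauss.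
  by apply: cvgM => //; apply: continuous_cvg; first exact: continuous_sin.
have D0 : `|complex.Re (D N)| + `|complex.Im (D N)| @[N --> \oo] --> 0 + 0.
  by apply: cvgD; rewrite -[X in _ --> X](normr0 R); exact: cvg_norm.
rewrite addr0 in D0.
apply: (squeeze_cvgr _ (cvg_cst 0) D0); apply: nearW => N.
by apply/andP; split; [exact: normc_ge0|exact: normc_le_ReIm].
Qed.

Lemma normc_cvg_dist (u_ : nat -> R[i]) (z : R[i]) :
  normc (u_ N - z) @[N --> \oo] --> (0 : R) ->
  normc (u_ N) @[N --> \oo] --> normc z.
Proof.
move=> uz; apply/cvgrPdist_le => e e0.
move/cvgrPdist_le : uz => /(_ e e0); apply: filterS => N.
rewrite sub0r normrN ger0_norm ?normc_ge0// => /(le_trans _); apply.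
rewrite ler_norml; apply/andP; split.
  rewrite lerNl opprB lerBlDr addrC.
  by rewrite -[X in normc X <= _](subrKC z); exact: le_normcD.
rewrite lerBlDr -[normc (u_ N - z)]normcN opprB.
by rewrite -[X in normc X <= _](subrK (u_ N)); exact: le_normcD.
Qed.

(** Bounded shifts keep all seminorms of the windows bounded, so [tempered_cvg] needs only their
    pointwise convergence. *)
Lemma stft_gauss_cvg s (c : R) (u : ('rV[R]_n -> R[i]) -> R[i])
    (a_ b_ : nat -> 'rV[R]_n) a b (M : R) :
  tempered_distribution u -> 0 < c -> (forall i, c <= s i) ->
  (forall N, `|a_ N| <= M) -> (forall N, `|b_ N| <= M) ->
  (forall i, a_ N 0 i @[N --> \oo] --> a 0 i) ->
  (forall i, b_ N 0 i @[N --> \oo] --> b 0 i) ->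
  normc (stft (gauss s) u (a_ N) (b_ N)) @[N --> \oo] -->
  normc (stft (gauss s) u a b).
Proof.
move=> tu c0 cs aM bM ca cb.
have M0 : 0 <= M by apply: le_trans (aM 0%N).
apply: normc_cvg_dist; apply: tempered_cvg => //.
- by move=> N; exact: schwartz_tfshift_gauss cs.
- exact: schwartz_tfshift_gauss cs.
- move=> k l; have [C [m [C0 B]]] := tfshift_gauss_seminorm k l c0 cs.
  exists (C * ((1 + M) * (1 + M)) ^+ m) => N x; apply: le_trans (B _ _ _) _.
  rewrite ler_wpM2l// lerXn2r ?nnegrE ?mulr_ge0 ?addr_ge0//.
  by rewrite ler_pM ?addr_ge0// lerD2l.
- by move=> x; exact: tfshift_gauss_cvg.
Qed.

(** Rounding down to the grid of mesh 1 / (N + 1). A function of rounded points is constant on each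
    of countably many boxes, hence measurable whatever the function; measurability of the transform
    then follows from continuity along sequences. *)
Definition grid_round (N : nat) x : 'rV[R]_n :=
  \row_i ((Num.floor (N.+1%:R * x 0 i))%:~R / N.+1%:R).

Lemma grid_round_dist N x i : `|grid_round N x 0 i - x 0 i| <= N.+1%:R^-1.
Proof.
rewrite mxE; have N0 : 0 < N.+1%:R :> R by rewrite ltr0n.
have := floor_itv (N.+1%:R * x 0 i) => /andP[fl fu].
rewrite distrC ger0_norm ?subr_ge0; last by rewrite ler_pdivrMr// [leRHS]mulrC.
rewrite lerBlDr -[X in _ <= X + _]mul1r -mulrDl ler_pdivlMr// [x 0 i * _]mulrC ltW//.
by move: fu; rewrite intrD addrC.
Qed.

Lemma grid_round_cvg x i : grid_round N x 0 i @[N --> \oo] --> x 0 i.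
Proof.
apply/cvgrPdist_le => e e0; near=> N.
rewrite distrC; apply: le_trans (grid_round_dist _ _ _) _.
near: N; have := @cvg_harmonic R => /cvgrPdist_le/(_ e e0).
by apply: filterS => N; rewrite sub0r normrN ger0_norm// /harmonic/= invr_ge0.
Unshelve. all: by end_near. Qed.

Lemma grid_round_norm N x : `|grid_round N x| <= `|x| + 1.
Proof.
apply: norm_le_coord; first exact: addr_ge0.
move=> i; rewrite -(subrK (x 0 i) (grid_round N x 0 i)) addrC.
apply: le_trans (ler_normD _ _) _; apply: lerD; first exact: coord_le_norm.
apply: le_trans (grid_round_dist _ _ _) _.
by rewrite invf_le1 ?ltr0n// ler1n.
Qed.

Lemma measurable_grid_comp N (G : 'rV[R]_n * 'rV[R]_n -> R) :
  measurable_fun setT (fun x : 'rV[R]_n * 'rV[R]_n =>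
    G (grid_round N x.1, grid_round N x.2)).
Proof.
pose phi (x : 'rV[R]_n) : {ffun 'I_n -> int} :=
  [ffun i => Num.floor (N.+1%:R * x 0 i)].
pose psi (z : {ffun 'I_n -> int}) : 'rV[R]_n := \row_i ((z i)%:~R / N.+1%:R).
have rE x : grid_round N x = psi (phi x).
  by apply/rowP => i; rewrite !mxE ffunE.
have mphi z : measurable (phi @^-1` [set z]).
  have -> : phi @^-1` [set z] = rV_box (fun i =>
      `[(z i)%:~R / N.+1%:R, (z i + 1)%:~R / N.+1%:R[%classic).
    have N0 : 0 < N.+1%:R :> R by rewrite ltr0n.
    apply/seteqP; split=> [x <- i|x xz]; rewrite /= ?in_itv/=.
      rewrite ffunE ler_pdivrMr// ltr_pdivlMr// [x 0 i * _]mulrC.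
      exact: (floor_itv (N.+1%:R * x 0 i)).
    apply/ffunP => i; rewrite ffunE; apply: floor_def.
    have := xz i; rewrite /= in_itv/= ler_pdivrMr// ltr_pdivlMr//.
    by rewrite mulrC.
  by apply: measurable_rV_box => i; exact: measurable_itv.
move=> _ Y mY; rewrite setTI.
rewrite (_ : _ @^-1` Y = \bigcup_(z in
   [set z : {ffun 'I_n -> int} * {ffun 'I_n -> int} | Y (G (psi z.1, psi z.2))])
   ((phi @^-1` [set z.1]) `*` (phi @^-1` [set z.2]))).
  rewrite bigcup_mkcond; apply: countable_bigcupT_measurable.
    exact: countableP.
  by move=> z; case: ifP => // _; exact: measurableX.
apply/seteqP; split=> -[x y] /=.
  by move=> Yxy; exists (phi x, phi y) => //=; rewrite -!rE.
by case=> -[z w] /= Yzw [xz yw]; move: Yzw; rewrite -xz -yw !rE.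
Qed.

Lemma measurable_stft_gauss s (c : R) (u : ('rV[R]_n -> R[i]) -> R[i]) :
  tempered_distribution u -> 0 < c -> (forall i, c <= s i) ->
  measurable_fun setT (fun x : 'rV[R]_n * 'rV[R]_n =>
    normc (stft (gauss s) u x.1 x.2)).
Proof.
move=> tu c0 cs.
apply: (measurable_fun_cvg (h := fun N (x : 'rV[R]_n * 'rV[R]_n) =>
  normc (stft (gauss s) u (grid_round N x.1) (grid_round N x.2)))).
  move=> N.
  exact: (measurable_grid_comp N (fun x : 'rV[R]_n * 'rV[R]_n =>
    normc (stft (gauss s) u x.1 x.2))).
move=> x _; apply: (@stft_gauss_cvg _ c _ _ _ _ _ (`|x.1| + `|x.2| + 1)) => //.
- by move=> N; apply: le_trans (grid_round_norm _ _) _; rewrite lerD2r lerDl.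
- by move=> N; apply: le_trans (grid_round_norm _ _) _; rewrite lerD2r lerDr.
- exact: grid_round_cvg.
- exact: grid_round_cvg.
Qed.

End stft_measurable.

(** * The Fourier transform of a Gaussian *)

Section gaussian_fourier.
Context {R : realType}.
Local Notation mu := (@lebesgue_measure R).
Implicit Types (r x t : R).

Definition rgauss r x : R := expR (- r * x ^+ 2).

Lemma rgauss_ge0 r x : 0 <= rgauss r x. Proof. exact: expR_ge0. Qed.

Lemma continuous_rgauss r : continuous (rgauss r).
Proof.
move=> x; apply: continuous_comp; last exact: continuous_expR.
by apply: continuousM; [exact: cst_continuous|exact: exprn_continuous].
Qed.

Lemma measurable_rgauss r : measurable_fun setT (rgauss r).
Proof. by apply: continuous_measurable_fun; exact: continuous_rgauss. Qed.

Lemma integrable_rgauss r : 0 < r -> mu.-integrable setT (EFin \o rgauss r).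
Proof.
move=> r0; pose k := Num.sqrt r; have k0 : 0 < k by rewrite sqrtr_gt0.
have dF : (fun x => k * x)^`()%classic = cst k.
  by apply/funext => x; rewrite derive1Ml ?derive1_id ?mulr1.
have := @increasing_ge0_integration_by_substitutionT R (fun x => k * x) gauss_fun.
move=> /(_ _ _ _ _ _ _ _ _ gauss_fun_ge0)/wrap[].
- by move=> x y; rewrite ltr_pM2l.
- by rewrite dF => x; exact: cst_continuous.
- by rewrite dF; exact: is_cvg_cst.
- by rewrite dF; exact: is_cvg_cst.
- by move=> x; exact: derivableM.
- exact: gt0_cvgMrNy.
- exact: gt0_cvgMry.
- exact: continuous_gauss_fun.
rewrite integralT_gauss dF => H.
apply/integrableP; split; first by apply/measurable_EFinP; exact: measurable_rgauss.
under eq_integral do rewrite gee0_abs ?lee_fin ?rgauss_ge0//.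
have : (\int[mu]_x (rgauss r x)%:E = (k^-1)%:E * \int[mu]_x ((gauss_fun (k * x) * k)%:E))%E.
  rewrite -ge0_integralZl//; last 3 first.
  - apply/measurable_EFinP; apply: measurable_funM => //.
    apply: (measurableT_comp (@measurable_gauss_fun R)).
    exact: measurable_funM.
  - by move=> x _; rewrite lee_fin mulr_ge0 ?gauss_fun_ge0// ltW.
  - by rewrite lee_fin invr_ge0 ltW.
  apply: eq_integral => x _; rewrite -EFinM; congr EFin.
  rewrite mulrC mulfK ?gt_eqF// /gauss_fun /rgauss exprMn sqr_sqrtr ?mulNr//.
  exact: ltW.
by rewrite -H => ->; rewrite -EFinM ltry.
Qed.

Lemma integrable_rgauss_le r (C : R) (f : R -> R) : 0 < r ->
  measurable_fun setT f -> (forall x, `|f x| <= C * rgauss r x) ->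
  mu.-integrable setT (EFin \o f).
Proof.
move=> r0 mf fC.
apply: (@le_integrable _ _ _ mu setT _ _ (fun x => (C * rgauss r x)%:E)) => //.
- exact/measurable_EFinP.
- by move=> x _; rewrite lee_fin (le_trans (fC x))// ler_norm.
under eq_fun do rewrite EFinM.
by apply: integrableZl => //; exact: integrable_rgauss.
Qed.

Lemma Rintegral_addl (h : R) (f : R -> R) : mu.-integrable setT (EFin \o f) ->
  mu.-integrable setT (EFin \o (fun x => f (h + x))) ->
  \int[mu]_x f (h + x) = \int[mu]_x f x.
Proof.
move=> intf intfh; rewrite /Rintegral; congr fine.
pose phi (x : measurableTypeR R) : measurableTypeR R := h + x.
have mphi : measurable_fun setT phi by apply: measurable_funD.
have mf : measurable_fun setT (EFin \o f) by case/integrableP: intf.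
rewrite -[LHS](@integral_pushforward _ _ _ _ _ _ mphi mu setT (EFin \o f))//.
by apply: eq_measure_integral => A mA _; exact: lebesgue_measure_addl.
Qed.

Lemma Rintegral_opp (f : R -> R) : mu.-integrable setT (EFin \o f) ->
  mu.-integrable setT (EFin \o (fun x => f (- x))) ->
  \int[mu]_x f (- x) = \int[mu]_x f x.
Proof.
move=> intf intfh; rewrite /Rintegral; congr fine.
pose phi (x : measurableTypeR R) : measurableTypeR R := - x.
have mphi : measurable_fun setT phi by exact: oppr_measurable.
have mf : measurable_fun setT (EFin \o f) by case/integrableP: intf.
rewrite -[LHS](@integral_pushforward _ _ _ _ _ _ mphi mu setT (EFin \o f))//.
by apply: eq_measure_integral => A mA _; exact: lebesgue_measureN.
Qed.

(** A factor |x|, produced by differentiation, is traded for half of the exponent: |x| is at most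
    (1/r + 1) (1 + r x^2 / 2), and 1 + r x^2 / 2 is at most exp (r x^2 / 2). *)
Lemma normr_le_rgauss r x : 0 < r -> `|x| * rgauss r x <= r^-1 * rgauss (r / 2) x + rgauss (r / 2) x.
Proof.
move=> r0.
have E : rgauss r x = rgauss (r / 2) x * rgauss (r / 2) x.
  by rewrite /rgauss -expRD; congr expR; field.
have G1 : (1 + r / 2 * x ^+ 2) * rgauss (r / 2) x <= 1.
  rewrite -[leRHS](expRxMexpNx_1 (r / 2 * x ^+ 2)) /rgauss mulNr.
  by rewrite ler_wpM2r ?expR_ge0// expR_ge1Dx.
have xle : `|x| <= r^-1 * (1 + r / 2 * x ^+ 2) + 1 * (1 + r / 2 * x ^+ 2).
  have rV : r^-1 * (1 + r / 2 * x ^+ 2) = r^-1 + x ^+ 2 / 2 by field; rewrite gt_eqF.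
  have rV0 : 0 < r^-1 by rewrite invr_gt0.
  have : 0 <= (`|x| - 1) ^+ 2 by exact: sqr_ge0.
  have : `|x| ^+ 2 = x ^+ 2 by rewrite real_normK// num_real.
  have : 0 <= r / 2 * x ^+ 2 by rewrite mulr_ge0 ?sqr_ge0// divr_ge0// ltW.
  by rewrite rV mul1r; nra.
have g0 := rgauss_ge0 (r / 2) x.
rewrite E mulrA [leRHS](_ : _ = (r^-1 + 1) * 1 * rgauss (r / 2) x); last by ring.
rewrite ler_wpM2r//.
apply: le_trans (ler_wpM2r g0 xle) _.
rewrite (_ : _ * rgauss _ _ = (r^-1 + 1) * ((1 + r / 2 * x ^+ 2) * rgauss (r / 2) x)).
  by apply: ler_wpM2l => //; rewrite addr_ge0// invr_ge0 ltW.
by ring.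
Qed.

(** A dominating function common to all translations by |h| <= 1. The inequality amounts to (x + 2
    h)^2 >= 0 together with h^2 <= 1. *)
Lemma rgauss_shift r h x : 0 <= r -> `|h| <= 1 ->
  rgauss r (h + x) <= expR r * rgauss (r / 2) x.
Proof.
move=> r0; rewrite ler_norml => /andP[h0 h1].
rewrite /rgauss -expRD ler_expR.
have : 0 <= (x + 2 * h) ^+ 2 by exact: sqr_ge0.
have : h ^+ 2 <= 1 by rewrite -[1](expr1n _ 2) -ler_sqrt// !sqrtr_sqr normr1 ler_norml h0.
by nra.
Qed.

End gaussian_fourier.

Section gaussian_fourier_ode.
Context {R : realType}.
Local Notation mu := (@lebesgue_measure R).
Implicit Types (r x t : R).
Variable r : R.
Hypothesis r0 : 0 < r.

Let r20 : 0 < r / 2. Proof. by rewrite divr_gt0. Qed.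

(** The cosine part is the whole transform, the sine part being zero by parity. The value at 0 is
    never computed; its positivity suffices. *)
Definition gaussFT (xi : R) : R := \int[mu]_x (rgauss r x * cos (xi * x)).

Lemma measurable_cos_comp (f : R -> R) : measurable_fun setT f ->
  measurable_fun setT (fun x => cos (f x)).
Proof.
apply: (measurableT_comp (f := @cos R)).
by apply: continuous_measurable_fun; exact: continuous_cos.
Qed.

Lemma measurable_sin_comp (f : R -> R) : measurable_fun setT f ->
  measurable_fun setT (fun x => sin (f x)).
Proof.
apply: (measurableT_comp (f := @sin R)).
by apply: continuous_measurable_fun; exact: continuous_sin.
Qed.

Lemma integrable_rgauss_cos xi :
  mu.-integrable setT (EFin \o (fun x => rgauss r x * cos (xi * x))).
Proof.
apply: (integrable_rgauss_le (r := r) (C := 1)) => //.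
  apply: measurable_funM; first exact: measurable_rgauss.
  by apply: measurable_cos_comp; exact: measurable_funM.
move=> x; rewrite mul1r normrM ger0_norm ?rgauss_ge0// ler_piMr ?rgauss_ge0//.
by rewrite ler_norml cos_geN1 cos_le1.
Qed.

Lemma integrable_mull (c : R) (f : R -> R) : mu.-integrable setT (EFin \o f) ->
  mu.-integrable setT (EFin \o (fun x => c * f x)).
Proof.
move=> intf; rewrite (_ : _ \o _ = fun x => (c%:E * (EFin \o f) x)%E)//.
exact: integrableZl.
Qed.

Let S xi : R := \int[mu]_x (rgauss r x * (x * sin (xi * x))).

Let integrable_S xi :
  mu.-integrable setT (EFin \o (fun x => rgauss r x * (x * sin (xi * x)))).
Proof.
apply: (integrable_rgauss_le (r := r / 2) (C := r^-1 + 1)) => //.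
  apply: measurable_funM; first exact: measurable_rgauss.
  apply: measurable_funM => //.
  by apply: measurable_sin_comp; exact: measurable_funM.
move=> x; rewrite mulrDl mul1r; apply: le_trans (normr_le_rgauss x r0).
rewrite !normrM ger0_norm ?rgauss_ge0// mulrC ler_wpM2r ?rgauss_ge0//.
by rewrite ler_piMr// ler_norml sin_geN1 sin_le1.
Qed.

Let dcos (x xi : R) :
  is_derive xi (1 : R) (fun xi => rgauss r x * cos (xi * x)) (- (rgauss r x * (x * sin (xi * x)))).
Proof.
have dl : is_derive xi (1 : R) (fun xi : R => xi * x) x.
  by apply: is_derive_eq; rewrite /GRing.scale/=; ring.
have dc := @is_derive1_comp _ cos (fun xi : R => xi * x) xi _ _ (is_derive_cos _) dl.
have dm := @is_deriveM _ _ (fun=> rgauss r x) _ _ _ _ _ (is_derive_cst _ _ _) dc.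
apply: (is_derive_eq dm).
by rewrite /GRing.scale/= mulr0 addr0; ring.
Qed.

Let gaussFT_derive xi : is_derive xi (1 : R) gaussFT (- S xi).
Proof.
pose f (xi x : R) := rgauss r x * cos (xi * x).
pose G x : R := (r^-1 + 1) * rgauss (r / 2) x.
have intG : mu.-integrable setT (EFin \o G).
  apply: (integrable_rgauss_le (r := r / 2) (C := r^-1 + 1)) => //.
    by apply: measurable_funM => //; exact: measurable_rgauss.
  by move=> x; rewrite ger0_norm// mulr_ge0 ?rgauss_ge0// addr_ge0// invr_ge0 ltW.
have G0 x : 0 <= G x by rewrite mulr_ge0 ?rgauss_ge0// addr_ge0// invr_ge0 ltW.
have xiI : `]xi - 1, xi + 1[%classic xi by rewrite /= in_itv/= ltrBlDr !ltrDl ltr01.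
have intf x : `]xi - 1, xi + 1[%classic x -> mu.-integrable setT (EFin \o f x).
  by move=> _; exact: integrable_rgauss_cos.
have df x y : `]xi - 1, xi + 1[%classic x -> setT y -> derivable (f ^~ y) x 1.
  by move=> _ _; have [] := dcos y x.
have GE x y : `]xi - 1, xi + 1[%classic x -> setT y -> `|partial1of2 f x y| <= G y.
  move=> _ _; rewrite partial1of2E (@derive_val _ _ _ _ _ _ _ (dcos y x)).
  rewrite normrN; rewrite /G mulrDl mul1r; apply: le_trans (normr_le_rgauss y r0).
  rewrite !normrM ger0_norm ?rgauss_ge0// mulrC ler_wpM2r ?rgauss_ge0//.
  by rewrite ler_piMr// ler_norml sin_geN1 sin_le1.
have D := derivable_under_integral measurableT xiI intf df G0 intG GE.
have DE := differentiation_under_integral measurableT xiI intf df G0 intG GE.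
apply: DeriveDef; first exact: D.
rewrite -derive1E [LHS]DE -mulN1r -RintegralZl//.
apply: eq_Rintegral => x _.
by rewrite partial1of2E (@derive_val _ _ _ _ _ _ _ (dcos x xi)) mulN1r.
Qed.

(* Differentiating the translation invariant integral of
   [exp (- r x^2) sin (xi x)]. *)
Let S_gaussFT xi : 2 * r * S xi = xi * gaussFT xi.
Proof.
pose f (h x : R) := rgauss r (h + x) * sin (xi * (h + x)).
pose df (y : R) : R := xi * (rgauss r y * cos (xi * y)) -
   2 * r * (rgauss r y * (y * sin (xi * y))).
have dfE x h : is_derive h (1 : R) (f ^~ x) (df (h + x)).
  have dl : is_derive h (1 : R) (fun h : R => h + x) 1.
    by apply: is_derive_eq; rewrite addr0.
  have dg : is_derive (h + x) (1 : R) (rgauss r) (- (2 * r * (h + x)) * rgauss r (h + x)).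
    have dq : is_derive (h + x) (1 : R) (fun y : R => - r * y ^+ 2) (- (2 * r * (h + x))).
      apply: is_derive_eq; rewrite /GRing.scale/=; ring.
    have := @is_derive1_comp _ expR (fun y : R => - r * y ^+ 2) (h + x) _ _ (is_derive_expR _) dq.
    by move=> H; apply: (is_derive_eq H); rewrite mulrC.
  have ds : is_derive (h + x) (1 : R) (fun y : R => sin (xi * y)) (xi * cos (xi * (h + x))).
    have dq : is_derive (h + x) (1 : R) (fun y : R => xi * y) xi.
      by apply: is_derive_eq; rewrite /GRing.scale/=; ring.
    have := @is_derive1_comp _ sin (fun y : R => xi * y) (h + x) _ _ (is_derive_sin _) dq.
    by move=> H; apply: (is_derive_eq H); rewrite mulrC.
  have dm := @is_deriveM _ _ _ _ _ _ _ _ dg ds.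
  have := @is_derive1_comp _ _ (fun h : R => h + x) h _ _ dm dl.
  move=> H; apply: (is_derive_eq H).
  by rewrite /df /GRing.scale/=; ring.
pose C := (`|xi| + 2 * r * (r^-1 + 1)) * expR (r / 2).
have bdf (y : R) : `|df y| <= (`|xi| + 2 * r * (r^-1 + 1)) * rgauss (r / 2) y.
  apply: le_trans (ler_normB _ _) _; rewrite [leRHS]mulrDl; apply: lerD.
    rewrite normrM ler_wpM2l// normrM ger0_norm ?rgauss_ge0//.
    apply: (@le_trans _ _ (rgauss r y)).
      by rewrite ler_piMr ?rgauss_ge0// ler_norml cos_geN1 cos_le1.
    by rewrite ler_expR ler_wpM2r ?sqr_ge0// lerN2; move: r0; lra.
  have r2 : 0 <= 2 * r by rewrite mulr_ge0// ltW.
  rewrite normrM (ger0_norm r2) -[leRHS]mulrA ler_wpM2l//.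
  rewrite mulrDl mul1r; apply: le_trans (normr_le_rgauss y r0).
  rewrite !normrM ger0_norm ?rgauss_ge0// mulrC ler_wpM2r ?rgauss_ge0//.
  by rewrite ler_piMr// ler_norml sin_geN1 sin_le1.
have r40 : 0 < r / 2 / 2 by rewrite !divr_gt0.
have C0 : 0 <= `|xi| + 2 * r * (r^-1 + 1).
  by rewrite addr_ge0// !mulr_ge0 ?addr_ge0 ?invr_ge0// ltW.
(* The exponent is halved twice: once to absorb the factor y, once to absorb the translation by
   h. *)
have bdf' (h x : R) : `|h| <= 1 -> `|df (h + x)| <= C * rgauss (r / 2 / 2) x.
  move=> h1; apply: le_trans (bdf _) _; rewrite /C -[leRHS]mulrA ler_wpM2l//.
  by apply: rgauss_shift => //; exact: ltW.
pose G x := C * rgauss (r / 2 / 2) x.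
have G0 x : 0 <= G x by rewrite !mulr_ge0 ?rgauss_ge0 ?expR_ge0.
have intG : mu.-integrable setT (EFin \o G).
  apply: (integrable_rgauss_le (r := r / 2 / 2) (C := C)) => //.
    by apply: measurable_funM => //; exact: measurable_rgauss.
  by move=> x; rewrite ger0_norm.
have I0 : `](-1 : R), 1[%classic (0 : R) by rewrite /= in_itv/= ltrN10 ltr01.
have inth h : `](-1 : R), 1[%classic h -> mu.-integrable setT (EFin \o f h).
  rewrite /= in_itv/= => /andP[h0 h1].
  apply: (integrable_rgauss_le (r := r / 2) (C := expR r)) => //.
    apply: measurable_funM.
      apply: (measurableT_comp (measurable_rgauss r)).
      exact: measurable_funD.
    apply: measurable_sin_comp; apply: measurable_funM => //.
    exact: measurable_funD.
  move=> x; rewrite normrM ger0_norm ?rgauss_ge0//.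
  apply: (@le_trans _ _ (rgauss r (h + x))).
    by rewrite ler_piMr ?rgauss_ge0// ler_norml sin_geN1 sin_le1.
  by apply: rgauss_shift; [exact: ltW|rewrite ler_norml !ltW].
have dh h y : `](-1 : R), 1[%classic h -> setT y -> derivable (f ^~ y) h 1.
  by move=> _ _; have [] := dfE y h.
have GE h y : `](-1 : R), 1[%classic h -> setT y -> `|partial1of2 f h y| <= G y.
  rewrite /= in_itv/= => /andP[h0 h1] _.
  rewrite partial1of2E (@derive_val _ _ _ _ _ _ _ (dfE y h)).
  by apply: bdf'; rewrite ler_norml !ltW.
have DE := differentiation_under_integral measurableT I0 inth dh G0 intG GE.
(* The integral does not depend on h near 0, so its derivative, the integral of [df], vanishes; the
   two terms of [df] are the two sides of the claim. *)
have : (fun h => \int[mu]_y f h y)^`()%classic 0 = 0.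
  rewrite derive1E.
  transitivity ('D_1 (cst (\int[mu]_y f 0 y)) (0 : R)); last exact: derive_cst.
  apply: near_eq_derive => //.
  near=> h.
  have hI : `](-1 : R), 1[%classic h.
    rewrite /=; near: h; exact: near_in_itvoo.
  have Tf : \int[mu]_y f h y = \int[mu]_y f 0 y.
    have f0E : f 0 = fun x => rgauss r x * sin (xi * x).
      by apply/funext => x; rewrite /f add0r.
    rewrite f0E.
    apply: (Rintegral_addl (f := fun x => rgauss r x * sin (xi * x))).
      by rewrite -f0E; exact: inth.
    exact: inth.
  by rewrite Tf.
rewrite [LHS]DE.
have -> : \int[mu]_y partial1of2 f 0 y = \int[mu]_y df y.
  by apply: eq_Rintegral => y _;
    rewrite partial1of2E (@derive_val _ _ _ _ _ _ _ (dfE y 0)) add0r.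
rewrite RintegralB//; last 2 first.
- by apply: integrable_mull; exact: integrable_rgauss_cos.
- exact: integrable_mull.
rewrite !RintegralZl//; last exact: integrable_rgauss_cos.
by move=> /eqP; rewrite subr_eq0 => /eqP/esym.
Unshelve. all: by end_near. Qed.

Lemma gaussFT0_gt0 : 0 < gaussFT 0.
Proof.
have E : gaussFT 0 = \int[mu]_x rgauss r x.
  by apply: eq_Rintegral => x _; rewrite mul0r cos0 mulr1.
have int_r := integrable_rgauss r0.
rewrite E /Rintegral; apply: fine_gt0; apply/andP; split; last first.
  have /integrableP[_] := int_r; apply: le_lt_trans.
  by apply: ge0_le_integral => //;
    [move=> x _; rewrite lee_fin rgauss_ge0|by apply/measurable_EFinP; exact: measurable_rgauss
    |by do 2 apply: measurableT_comp => //; exact: measurable_rgauss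
    |by move=> x _; rewrite lee_fin ler_norm].
(* On [0, 1] the integrand is at least exp (- r). *)
apply: (@lt_le_trans _ _ (\int[mu]_x ((expR (- r))%:E * (\1_(`[0, 1]%classic : set R) x)%:E))%E).
  rewrite ge0_integralZl//; last by apply/measurable_EFinP; exact: measurable_indic.
  rewrite integral_indic//= setIT lebesgue_measure_itv/= lte_fin ltr01.
  by rewrite oppr0 adde0 mule1 lte_fin expR_gt0.
apply: ge0_le_integral => //.
- by apply: measurable_funeM; apply/measurable_EFinP; exact: measurable_indic.
- by apply/measurable_EFinP; exact: measurable_rgauss.
move=> x _; rewrite -EFinM lee_fin indicE.
case: (boolP (x \in _)) => [|_]; last by rewrite mulr0 rgauss_ge0.
rewrite inE/= in_itv/= => /andP[x0 x1]; rewrite mulr1 ler_expR mulNr lerN2.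
by rewrite ler_piMr ?(ltW r0)// expr_le1.
Qed.

(** The derivative - S and the identity [S_gaussFT] combine to the equation y' = - xi y / (2 r), for
    which exp (xi^2 / (4 r)) is an integrating factor. *)
Lemma gaussFTE xi : gaussFT xi = gaussFT 0 * expR (- xi ^+ 2 / (4 * r)).
Proof.
pose F (y : R) := gaussFT y * expR (y ^+ 2 / (4 * r)).
have dF y : is_derive y (1 : R) F 0.
  have dq : is_derive y (1 : R) (fun y : R => y ^+ 2 / (4 * r)) (y / (2 * r)).
    apply: is_derive_eq; rewrite /GRing.scale/=.
    by field; rewrite gt_eqF.
  have de := @is_derive1_comp _ expR _ y _ _ (is_derive_expR _) dq.
  have dm := @is_deriveM _ _ _ _ _ _ _ _ (gaussFT_derive y) de.
  apply: (is_derive_eq dm); rewrite /GRing.scale/=.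
  have -> : S y = y / (2 * r) * gaussFT y.
    apply: (mulfI (_ : 2 * r != 0)); first by rewrite mulf_neq0// gt_eqF.
    by rewrite S_gaussFT; field; rewrite gt_eqF.
  by ring.
have := is_derive_0_is_cst xi 0 dF.
rewrite /F expr0n/= mul0r expR0 mulr1 => <-.
by rewrite -mulrA -expRD mulNr subrr expR0 mulr1.
Qed.

Lemma Rintegral_rgauss_sin xi : \int[mu]_x (rgauss r x * sin (xi * x)) = 0.
Proof.
have int_s (z : R) : mu.-integrable setT (EFin \o (fun x => rgauss r x * sin (z * x))).
  apply: (integrable_rgauss_le (r := r) (C := 1)) => //.
    apply: measurable_funM; first exact: measurable_rgauss.
    by apply: measurable_sin_comp; exact: measurable_funM.
  move=> x; rewrite mul1r normrM ger0_norm ?rgauss_ge0// ler_piMr ?rgauss_ge0//.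
  by rewrite ler_norml sin_geN1 sin_le1.
have gN x : rgauss r (- x) * sin (xi * - x) = - 1 * (rgauss r x * sin (xi * x)).
  by rewrite /rgauss sqrrN mulrN sinN mulrN mulN1r.
have : \int[mu]_x (rgauss r (- x) * sin (xi * - x)) = \int[mu]_x (rgauss r x * sin (xi * x)).
  apply: (Rintegral_opp (f := fun x => rgauss r x * sin (xi * x))) => //.
  under eq_fun do rewrite gN.
  by under eq_fun do rewrite mulN1r -mulrN -sinN -mulNr; exact: int_s.
under eq_Rintegral do rewrite gN.
by rewrite RintegralZl// => /eqP; rewrite mulN1r -subr_eq0 -opprD oppr_eq0 -mulr2n mulrn_eq0/= => /eqP.
Qed.

End gaussian_fourier_ode.

(** * Complex integrals and products of one-variable functions *)

Section complex_integral.
Context d (T : measurableType d) {R : realType}.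
Variable mu : {measure set T -> \bar R}.
Implicit Types f g : T -> R[i].

Definition cint f : R[i] :=
  (\int[mu]_x complex.Re (f x)) +i* (\int[mu]_x complex.Im (f x)).

Definition cintegrable f :=
  mu.-integrable setT (fun x => (complex.Re (f x))%:E) /\
  mu.-integrable setT (fun x => (complex.Im (f x))%:E).

Lemma integrable_scale (c : R) (f : T -> R) :
  mu.-integrable setT (fun x => (f x)%:E) ->
  mu.-integrable setT (fun x => (c * f x)%:E).
Proof. by move=> intf; under eq_fun do rewrite EFinM; exact: integrableZl. Qed.

Lemma cintZ (c : R[i]) f : cintegrable f -> cint (fun x => c * f x) = c * cint f.
Proof.
move=> [rf jf]; apply: complex_eqP; rewrite ?ReM ?ImM /=.
  under eq_Rintegral do rewrite ReM.
  by rewrite RintegralB ?RintegralZl//; exact: integrable_scale.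
under eq_Rintegral do rewrite ImM.
by rewrite RintegralD ?RintegralZl//; exact: integrable_scale.
Qed.

End complex_integral.

Section product_integral.
Context d1 d2 (T1 : measurableType d1) (T2 : measurableType d2) {R : realType}.
Variable m1 : {sigma_finite_measure set T1 -> \bar R}.
Variable m2 : {sigma_finite_measure set T2 -> \bar R}.
Local Open Scope ereal_scope.

Lemma measurable_tensor (f : T1 -> R) (g : T2 -> R) :
  measurable_fun setT f -> measurable_fun setT g ->
  measurable_fun setT (fun x : T1 * T2 => (f x.1 * g x.2)%R).
Proof.
move=> mf mg; apply: measurable_funM.
  exact: (measurableT_comp mf measurable_fst).
exact: (measurableT_comp mg measurable_snd).
Qed.

Lemma integrable_tensor (f : T1 -> R) (g : T2 -> R) :
  m1.-integrable setT (EFin \o f) -> m2.-integrable setT (EFin \o g) ->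
  (m1 \x m2).-integrable setT (fun x => (f x.1 * g x.2)%:E).
Proof.
move=> /integrableP[/measurable_EFinP mf fi] /integrableP[/measurable_EFinP mg gi].
apply/integrable12ltyP; first by apply/measurable_EFinP; exact: measurable_tensor.
rewrite (eq_integral (fun x => `|(f x)%:E| * \int[m2]_y `|(EFin \o g) y|)); last first.
  move=> x _; rewrite -ge0_integralZl//.
    by apply: eq_integral => y _; rewrite EFinM abseM.
  by apply: measurableT_comp => //; apply/measurable_EFinP.
rewrite ge0_integralZr//; last 2 first.
- by apply: measurableT_comp => //; apply/measurable_EFinP.
- by apply: integral_ge0.
by rewrite lte_mul_pinfty ?integral_ge0// ge0_fin_numE ?integral_ge0.
Qed.

Lemma Rintegral_tensor (f : T1 -> R) (g : T2 -> R) :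
  m1.-integrable setT (EFin \o f) -> m2.-integrable setT (EFin \o g) ->
  (\int[m1 \x m2]_x (f x.1 * g x.2) = (\int[m1]_x f x) * (\int[m2]_y g y))%R.
Proof.
move=> intf intg; have intfg := integrable_tensor intf intg.
rewrite /Rintegral -(integral12_prod_meas1 intfg) /fubini_F/=.
rewrite (eq_integral (fun x => (f x)%:E * \int[m2]_y (EFin \o g) y)); last first.
  move=> x _; rewrite -integralZl//.
rewrite -fineM; last 2 first.
- exact: integrable_fin_num.
- exact: integrable_fin_num.
have gfin : \int[m2]_y (EFin \o g) y \is a fin_num by exact: integrable_fin_num.
by rewrite -(fineK gfin) integralZr.
Qed.

End product_integral.

Lemma measurable_cprod d (T : measurableType d) {R : realType} (I : Type)
    (s : seq I) (F : I -> T -> R[i]) :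
  (forall i, measurable_fun setT (fun t => complex.Re (F i t))) ->
  (forall i, measurable_fun setT (fun t => complex.Im (F i t))) ->
  measurable_fun setT (fun t => complex.Re (\prod_(i <- s) F i t)) /\
  measurable_fun setT (fun t => complex.Im (\prod_(i <- s) F i t)).
Proof.
move=> mR mI; elim: s => [|i s [IHR IHI]].
  by split; under eq_fun do rewrite big_nil; exact: measurable_cst.
split; under eq_fun do rewrite big_cons ?ReM ?ImM.
  by apply: measurable_funB; exact: measurable_funM.
by apply: measurable_funD; exact: measurable_funM.
Qed.

Section product_formula.
Context {R : realType}.
Local Notation mu := (@lebesgue_measure R).

Lemma integrable_rV_cons n (f : 'rV[R]_n.+1 -> R) :
  measurable_fun setT f ->
  (mu \x lebesgue_rV n)%E.-integrable setT (fun p => (f (rV_cons p))%:E) ->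
  (lebesgue_rV n.+1).-integrable setT (fun x => (f x)%:E) /\
  \int[lebesgue_rV n.+1]_x f x = \int[(mu \x lebesgue_rV n)%E]_p f (rV_cons p).
Proof.
move=> mf intf; have mc := @measurable_rV_cons R n.
split.
  apply: (@integrable_pushforward _ _ _ _ _ _ mc (mu \x lebesgue_rV n)%E setT
    (EFin \o f)) => //.
  exact/measurable_EFinP.
rewrite /Rintegral; congr fine.
by rewrite -[RHS](@integral_pushforward _ _ _ _ _ _ mc (mu \x lebesgue_rV n)%E setT
  (EFin \o f))//; exact/measurable_EFinP.
Qed.

(** The first coordinate is split off by Fubini; real and imaginary parts of the product give four
    tensor products. *)
Lemma cintegral_prod n (h : 'I_n -> R -> R[i]) :
  (forall i, cintegrable mu (h i)) ->
  cintegrable (lebesgue_rV n) (fun t : 'rV[R]_n => \prod_i h i (t 0 i)) /\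
  cint (lebesgue_rV n) (fun t : 'rV[R]_n => \prod_i h i (t 0 i)) =
    \prod_i cint mu (h i).
Proof.
elim: n h => [|n IHn] h inth.
  have intc (c : R) : (lebesgue_rV 0).-integrable setT (fun _ : 'rV[R]_0 => c%:E).
    apply/integrableP; split => //.
    by rewrite [X in (X < _)%E]integral_dirac//= diracT mul1e ltry.
  set F := (X in cintegrable _ X).
  have -> : F = fun=> 1 by apply/funext => t; rewrite /F big_ord0.
  rewrite big_ord0; split; first by split; exact: intc.
  rewrite (_ : cint _ _ = cint (lebesgue_rV 0) (fun=> 1)); last first.
    by congr cint; apply/funext => t; rewrite big_ord0.
  have E (c : R) : \int[lebesgue_rV 0]_(_ in setT) c = c.
    by rewrite /Rintegral integral_cst//= indicT mulr1.
  by rewrite /cint/= !E.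
have [[rP jP] eP] := IHn (fun i => h (lift 0 i)) (fun i => inth (lift 0 i)).
have [r0 j0] := inth 0.
pose P (v : 'rV[R]_n) := \prod_i h (lift 0 i) (v 0 i).
have mRe i : measurable_fun setT (fun x => complex.Re (h i x)).
  by have [/integrableP[/measurable_EFinP]] := inth i.
have mIm i : measurable_fun setT (fun x => complex.Im (h i x)).
  by have [_ /integrableP[/measurable_EFinP]] := inth i.
have prodE (p : measurableTypeR R * 'rV[R]_n) :
    \prod_i h i (rV_cons p 0 i) = h 0 p.1 * P p.2.
  rewrite big_ord_recl rV_consE0; congr (_ * _).
  by apply: eq_bigr => i _; rewrite rV_consES.
have [mpR mpI] := measurable_cprod (index_enum 'I_n.+1)
  (F := fun i (t : 'rV[R]_n.+1) => h i (rV_coord i t))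
  (fun i => measurableT_comp (mRe i) (measurable_rV_coord i))
  (fun i => measurableT_comp (mIm i) (measurable_rV_coord i)).
have tens (f : R -> R) (g : 'rV[R]_n -> R) := @integrable_tensor _ _ _ _ _ mu (lebesgue_rV n) f g.
have Rtens (f : R -> R) (g : 'rV[R]_n -> R) := @Rintegral_tensor _ _ _ _ _ mu (lebesgue_rV n) f g.
have tRR := tens (fun x => complex.Re (h 0 x)) (fun v => complex.Re (P v)) r0 rP.
have tII := tens (fun x => complex.Im (h 0 x)) (fun v => complex.Im (P v)) j0 jP.
have tRI := tens (fun x => complex.Re (h 0 x)) (fun v => complex.Im (P v)) r0 jP.
have tIR := tens (fun x => complex.Im (h 0 x)) (fun v => complex.Re (P v)) j0 rP.
have intR : (mu \x lebesgue_rV n)%E.-integrable setT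
    (fun p => (complex.Re (\prod_i h i (rV_cons p 0 i)))%:E).
  under eq_fun do rewrite prodE ReM EFinB.
  exact: (integrableB _ tRR tII).
have intI : (mu \x lebesgue_rV n)%E.-integrable setT
    (fun p => (complex.Im (\prod_i h i (rV_cons p 0 i)))%:E).
  under eq_fun do rewrite prodE ImM EFinD.
  exact: (integrableD _ tRI tIR).
have [iR eR] := integrable_rV_cons mpR intR.
have [iI eI] := integrable_rV_cons mpI intI.
split; first by split.
rewrite big_ord_recl -eP; apply: complex_eqP.
  rewrite ReM/= [LHS]eR.
  under eq_Rintegral do rewrite prodE ReM.
  rewrite RintegralB// (Rtens (fun x => complex.Re (h 0 x)) (fun v => complex.Re (P v)))//.
  by rewrite (Rtens (fun x => complex.Im (h 0 x)) (fun v => complex.Im (P v))).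
rewrite ImM/= [LHS]eI.
under eq_Rintegral do rewrite prodE ImM.
rewrite RintegralD// (Rtens (fun x => complex.Re (h 0 x)) (fun v => complex.Im (P v)))//.
by rewrite (Rtens (fun x => complex.Im (h 0 x)) (fun v => complex.Re (P v))).
Qed.

End product_formula.

(** * The cross-Wigner distribution of shifted Gaussians *)

Section wigner_gaussian.
Context {R : realType}.
Local Notation mu := (@lebesgue_measure R).

(** The exponential of r + i t, with modulus and phase kept apart so that an identity between
    exponentials splits into two real ones. *)
Definition cexp (r t : R) : R[i] := (expR r)%:C * cis t.

Lemma cisD (s t : R) : cis (s + t) = cis s * cis t.
Proof.
apply: complex_eqP; rewrite ?ReM ?ImM /=; first exact: cosD.
by rewrite sinD addrC.
Qed.

Lemma cis0 : cis (0 : R) = 1.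
Proof. by rewrite /cis cos0 sin0. Qed.

Lemma cexpD (r s t u : R) : cexp (r + s) (t + u) = cexp r t * cexp s u.
Proof.
rewrite /cexp expRD cisD mulrACA; congr (_ * _).
by apply: complex_eqP; rewrite ?ReM ?ImM /=; ring.
Qed.

Lemma cexp0 : cexp 0 0 = 1.
Proof. by rewrite /cexp expR0 cis0 mulr1. Qed.

Lemma cexp_sum n (r t : 'I_n -> R) :
  cexp (\sum_i r i) (\sum_i t i) = \prod_i cexp (r i) (t i).
Proof.
elim: n r t => [|n IHn] r t; first by rewrite !big_ord0 cexp0.
by rewrite !big_ord_recl cexpD IHn.
Qed.

Lemma conj_cexp (k r t : R) : conjc (k%:C * cexp r t) = k%:C * cexp r (- t).
Proof. by rewrite /cexp /cis cosN sinN; apply: complex_eqP; rewrite /=; ring. Qed.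

Lemma normc_cexp (r t : R) : normc (cexp r t) = expR r.
Proof. by rewrite normcM normc_cis mulr1 normc_real ger0_norm// expR_ge0. Qed.

Lemma realcM (a b : R) : (a * b)%:C = a%:C * b%:C :> R[i].
Proof. by apply: complex_eqP; rewrite ?ReM ?ImM /=; ring. Qed.

(** Writing xi y = xi (c + y) - xi c, translation invariance reduces the integral to the centred one
    and leaves the phase - xi c. *)
Lemma cint_shifted_gaussian (r c xi : R) : 0 < r ->
  cintegrable mu (fun y => cexp (- r * (c + y) ^+ 2) (xi * y)) /\
  cint mu (fun y => cexp (- r * (c + y) ^+ 2) (xi * y)) =
    (gaussFT r 0)%:C * cexp (- xi ^+ 2 / (4 * r)) (- (xi * c)).
Proof.
move=> r0.
have intC := integrable_rgauss_cos r0 xi.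
have intS : mu.-integrable setT (EFin \o (fun x => rgauss r x * sin (xi * x))).
  apply: (integrable_rgauss_le (r := r) (C := 1)) => //.
    apply: measurable_funM; first exact: measurable_rgauss.
    by apply: measurable_sin_comp; exact: measurable_funM.
  move=> x; rewrite mul1r normrM ger0_norm ?rgauss_ge0// ler_piMr ?rgauss_ge0//.
  by rewrite ler_norml sin_geN1 sin_le1.
pose a := cos (xi * c); pose b := sin (xi * c).
pose u x := a * (rgauss r x * cos (xi * x)) + b * (rgauss r x * sin (xi * x)).
pose v x := a * (rgauss r x * sin (xi * x)) - b * (rgauss r x * cos (xi * x)).
have angle y : xi * y = xi * (c + y) - xi * c by ring.
have uE y : complex.Re (cexp (- r * (c + y) ^+ 2) (xi * y)) = u (c + y).
  rewrite /cexp ReM /= {1}angle cosB /u /a /b /rgauss; ring.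
have vE y : complex.Im (cexp (- r * (c + y) ^+ 2) (xi * y)) = v (c + y).
  rewrite /cexp ImM /= {1}angle sinB /v /a /b /rgauss; ring.
have intu : mu.-integrable setT (EFin \o u).
  rewrite (_ : EFin \o u = fun x => ((a * (rgauss r x * cos (xi * x)))%:E +
     (b * (rgauss r x * sin (xi * x)))%:E)%E)//.
  by apply: integrableD => //; exact: integrable_mull.
have intv : mu.-integrable setT (EFin \o v).
  rewrite (_ : EFin \o v = fun x => ((a * (rgauss r x * sin (xi * x)))%:E -
     (b * (rgauss r x * cos (xi * x)))%:E)%E)//.
  by apply: integrableB => //; exact: integrable_mull.
have int_shift (f : R -> R) : mu.-integrable setT (EFin \o f) ->
    mu.-integrable setT (EFin \o (fun y => f (c + y))).
  move=> /integrableP[mf foo].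
  pose phi (x : measurableTypeR R) : measurableTypeR R := c + x.
  have mphi : measurable_fun setT phi by apply: measurable_funD.
  apply/integrableP; split.
    exact: (measurableT_comp mf mphi).
  rewrite -[X in (X < _)%E](@ge0_integral_pushforward _ _ _ _ _ _ mphi mu setT
    (fun x => `|(EFin \o f) x|%E))//; last exact: measurableT_comp.
  rewrite [X in (X < _)%E](_ : _ = (\int[mu]_x `|(EFin \o f) x|)%E)//.
  by apply: eq_measure_integral => A mA _; exact: lebesgue_measure_addl.
have intuc := int_shift _ intu; have intvc := int_shift _ intv.
split.
  by split; under eq_fun do rewrite ?uE ?vE.
have Cu : \int[mu]_y complex.Re (cexp (- r * (c + y) ^+ 2) (xi * y)) = a * gaussFT r xi.
  under eq_Rintegral do rewrite uE.
  rewrite Rintegral_addl// /u RintegralD//; try exact: integrable_mull.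
  by rewrite !RintegralZl// Rintegral_rgauss_sin// mulr0 addr0.
have Cv : \int[mu]_y complex.Im (cexp (- r * (c + y) ^+ 2) (xi * y)) = - b * gaussFT r xi.
  under eq_Rintegral do rewrite vE.
  rewrite Rintegral_addl// /v RintegralB//; try exact: integrable_mull.
  by rewrite !RintegralZl// Rintegral_rgauss_sin// mulr0 add0r mulNr.
rewrite /cint Cu Cv gaussFTE// /cexp /cis cosN sinN -/a -/b.
by apply: complex_eqP; rewrite ?ReM ?ImM /=; ring.
Qed.

Lemma tfshift_gaussianE n (a b t : 'rV[R]_n) :
  tfshift a b (@gaussian R n) t = (2 `^ (n%:R / 4))%:C *
    cexp (- pi * dotr (t - a) (t - a)) (2 * pi * dotr b t).
Proof. by rewrite /tfshift /gaussian realcM /cexp; ring. Qed.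

Lemma tfshift_gaussE n s (a b t : 'rV[R]_n) :
  tfshift a b (gauss s) t = cexp (- pi * wquad s (t - a)) (2 * pi * dotr b t).
Proof. by rewrite /tfshift /gauss /cexp mulrC. Qed.

(** The normalisations of the two Gaussians times d one-dimensional integrals of exp (- pi y^2 / 2);
    the exponent comes from 2 pi (y / 2)^2. *)
Definition wigner_cst d : R :=
  (2 `^ (d%:R / 4)) ^+ 2 * (gaussFT (pi / 2) 0) ^+ d.

Lemma wigner_cst_gt0 d : 0 < wigner_cst d.
Proof.
have p0 : 0 < pi / 2 :> R by rewrite divr_gt0// pi_gt0.
by rewrite mulr_gt0// exprn_gt0// ?powR_gt0// gaussFT0_gt0.
Qed.

(* The cross-Wigner distribution of [pi(z) phi0] and [pi(w) phi0] is, up to a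
   constant of modulus [wigner_cst d], the time-frequency shift of the Gaussian
   [exp (- 2 pi |.|^2)] by the midpoint of [z] and [w] and by [J (z - w)],
   where [J (x, y) = (y, - x)]. *)
Lemma wigner_gaussian d (z w : 'rV[R]_(d + d)) :
  wigner (phase_shift z (@gaussian R d)) (phase_shift w (@gaussian R d)) =
  fun zeta => ((wigner_cst d)%:C *
      cexp 0 (2 * pi * \sum_i (lsubmx z 0 i - lsubmx w 0 i) *
                             ((rsubmx z 0 i + rsubmx w 0 i) / 2))) *
    tfshift (2^-1 *: (z + w))
      (row_mx (rsubmx z - rsubmx w) (lsubmx w - lsubmx z))
      (gauss (fun=> 2)) zeta.
Proof.
apply/funext => zeta.
have p0 : 0 < pi / 2 :> R by rewrite divr_gt0// pi_gt0.
pose x := lsubmx zeta; pose om := rsubmx zeta.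
pose z1 := lsubmx z; pose z2 := rsubmx z; pose w1 := lsubmx w; pose w2 := rsubmx w.
pose k : R := 2 `^ (d%:R / 4).
(* By the parallelogram identity the exponent splits into [A], free of t, and a Gaussian in t
   centred at - c. Likewise [B] is the part of the phase free of t, and [xi] the frequency in t. *)
pose c i : R := w1 0 i - z1 0 i.
pose xi i : R := 2 * pi * ((z2 0 i + w2 0 i) / 2 - om 0 i).
pose A : R := \sum_i (- (2 * pi) * (x 0 i - (z1 0 i + w1 0 i) / 2) ^+ 2).
pose B : R := \sum_i (2 * pi * ((z2 0 i - w2 0 i) * x 0 i)).
have integrandE (t : 'rV[R]_d) :
    phase_shift z (@gaussian R d) (x + 2^-1 *: t) *
    conjc (phase_shift w (@gaussian R d) (x - 2^-1 *: t)) *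
    cis (- (2 * pi * dotr om t)) =
    ((k ^+ 2)%:C * cexp A B) *
    \prod_i cexp (- (pi / 2) * (c i + t 0 i) ^+ 2) (xi i * t 0 i).
  rewrite /phase_shift !tfshift_gaussianE -cexp_sum -[RHS]mulrA -[in RHS]cexpD.
  rewrite conj_cexp.
  have -> (s : R) : cis s = cexp 0 s by rewrite /cexp expR0 mul1r.
  rewrite -/k expr2 realcM.
  set e1 := cexp _ _; set e2 := cexp _ _; set e3 := cexp _ _.
  have -> : k%:C * e1 * (k%:C * e2) * e3 = k%:C * k%:C * (e1 * e2 * e3) by ring.
  congr (_ * _); rewrite /e1 /e2 /e3 -!cexpD; congr cexp.
    rewrite addr0 /A /dotr !mulr_sumr -!big_split/=.
    apply: eq_bigr => i _; rewrite !mxE /c /x /z1 /w1 !mxE.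
    by field.
  rewrite /B /dotr !mulr_sumr -!sumrN -!big_split/=.
  apply: eq_bigr => i _; rewrite !mxE /xi /om /x /z2 /w2 !mxE.
  by field.
pose h i (y : R) := cexp (- (pi / 2) * (c i + y) ^+ 2) (xi i * y).
have hP i := cint_shifted_gaussian (c i) (xi i) p0.
have [intP valP] := cintegral_prod (h := h) (fun i => (hP i).1).
rewrite /wigner.
transitivity (cint (lebesgue_rV d) (fun t : 'rV[R]_d =>
    ((k ^+ 2)%:C * cexp A B) * \prod_i h i (t 0 i))).
  by congr cint; apply/funext => t; exact: integrandE.
rewrite cintZ// valP.
under eq_bigr => i _ do rewrite (hP i).2.
rewrite big_split/= prodr_const card_ord -cexp_sum.
rewrite tfshift_gaussE /wigner_cst -/k.
have -> : (gaussFT (pi / 2) 0)%:C ^+ d = (gaussFT (pi / 2) 0 ^+ d)%:C :> R[i].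
  by elim: (d) => [|m IHm]; rewrite ?expr0// !exprS IHm realcM.
rewrite [in RHS]realcM.
set e1 := cexp A B; set e2 := cexp _ _; set e3 := cexp _ _; set e4 := cexp _ _.
set g := (_ ^+ d)%:C; set kk := (k ^+ 2)%:C.
have -> : kk * e1 * (g * e2) = kk * g * (e1 * e2) by ring.
rewrite -[RHS]mulrA; congr (_ * _); rewrite /e1 /e2 /e3 /e4 -!cexpD; congr cexp.
  (* The transform contributes - xi^2 / (2 pi), which is - 2 pi times the squared distance of [om]
     to the mean frequency: the frequency half of the quadratic form, of which [A] is the position
     half. *)
  rewrite add0r /A /wquad big_split_ord/= -!big_split/= mulr_sumr.
  apply: eq_bigr => i _; rewrite !mxE /xi /om /x /z1 /w1 /z2 /w2 !mxE.
  by move: pi (lt0r_neq0 (pi_gt0 R)) => P PN; field.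
rewrite /B /dotr big_split_ord/= -!big_split/= !mulr_sumr -!big_split/=.
apply: eq_bigr => i _; rewrite !row_mxEl !row_mxEr !mxE /xi /c /om /x /z1 /w1 /z2 /w2 !mxE.
by field.
Qed.

End wigner_gaussian.

(** * Random walks *)

Section elementary_limits.
Context {R : realType}.
Implicit Types x y h : R.

Lemma ge0_of_derive (f df : R -> R) : f 0 = 0 ->
  (forall x, is_derive x (1 : R) f (df x)) -> (forall x, 0 <= x -> 0 <= df x) ->
  forall x, 0 <= x -> 0 <= f x.
Proof.
move=> f0 dfE df0 x x0.
have cf : {within `[0, x], continuous f}.
  by apply: derivable_within_continuous => y _; have [] := dfE y.
have [c] := MVT_segment x0 (fun y _ => dfE y) cf.
rewrite in_itv/= f0 !subr0 => /andP[c0 _] ->.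
by rewrite mulr_ge0// df0.
Qed.

(** Four successive integrations, from 0, of the inequality cos <= 1. *)
Lemma cos_taylor_ge0 x : 0 <= x ->
  1 - x ^+ 2 / 2 <= cos x <= 1 - x ^+ 2 / 2 + x ^+ 4 / 24.
Proof.
have h1 y : 0 <= y -> 0 <= y - sin y.
  apply: (@ge0_of_derive (fun y => y - sin y) (fun y => 1 - cos y)); first by rewrite sin0 subrr.
  by move=> z _; rewrite subr_ge0 cos_le1.
have h2 y : 0 <= y -> 0 <= cos y - 1 + y ^+ 2 / 2.
  apply: (@ge0_of_derive (fun y => cos y - 1 + y ^+ 2 / 2) (fun y => y - sin y)).
  - by rewrite cos0 expr0n/= mul0r subrr addr0.
  - by move=> z; apply: is_derive_eq; rewrite /GRing.scale/=; field.
  - exact: h1.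
have h3 y : 0 <= y -> 0 <= sin y - y + y ^+ 3 / 6.
  apply: (@ge0_of_derive (fun y => sin y - y + y ^+ 3 / 6)
    (fun y => cos y - 1 + y ^+ 2 / 2)).
  - by rewrite sin0 expr0n/= mul0r subrr addr0.
  - by move=> z; apply: is_derive_eq; rewrite /GRing.scale/=; field.
  - exact: h2.
have h4 y : 0 <= y -> 0 <= 1 - y ^+ 2 / 2 + y ^+ 4 / 24 - cos y.
  apply: (@ge0_of_derive (fun y => 1 - y ^+ 2 / 2 + y ^+ 4 / 24 - cos y)
    (fun y => sin y - y + y ^+ 3 / 6)).
  - by rewrite cos0 !expr0n/= !mul0r subr0 addr0 subrr.
  - by move=> z; apply: is_derive_eq; rewrite /GRing.scale/=; field.
  - exact: h3.
move=> x0; apply/andP; split; first by have := h2 x x0; lra.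
by have := h4 x x0; lra.
Qed.

Lemma cos_taylor x : 1 - x ^+ 2 / 2 <= cos x <= 1 - x ^+ 2 / 2 + x ^+ 4 / 24.
Proof.
have [x0|x0] := leP 0 x; first exact: cos_taylor_ge0.
have -> : x ^+ 4 = (- x) ^+ 4 by ring.
rewrite -cosN -(sqrrN x).
by apply: cos_taylor_ge0; rewrite oppr_ge0 ltW.
Qed.

Lemma expRN_taylor (u : R) : 0 <= u -> 1 - u <= expR (- u) <= 1 - u + u ^+ 2.
Proof.
move=> u0; apply/andP; split; first exact: expR_ge1Dx.
rewrite expRN -[leLHS]mul1r ler_pdivrMr ?expR_gt0//.
apply: (@le_trans _ _ ((1 - u + u ^+ 2) * (1 + u))).
  have -> : (1 - u + u ^+ 2) * (1 + u) = 1 + u ^+ 3 by ring.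
  by rewrite lerDl exprn_ge0.
rewrite ler_wpM2l ?expR_ge1Dx//.
have : 0 <= (u - 1) ^+ 2 by exact: sqr_ge0.
by nra.
Qed.

Lemma cos_sub_expR x : `|cos x - expR (- (x ^+ 2 / 2))| <= x ^+ 4.
Proof.
have /andP[c1 c2] := cos_taylor x.
have u0 : 0 <= x ^+ 2 / 2 by rewrite divr_ge0// sqr_ge0.
have /andP[e1 e2] := expRN_taylor u0.
have x4 : x ^+ 4 = (x ^+ 2) ^+ 2 by rewrite -exprM.
have q : 0 <= (x ^+ 2) ^+ 2 by exact: sqr_ge0.
rewrite ler_norml; apply/andP; split; rewrite x4 in c2 *; nra.
Qed.

Lemma subrX_le (a b : R) n : `|a| <= 1 -> `|b| <= 1 ->
  `|a ^+ n - b ^+ n| <= n%:R * `|a - b|.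
Proof.
move=> a1 b1; elim: n => [|n IHn]; first by rewrite subrr normr0 mul0r.
have -> : a ^+ n.+1 - b ^+ n.+1 = a * (a ^+ n - b ^+ n) + (a - b) * b ^+ n.
  by rewrite !exprS; ring.
apply: le_trans (ler_normD _ _) _; rewrite -natr1 [leRHS]mulrDl mul1r; apply: lerD.
  by rewrite normrM (le_trans _ IHn)// ler_piMl.
by rewrite normrM normrX ler_piMr// exprn_ile1.
Qed.

(** The step length of a walk with N + 1 steps, whose endpoint thus has variance k^2 for every N. *)
Definition step (k : R) (N : nat) : R := k / Num.sqrt N.+1%:R.

Lemma step_sqr k N : N.+1%:R * step k N ^+ 2 = k ^+ 2.
Proof.
rewrite /step expr_div_n sqr_sqrtr ?ler0n// mulrC divfK// pnatr_eq0//.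
Qed.

Lemma cos_expr_cvg x :
  cos (step x N) ^+ N.+1 @[N --> \oo] --> expR (- (x ^+ 2 / 2)).
Proof.
have bnd N : `|cos (step x N) ^+ N.+1 - expR (- (x ^+ 2 / 2))| <= x ^+ 4 * N.+1%:R^-1.
  have -> : expR (- (x ^+ 2 / 2)) = expR (- (step x N ^+ 2 / 2)) ^+ N.+1.
    rewrite -expRM_natl; congr expR.
    by rewrite -(step_sqr x N); field.
  apply: le_trans (subrX_le _ _ _) _.
  - by rewrite ler_norml cos_geN1 cos_le1.
  - rewrite ger0_norm ?expR_ge0// -expR0 ler_expR oppr_le0.
    by rewrite divr_ge0// sqr_ge0.
  apply: le_trans (ler_wpM2l _ (cos_sub_expR _)) _ => //.
  rewrite (_ : x ^+ 4 = (N.+1%:R * step x N ^+ 2) ^+ 2); last by rewrite step_sqr -exprM.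
  have M0 : N.+1%:R != 0 :> R by rewrite pnatr_eq0.
  rewrite le_eqVlt; apply/orP; left; apply/eqP.
  by move: N.+1%:R M0 => M M0; field.
apply/cvgrPdist_le => e e0.
have : x ^+ 4 * N.+1%:R^-1 @[N --> \oo] --> x ^+ 4 * 0.
  by apply: cvgMr; exact: cvg_harmonic.
rewrite mulr0 => /cvgrPdist_le/(_ e e0); apply: filterS => N.
rewrite sub0r normrN => H; rewrite distrC; apply: le_trans (bnd N) _.
by apply: le_trans H; exact: ler_norm.
Qed.

(** A cruder constant than 1/2 is enough: what matters is the exponent quadratic in h, which makes
    the (N + 1)-st power bounded for h = k / sqrt (N + 1). For h > 1/2, h itself is below 2 h^2. *)
Lemma cosh_le h : (expR h + expR (- h)) / 2 <= expR (2 * h ^+ 2).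
Proof.
wlog h0 : h / 0 <= h.
  move=> H; have [h0|h0] := leP 0 h; first exact: H.
  by have := H (- h); rewrite oppr_ge0 opprK sqrrN addrC => /(_ (ltW h0)).
have [h2|h2] := leP h (1 / 2).
  apply: (@le_trans _ _ (1 + 2 * h ^+ 2)); last exact: expR_ge1Dx.
  have /andP[_ eN] := expRN_taylor h0.
  (* After multiplication by exp (- h), at least 1 - h, this becomes (1 - h) (1 + h + 2 h^2) = 1 +
     h^2 (1 - 2 h) >= 1. *)
  have eP : expR h <= 1 + h + 2 * h ^+ 2.
    have eN0 : 0 < expR (- h) by exact: expR_gt0.
    have H1 : (1 - h) * (1 + h + 2 * h ^+ 2) >= 1.
      have -> : (1 - h) * (1 + h + 2 * h ^+ 2) = 1 + h ^+ 2 * (1 - 2 * h) by ring.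
      by rewrite lerDl mulr_ge0 ?sqr_ge0//; lra.
    have H2 : 1 <= expR (- h) * (1 + h + 2 * h ^+ 2).
      apply: le_trans H1 _; rewrite ler_wpM2r ?expR_ge1Dx//.
      by rewrite !addr_ge0// mulr_ge0// sqr_ge0.
    by rewrite -(ler_pM2l eN0) mulrC expRxMexpNx_1.
  by have := sqr_ge0 h; lra.
apply: (@le_trans _ _ (expR h)).
  have : expR (- h) <= expR h by rewrite ler_expR; lra.
  by lra.
by rewrite ler_expR expr2; nra.
Qed.

End elementary_limits.

Section random_walk.
Context {R : realType}.

(** The endpoint of a walk with steps of length h. The signs are enumerated explicitly, so that an
    expectation is a finite sum, on which a distribution acts by antilinearity. *)
Definition walk N (h : R) (eps : {ffun 'I_N -> bool}) : R :=
  \sum_j (if eps j then h else - h).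

(** Independence of the steps, for a multiplicative G; it is applied to the real exponential and to
    [cis]. *)
Lemma walk_prod (A : comPzRingType) N (h : R) (G : R -> A) :
  (forall x y, G (x + y) = G x * G y) -> G 0 = 1 ->
  \sum_(eps : {ffun 'I_N -> bool}) G (walk h eps) = (G h + G (- h)) ^+ N.
Proof.
move=> GD G0.
have GE (eps : {ffun 'I_N -> bool}) :
    G (walk h eps) = \prod_j (if eps j then G h else G (- h)).
  rewrite /walk (big_morph G GD G0); apply: eq_bigr => j _.
  by case: (eps j).
under eq_bigr do rewrite GE.
rewrite -(bigA_distr_bigA (fun=> fun b : bool => if b then G h else G (- h))).
by rewrite prodr_const card_ord big_bool.
Qed.

Lemma walk_weight N : \sum_(eps : {ffun 'I_N -> bool}) 2^-1 ^+ N = 1 :> R.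
Proof.
rewrite sumr_const card_ffun card_bool card_ord -[LHS]mulr_natl natrX -exprMn.
by rewrite mulfV// expr1n.
Qed.

Lemma walk_expR N (k : R) :
  \sum_(eps : {ffun 'I_N.+1 -> bool}) 2^-1 ^+ N.+1 * expR (walk (step k N) eps) <=
  expR (2 * k ^+ 2).
Proof.
rewrite -mulr_sumr (walk_prod N.+1 (step k N) (@expRD R) (@expR0 R)) -exprMn mulrC.
apply: (@le_trans _ _ (expR (2 * step k N ^+ 2) ^+ N.+1)).
  by rewrite lerXn2r ?nnegrE ?expR_ge0 ?divr_ge0 ?addr_ge0 ?expR_ge0// cosh_le.
rewrite -expRM_natl ler_expR -(step_sqr k N).
by rewrite mulrCA.
Qed.

Lemma walkN N (h : R) (eps : {ffun 'I_N -> bool}) : walk (- h) eps = - walk h eps.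
Proof.
by rewrite /walk -sumrN; apply: eq_bigr => j _; case: (eps j).
Qed.

(** The power is at most m! exp (1 + |W|), and exp |W| is at most exp W + exp (- W), whose
    expectations are bounded uniformly in N. *)
Lemma walk_moment m (k : R) : exists M, forall N,
  \sum_(eps : {ffun 'I_N.+1 -> bool})
    2^-1 ^+ N.+1 * (1 + `|walk (step k N) eps|) ^+ m <= M.
Proof.
exists (m`!%:R * expR 1 * (expR (2 * k ^+ 2) + expR (2 * k ^+ 2))) => N.
have := walk_expR N k; have := walk_expR N (- k); rewrite sqrrN => eN eP.
apply: (@le_trans _ _ (\sum_(eps : {ffun 'I_N.+1 -> bool}) m`!%:R * expR 1 *
   (2^-1 ^+ N.+1 * expR (walk (step k N) eps) +
    2^-1 ^+ N.+1 * expR (walk (step (- k) N) eps)))).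
  apply: ler_sum => eps _; rewrite -mulrDr mulrCA ler_wpM2l ?exprn_ge0//.
  have -> : walk (step (- k) N) eps = - walk (step k N) eps.
    by rewrite -walkN /step mulNr.
  set W := walk _ _.
  apply: le_trans (expr_le_expR m _) _; first by rewrite addr_ge0.
  rewrite expRD -mulrA ler_wpM2l// ler_wpM2l ?expR_ge0//.
  have [W0|W0] := leP 0 W; first by rewrite ?(ger0_norm W0) lerDl expR_ge0.
  by rewrite ?(ltr0_norm W0) lerDr expR_ge0.
rewrite -mulr_sumr ler_wpM2l ?mulr_ge0 ?expR_ge0//.
by rewrite big_split/= lerD.
Qed.

Lemma walk_cos N (h t : R) :
  \sum_(eps : {ffun 'I_N -> bool}) 2^-1 ^+ N * cos (t * walk h eps) = cos (t * h) ^+ N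
  /\ \sum_(eps : {ffun 'I_N -> bool}) 2^-1 ^+ N * sin (t * walk h eps) = 0.
Proof.
have H := walk_prod N h (G := fun x => cis (t * x)).
have {}H : \sum_(eps : {ffun 'I_N -> bool}) cis (t * walk h eps) =
    (2%:R * (cos (t * h)))%:C ^+ N.
  rewrite H; last by rewrite mulr0 cis0.
    congr (_ ^+ _); rewrite mulrN /cis cosN sinN; apply: complex_eqP => /=; ring.
  by move=> x y; rewrite mulrDr cisD.
have XE (a : R) : a%:C ^+ N = (a ^+ N)%:C :> R[i].
  by elim: N {H} => [|m IHm]; rewrite ?expr0// !exprS IHm realcM.
have ReS : complex.Re (\sum_(eps : {ffun 'I_N -> bool}) cis (t * walk h eps)) =
    \sum_(eps : {ffun 'I_N -> bool}) cos (t * walk h eps).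
  by apply: (big_morph (fun z : R[i] => complex.Re z)) => // z w; exact: ReD.
have ImS : complex.Im (\sum_(eps : {ffun 'I_N -> bool}) cis (t * walk h eps)) =
    \sum_(eps : {ffun 'I_N -> bool}) sin (t * walk h eps).
  by apply: (big_morph (fun z : R[i] => complex.Im z)) => // z w; exact: ImD.
rewrite -!mulr_sumr -ReS -ImS H XE /= mulr0 -exprMn mulrA mulVf ?mul1r//.
Qed.

End random_walk.

(** * From random walks to a change of window *)

Section tempered_linear.
Context {R : realType} {n : nat}.
Variable u : ('rV[R]_n -> R[i]) -> R[i].
Hypothesis tu : tempered_distribution u.

Lemma tempered0 : u (fun=> 0) = 0.
Proof.
have [lin _] := tu.
have := lin 0 (fun=> 0) (fun=> 0) (schwartz0) (schwartz0).
have -> : (fun x : 'rV[R]_n => 0 * 0 + 0 : R[i]) = fun=> 0.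
  by apply/funext => x; rewrite mul0r addr0.
have := lin (-1) (fun=> 0) (fun=> 0) (schwartz0) (schwartz0).
have -> : (fun x : 'rV[R]_n => -1 * 0 + 0 : R[i]) = fun=> 0.
  by apply/funext => x; rewrite mulr0 addr0.
move=> -> _; rewrite [conjc _](_ : _ = -1); first by rewrite mulN1r addNr.
by apply: complex_eqP => //=; rewrite !oppr0.
Qed.

Lemma temperedZ c f : schwartz f -> u (fun x => c * f x) = conjc c * u f.
Proof.
move=> sf; have [lin _] := tu.
have := lin c f (fun=> 0) sf (schwartz0).
rewrite tempered0 addr0 => <-; congr u.
by apply/funext => x; rewrite addr0.
Qed.

Lemma tempered_sum (I : Type) (s : seq I) (w : I -> R[i])
    (F : I -> 'rV[R]_n -> R[i]) : (forall i, schwartz (F i)) ->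
  u (fun x => \sum_(i <- s) w i * F i x) = \sum_(i <- s) conjc (w i) * u (F i).
Proof.
move=> sF; have [lin _] := tu; elim: s => [|i s IHs].
  rewrite big_nil -[RHS]tempered0; congr u.
  by apply/funext => x; rewrite big_nil.
rewrite big_cons -IHs -lin//; last exact: schwartz_sum.
by congr u; apply/funext => x; rewrite big_cons.
Qed.

Lemma schwartzZ c (f : 'rV[R]_n -> R[i]) : schwartz f -> schwartz (fun x => c * f x).
Proof.
move=> sf; have := schwartz_lin c sf schwartz0.
by under eq_fun do rewrite addr0.
Qed.

End tempered_linear.

Section walk_window.
Context {R : realType} {n : nat}.
Variable u : ('rV[R]_n -> R[i]) -> R[i].
Hypothesis tu : tempered_distribution u.
Variables (s s' : 'I_n -> R) (c C : R).
Hypotheses (c0 : 0 < c) (cs : forall i, c <= s i) (cs' : forall i, c <= s' i).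
Hypothesis C0 : 0 <= C.
Variables (y xi : forall N, {ffun 'I_N.+1 -> bool} -> 'rV[R]_n).
Variable ph : forall N, {ffun 'I_N.+1 -> bool} -> R[i].
Variables a b : 'rV[R]_n.
Hypothesis ph1 : forall N eps, normc (@ph N eps) = 1.
Hypothesis moment : forall m, exists M, forall N, \sum_(eps : {ffun 'I_N.+1 -> bool})
  2^-1 ^+ N.+1 * ((1 + `|y eps|) * (1 + `|xi eps|)) ^+ m <= M.

Let S N t := \sum_(eps : {ffun 'I_N.+1 -> bool})
  ((2^-1 ^+ N.+1)%:C * ph eps) * tfshift (a + y eps) (b + xi eps) (gauss s) t.

Hypothesis cvgS : forall t,
  normc (S N t - C%:C * tfshift a b (gauss s') t) @[N --> \oo] --> (0 : R).

(** By [moment] and 1 + |a + y| <= (1 + |a|) (1 + |y|), the seminorms of the averages [S] are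
    bounded in N, so u passes to the limit. The triangle inequality then removes the unimodular
    phases. *)
Lemma stft_walk_le :
  ((C * normc (stft (gauss s') u a b))%:E <=
   limn_einf (fun N => \sum_(eps : {ffun 'I_N.+1 -> bool})
     (2^-1 ^+ N.+1)%:E * (normc (stft (gauss s) u (a + y eps) (b + xi eps)))%:E))%E.
Proof.
have sF N (eps : {ffun 'I_N.+1 -> bool}) :
    schwartz (tfshift (a + y eps) (b + xi eps) (gauss s)).
  exact: schwartz_tfshift_gauss cs.
have sf' : schwartz (tfshift a b (gauss s')) by exact: schwartz_tfshift_gauss cs'.
have wn N (eps : {ffun 'I_N.+1 -> bool}) :
    normc ((2^-1 ^+ N.+1)%:C * ph eps : R[i]) = 2^-1 ^+ N.+1.
  by rewrite normcM ph1 mulr1 normc_real ger0_norm// exprn_ge0.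
pose W N (eps : {ffun 'I_N.+1 -> bool}) : R[i] := (2^-1 ^+ N.+1)%:C * ph eps.
have cvu : normc (u (S N) - u (fun t => C%:C * tfshift a b (gauss s') t))
    @[N --> \oo] --> (0 : R).
  apply: tempered_cvg => //.
  - move=> N; exact: (schwartz_sum (index_enum {ffun 'I_N.+1 -> bool}) (@W N) (sF N)).
  - exact: (schwartzZ _ sf').
  move=> k l; have [D [m [D0 B]]] := tfshift_gauss_seminorm k l c0 cs.
  have [M HM] := moment m.
  exists (D * ((1 + `|a|) * (1 + `|b|)) ^+ m * M) => N x.
  rewrite (cpartials_sum (index_enum {ffun 'I_N.+1 -> bool}) (@W N) l (sF N)).
  have wx0 : 0 <= (1 + `|x|) ^+ k by rewrite exprn_ge0// addr_ge0.
  apply: le_trans (ler_wpM2l wx0 (normc_sum _ _)) _; rewrite mulr_sumr.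
  apply: (@le_trans _ _ (\sum_(eps : {ffun 'I_N.+1 -> bool})
    D * ((1 + `|a|) * (1 + `|b|)) ^+ m *
    (2^-1 ^+ N.+1 * ((1 + `|y eps|) * (1 + `|xi eps|)) ^+ m))); last first.
    have ab0 : 0 <= (1 + `|a|) * (1 + `|b|) by rewrite mulr_ge0 ?addr_ge0.
    rewrite -mulr_sumr ler_wpM2l ?HM//.
    by apply: mulr_ge0 => //; exact: exprn_ge0.
  apply: ler_sum => eps _; rewrite normcM wn [leLHS]mulrCA.
  rewrite [leRHS]mulrCA ler_wpM2l ?exprn_ge0//.
  apply: le_trans (B _ _ _) _; rewrite -[leRHS]mulrA ler_wpM2l// -exprMn.
  rewrite lerXn2r ?nnegrE ?mulr_ge0 ?addr_ge0//.
  rewrite mulrACA ler_pM ?addr_ge0//.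
    have := ler_normD a (y eps); have := normr_ge0 a; have := normr_ge0 (y eps).
    by nra.
  have := ler_normD b (xi eps); have := normr_ge0 b; have := normr_ge0 (xi eps).
  by nra.
have cvn := normc_cvg_dist cvu.
rewrite temperedZ// normcM normc_conj normc_real ger0_norm// in cvn.
have cvE : (normc (u (S N)))%:E @[N --> \oo] --> (C * normc (stft (gauss s') u a b))%:E.
  by apply: cvg_EFin => //; exact: nearW.
rewrite -(cvg_lim _ cvE)// -is_cvg_limn_einfE; last by apply/cvg_ex; eexists; exact: cvE.
apply: le_limn_einf => N.
rewrite (tempered_sum tu (index_enum {ffun 'I_N.+1 -> bool}) (@W N) (sF N)).
apply: (@le_trans _ _ (\sum_(eps : {ffun 'I_N.+1 -> bool}) 2^-1 ^+ N.+1 *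
    normc (stft (gauss s) u (a + y eps) (b + xi eps)))%:E).
  rewrite lee_fin; apply: le_trans (normc_sum _ _) _.
  by apply: ler_sum => eps _; rewrite normcM normc_conj wn.
by rewrite -sumEFin; apply: lee_sum => eps _; rewrite EFinM.
Qed.

End walk_window.

Section mixed_norm_walk.
Context {R : realType} {n : nat}.
Local Open Scope ereal_scope.
Local Notation leb := (@lebesgue_rV R n).

Lemma Lnorm_translate (f : 'rV[R]_n -> \bar R) (y : 'rV[R]_n) p : 1 <= p ->
  measurable_fun setT f -> (forall x, 0 <= f x) ->
  Lnorm leb p (fun x : 'rV[R]_n => f (x + y)%R) = Lnorm leb p f.
Proof.
move=> p1 mf f0.
have E x : (x + y)%R = signed_perm_shift y (fun=> false) 1%g x.
  by apply/rowP => i; rewrite !mxE expr0 mul1r perm1 addrC.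
under eq_fun do rewrite E.
apply: (@measure_preserving_Lnorm _ _ _ leb f p) => //.
- exact: measurable_signed_perm_shift.
- move=> X mX; exact: lebesgue_rV_signed_perm_shift.
Qed.

(** Fatou's lemma and the triangle inequality are used first in a, then in b. Each shifted copy of F
    has the norm of F, and the weights have sum 1. *)
Lemma mixed_norm_walk_le (F G : 'rV[R]_n -> 'rV[R]_n -> R[i]) (C : R)
    (y xi : forall N, {ffun 'I_N.+1 -> bool} -> 'rV[R]_n) p q :
  1 <= p -> 1 <= q -> (0 < C)%R ->
  measurable_fun setT (fun x : 'rV[R]_n * 'rV[R]_n => normc (F x.1 x.2)) ->
  measurable_fun setT (fun x : 'rV[R]_n * 'rV[R]_n => normc (G x.1 x.2)) ->
  (forall a b, (C * normc (G a b))%:E <=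
    limn_einf (fun N => \sum_(eps : {ffun 'I_N.+1 -> bool})
      (2^-1 ^+ N.+1)%:E * (normc (F (a + y N eps) (b + xi N eps))%R)%:E)) ->
  C%:E * mixed_norm p q G <= mixed_norm p q F.
Proof.
move=> p1 q1 C0 mF mG FG.
have w0 N : (0 <= 2^-1 ^+ N.+1 :> R)%R by rewrite exprn_ge0.
have wsum N (z : \bar R) : 0 <= z ->
    \sum_(eps : {ffun 'I_N.+1 -> bool}) (2^-1 ^+ N.+1)%:E * z = z.
  move=> z0; rewrite -ge0_sume_distrl; last by move=> eps _; rewrite lee_fin.
  by rewrite sumEFin walk_weight mul1e.
pose F' (x : 'rV[R]_n * 'rV[R]_n) := (normc (F x.1 x.2))%:E.
have mF' : measurable_fun setT F' by exact/measurable_EFinP.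
have F'0 x : 0 <= F' x by rewrite lee_fin normc_ge0.
pose G' (x : 'rV[R]_n * 'rV[R]_n) := (normc (G x.1 x.2))%:E.
have mG' : measurable_fun setT G' by exact/measurable_EFinP.
have G'0 x : 0 <= G' x by rewrite lee_fin normc_ge0.
pose h b := Lnorm leb p (fun a : 'rV[R]_n => F' (a, b)).
have mh : measurable_fun setT h by exact: measurable_Lnorm_l.
have h0 b : 0 <= h b by exact: Lnorm_ge0.
pose g b := Lnorm leb p (fun a => G' (a, b)).
have mg : measurable_fun setT g by exact: measurable_Lnorm_l.
have g0 b : 0 <= g b by exact: Lnorm_ge0.
have mtr (f : 'rV[R]_n -> \bar R) (z : 'rV[R]_n) : measurable_fun setT f ->
    measurable_fun setT (fun x : 'rV[R]_n => f (x + z)%R).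
  move=> mf.
  have E x : (x + z)%R = signed_perm_shift z (fun=> false) 1%g x.
    by apply/rowP => i; rewrite !mxE expr0 mul1r perm1 addrC.
  under eq_fun do rewrite E.
  exact: (measurableT_comp mf (measurable_signed_perm_shift _ _ _)).
have mFb b : measurable_fun setT (fun a : 'rV[R]_n => F' (a, b)) by exact: measurableT_comp.
have mGb b : measurable_fun setT (fun a => G' (a, b)) by exact: measurableT_comp.
have gh b : C%:E * g b <=
    limn_einf (fun N => \sum_(eps : {ffun 'I_N.+1 -> bool})
      (2^-1 ^+ N.+1)%:E * h (b + xi N eps)%R).
  rewrite /g -Lnorm_ge0Z//; last exact: ltW.
  pose K N (a : 'rV[R]_n) := \sum_(eps : {ffun 'I_N.+1 -> bool})
      (2^-1 ^+ N.+1)%:E * F' ((a + y N eps)%R, (b + xi N eps)%R).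
  have mK N : measurable_fun setT (K N).
    apply: emeasurable_sum => eps; apply: measurable_funeM.
    exact: (mtr (fun a : 'rV[R]_n => F' (a, (b + xi N eps)%R))).
  have K0 N a : 0 <= K N a.
    by apply: sume_ge0 => eps _; rewrite mule_ge0// lee_fin.
  apply: (@le_trans _ _ (Lnorm leb p (fun a => limn_einf (K ^~ a)))).
    apply: le_Lnorm => //.
    - exact: measurable_funeM.
    - exact: measurable_fun_limn_einf.
    - by move=> a; rewrite mule_ge0// lee_fin ltW.
    by move=> a; rewrite -EFinM; exact: FG.
  apply: le_trans (Lnorm_limn_einf _ _ _ _) _ => //.
  apply: le_limn_einf => N.
  apply: le_trans (@Lnorm_sum _ _ _ leb _ _ (fun=> 2^-1 ^+ N.+1)%R
    (fun eps (a : 'rV[R]_n) => F' ((a + y N eps)%R, (b + xi N eps)%R)) _ _ _ _ _) _ => //.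
    by move=> eps; exact: (mtr (fun a : 'rV[R]_n => F' (a, (b + xi N eps)%R))).
  apply: lee_sum => eps _.
  by rewrite (Lnorm_translate (f := fun a => F' (a, (b + xi N eps)%R))).
have -> : mixed_norm p q G = Lnorm leb q g by [].
have -> : mixed_norm p q F = Lnorm leb q h by [].
rewrite -Lnorm_ge0Z//; last exact: ltW.
apply: (@Lnorm_limn_einf_le _ _ _ leb _ (fun N (b : 'rV[R]_n) => \sum_(eps : {ffun 'I_N.+1 -> bool})
      (2^-1 ^+ N.+1)%:E * h (b + xi N eps)%R)) => //.
- exact: measurable_funeM.
- by move=> b; rewrite mule_ge0// lee_fin ltW.
- by move=> N; apply: emeasurable_sum => eps; apply: measurable_funeM; exact: mtr.
- by move=> N b; apply: sume_ge0 => eps _; rewrite mule_ge0// lee_fin.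
move=> N.
apply: le_trans (@Lnorm_sum _ _ _ leb _ _ (fun=> 2^-1 ^+ N.+1)%R
    (fun eps (b : 'rV[R]_n) => h (b + xi N eps)%R) _ _ _ _ _) _ => //.
  by move=> eps; exact: mtr.
under eq_bigr do rewrite (Lnorm_translate _ q1 mh h0).
by rewrite wsum// Lnorm_ge0.
Qed.

End mixed_norm_walk.

Section gaussian_walk.
Context {R : realType}.
Local Notation mu := (@lebesgue_measure R).

Lemma Rintegral_sum (I : Type) (l : seq I) (w : I -> R) (f : I -> R -> R) :
  (forall i, mu.-integrable setT (EFin \o f i)) ->
  mu.-integrable setT (EFin \o (fun x => \sum_(i <- l) w i * f i x)) /\
  \int[mu]_x (\sum_(i <- l) w i * f i x) = \sum_(i <- l) w i * \int[mu]_x f i x.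
Proof.
move=> intf; elim: l => [|i l [IH1 IH2]].
  split; last first.
    rewrite big_nil; under eq_Rintegral do rewrite big_nil.
    by rewrite /Rintegral integral0.
  rewrite (_ : _ \o _ = cst 0%E); first exact: integrable0.
  by apply/funext => x /=; rewrite big_nil.
have intwi := integrable_mull (w i) (intf i).
split.
  rewrite (_ : _ \o _ = fun x => ((w i * f i x)%:E +
      (EFin \o (fun x => (\sum_(i <- l) w i * f i x)%R)) x)%E).
    exact: integrableD.
  by apply/funext => x /=; rewrite big_cons EFinD.
under eq_Rintegral do rewrite big_cons.
by rewrite big_cons RintegralD// RintegralZl// IH2.
Qed.

(** On the Fourier side, averaging over the walk multiplies exp (- r x^2) by cos (k x / sqrt (N +
    1))^(N+1), which tends to exp (- k^2 x^2 / 2): the parameter r becomes r + k^2 / 2. Dominated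
    convergence applies with the majorant exp (- r x^2). *)
Lemma gaussian_walk_cvg (r k v : R) : 0 < r ->
  \sum_(eps : {ffun 'I_N.+1 -> bool})
    2^-1 ^+ N.+1 * expR (- (v - walk (step k N) eps) ^+ 2 / (4 * r))
  @[N --> \oo] -->
  gaussFT (r + k ^+ 2 / 2) 0 / gaussFT r 0 *
    expR (- v ^+ 2 / (4 * (r + k ^+ 2 / 2))).
Proof.
move=> r0; have K0 := gaussFT0_gt0 r0; set r' := r + k ^+ 2 / 2.
have r'0 : 0 < r' by rewrite ltr_wpDr// divr_ge0// sqr_ge0.
pose f N x := rgauss r x * (cos (v * x) * cos (step (k * x) N) ^+ N.+1).
have sumE N : \sum_(eps : {ffun 'I_N.+1 -> bool})
    2^-1 ^+ N.+1 * expR (- (v - walk (step k N) eps) ^+ 2 / (4 * r)) =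
    (gaussFT r 0)^-1 * \int[mu]_x f N x.
  have intw (eps : {ffun 'I_N.+1 -> bool}) :=
    integrable_rgauss_cos r0 (v - walk (step k N) eps).
  have [_ S2] := Rintegral_sum (index_enum _) (fun=> 2^-1 ^+ N.+1) intw.
  have -> : \int[mu]_x f N x = \sum_(eps : {ffun 'I_N.+1 -> bool}) 2^-1 ^+ N.+1 *
      \int[mu]_x (rgauss r x * cos ((v - walk (step k N) eps) * x)).
    rewrite -[RHS]S2; apply: eq_Rintegral => x _.
    have [Wc Ws] := walk_cos N.+1 (step k N) x.
    (* The sine sum is zero; it is inserted so that the addition formula assembles cos ((v - W)
       x). *)
    transitivity (rgauss r x *
      (cos (v * x) * (\sum_(eps : {ffun 'I_N.+1 -> bool}) 2^-1 ^+ N.+1 * cos (x * walk (step k N) eps)) +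
       sin (v * x) * (\sum_(eps : {ffun 'I_N.+1 -> bool}) 2^-1 ^+ N.+1 * sin (x * walk (step k N) eps)))).
      by rewrite Wc Ws mulr0 addr0 /f /step [x * (k / _)]mulrA [x * k]mulrC.
    rewrite !mulr_sumr -big_split/= mulr_sumr; apply: eq_bigr => eps _.
    by rewrite mulrBl cosB [walk _ _ * x]mulrC; ring.
  rewrite mulr_sumr; apply: eq_bigr => eps _; rewrite -/(gaussFT r _) (gaussFTE r0 (v - _)).
  by rewrite [RHS]mulrCA mulKf// gt_eqF.
have -> : gaussFT r' 0 / gaussFT r 0 * expR (- v ^+ 2 / (4 * r')) =
    (gaussFT r 0)^-1 * gaussFT r' v.
  by rewrite (gaussFTE r'0 v) mulrA [_ / _]mulrC.
under eq_fun do rewrite sumE.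
apply: cvgMr.
have f_cvg x : f N x @[N --> \oo] --> rgauss r' x * cos (v * x).
  rewrite [X in _ --> X](_ : _ = rgauss r x * (cos (v * x) * expR (- ((k * x) ^+ 2 / 2)))).
    by apply: cvgMr; apply: cvgMr; exact: cos_expr_cvg.
  rewrite [cos _ * _]mulrC mulrA; congr (_ * _).
  by rewrite /rgauss -expRD /r'; congr expR; field.
have mf N : measurable_fun setT (f N).
  apply: measurable_funM; first exact: measurable_rgauss.
  apply: measurable_funM; first by apply: measurable_cos_comp; exact: measurable_funM.
  apply: measurable_funX; apply: measurable_cos_comp.
  by rewrite /step; apply: measurable_funM => //; exact: measurable_funM.
have mf' : measurable_fun setT (fun x => rgauss r' x * cos (v * x)).
  apply: measurable_funM; first exact: measurable_rgauss.
  by apply: measurable_cos_comp; exact: measurable_funM.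
have f_le N x : `|f N x| <= rgauss r x.
  rewrite normrM ger0_norm ?rgauss_ge0// ler_piMr ?rgauss_ge0// normrM.
  rewrite mulr_ile1//; first by rewrite ler_norml cos_geN1 cos_le1.
  by rewrite normrX exprn_ile1// ler_norml cos_geN1 cos_le1.
have mfE N : measurable_fun [set: measurableTypeR R] (fun x => (f N x)%:E).
  by apply/measurable_EFinP; exact: mf.
have mfE' : measurable_fun [set: measurableTypeR R] (fun x => (rgauss r' x * cos (v * x))%:E).
  by apply/measurable_EFinP; exact: mf'.
have f_cvgE x : (f N x)%:E @[N --> \oo] --> (rgauss r' x * cos (v * x))%:E.
  by apply: cvg_EFin; [exact: nearW|exact: f_cvg].
have f_leE N x : (`|(f N x)%:E| <= (rgauss r x)%:E)%E by rewrite lee_fin.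
have f_cvgAE : {ae mu, forall x : measurableTypeR R, [set: measurableTypeR R] x ->
    (f N x)%:E @[N --> \oo] --> (rgauss r' x * cos (v * x))%:E}.
  by apply: aeW => x _; exact: f_cvgE.
have f_leAE : {ae mu, forall (x : measurableTypeR R) N, [set: measurableTypeR R] x ->
    (`|(f N x)%:E| <= (rgauss r x)%:E)%E}.
  by apply: aeW => x N _; exact: f_leE.
have [_ _] := dominated_convergence measurableT mfE mfE' f_cvgAE
  (integrable_rgauss r0) f_leAE.
have fin : (\int[mu]_x (rgauss r' x * cos (v * x))%:E)%E \is a fin_num.
  by apply: integrable_fin_num => //; exact: integrable_rgauss_cos.
rewrite -(fineK fin) => /fine_cvgP[_].
exact.
Qed.

Lemma walk_cis N (h t : R) :
  \sum_(eps : {ffun 'I_N -> bool}) (2^-1 ^+ N)%:C * cis (t * walk h eps) =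
  (cos (t * h) ^+ N)%:C.
Proof.
have [Wc Ws] := walk_cos N h t.
apply: complex_eqP.
  rewrite (big_morph (fun z : R[i] => complex.Re z) (id1 := 0) (op1 := +%R))//; last exact: ReD.
  by rewrite -Wc; apply: eq_bigr => eps _; rewrite ReM /= mul0r subr0.
rewrite (big_morph (fun z : R[i] => complex.Im z) (id1 := 0) (op1 := +%R))//; last exact: ImD.
by rewrite -[RHS]Ws; apply: eq_bigr => eps _; rewrite ImM /= mul0r addr0.
Qed.

Lemma normc_cvg_scale (z : R[i]) (r_ : nat -> R) (r : R) :
  r_ N @[N --> \oo] --> r ->
  normc (z * (r_ N)%:C - z * r%:C) @[N --> \oo] --> (0 : R).
Proof.
move=> cr.
have E N : normc (z * (r_ N)%:C - z * r%:C) = normc z * `|r_ N - r|.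
  rewrite -mulrBr normcM -normc_real; congr (_ * normc _).
  by apply: complex_eqP => //=; rewrite subrr.
have c0 : normc z * `|r_ N - r| @[N --> \oo] --> normc z * `|0 : R|.
  by apply: cvgMr; apply: cvg_norm; apply/subr_cvg0.
by rewrite normr0 mulr0 in c0; under eq_fun do rewrite E.
Qed.

End gaussian_walk.

Section window_change.
Context {R : realType} {n : nat}.
Implicit Types (s : 'I_n -> R) (t v : 'rV[R]_n).

(** Finiteness is compared rather than norms, so that no constant has to be carried along the chain
    of coordinates. *)
Definition window_le s s' := forall (u : ('rV[R]_n -> R[i]) -> R[i]) p q,
  tempered_distribution u -> (1 <= p)%E -> (1 <= q)%E ->
  (mixed_norm p q (stft (gauss s) u) < +oo)%E ->
  (mixed_norm p q (stft (gauss s') u) < +oo)%E.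

(** The phases may depend on a because only moduli enter the norms; the shifts may not, since
    translation invariance is used in both variables. *)
Lemma window_le_walk s s' (c C : R)
    (y xi : forall N, {ffun 'I_N.+1 -> bool} -> 'rV[R]_n)
    (ph : 'rV[R]_n -> forall N, {ffun 'I_N.+1 -> bool} -> R[i]) :
  0 < c -> (forall i, c <= s i) -> (forall i, c <= s' i) -> 0 < C ->
  (forall a N eps, normc (@ph a N eps) = 1) ->
  (forall m, exists M, forall N, \sum_(eps : {ffun 'I_N.+1 -> bool})
    2^-1 ^+ N.+1 * ((1 + `|y N eps|) * (1 + `|xi N eps|)) ^+ m <= M) ->
  (forall a b t, normc (\sum_(eps : {ffun 'I_N.+1 -> bool})
      ((2^-1 ^+ N.+1)%:C * ph a N eps) *
        tfshift (a + y N eps) (b + xi N eps) (gauss s) t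
      - C%:C * tfshift a b (gauss s') t) @[N --> \oo] --> (0 : R)) ->
  window_le s s'.
Proof.
move=> c0 cs cs' C0 ph1 mom cvgS u p q tu p1 q1 fin.
have : (C%:E * mixed_norm p q (stft (gauss s') u) <=
        mixed_norm p q (stft (gauss s) u))%E.
  apply: (@mixed_norm_walk_le _ _ _ _ C y xi) => //.
  - exact: measurable_stft_gauss tu c0 cs.
  - exact: measurable_stft_gauss tu c0 cs'.
  by move=> a b; apply: (@stft_walk_le _ _ u tu s s' c C c0 cs cs' (ltW C0)
    y xi (ph a)).
move=> /le_lt_trans /(_ fin).
by case: (mixed_norm _ _ _) => [r| |]; rewrite ?ltry ?ltNyr// gt0_muley.
Qed.

Definition update s i (d : R) : 'I_n -> R := fun j => if j == i then d else s j.

Lemma wquad_update s i d v :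
  wquad (update s i d) v = wquad s v + (d - s i) * v 0 i ^+ 2.
Proof.
rewrite /wquad (bigD1 i)//= [in RHS](bigD1 i)//= /update eqxx.
under eq_bigr => j ji do rewrite (negbTE ji).
by ring.
Qed.

Lemma wquad_shift s i (W : R) v :
  wquad s (v - W *: delta_mx 0 i) =
  wquad s v - s i * v 0 i ^+ 2 + s i * (v 0 i - W) ^+ 2.
Proof.
rewrite /wquad (bigD1 i)//= [in RHS](bigD1 i)//= !mxE !eqxx/= mulr1.
under eq_bigr => j ji do rewrite !mxE (negbTE ji) andbF mulr0 subr0.
by ring.
Qed.

Lemma dotr_delta (b t : 'rV[R]_n) i (W : R) :
  dotr (b + W *: delta_mx 0 i) t = dotr b t + W * t 0 i.
Proof.
rewrite /dotr (bigD1 i)//= [in RHS](bigD1 i)//= !mxE !eqxx/= mulr1.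
under eq_bigr => j ji do rewrite !mxE (negbTE ji) andbF mulr0 addr0.
by ring.
Qed.

Lemma walk_moment_delta i (k : R) m : exists M, forall N,
  \sum_(eps : {ffun 'I_N.+1 -> bool}) 2^-1 ^+ N.+1 *
    (1 + `|walk (step k N) eps *: (delta_mx 0 i : 'rV[R]_n)|) ^+ m <= M.
Proof.
have [M HM] := walk_moment m k; exists M => N; apply: le_trans (HM N).
apply: ler_sum => eps _; rewrite ler_wpM2l ?exprn_ge0//.
rewrite lerXn2r ?nnegrE ?addr_ge0// lerD2l normrZ.
by rewrite ler_piMr// norm_delta.
Qed.

Lemma window_le_narrow s i (c d : R) : 0 < c -> (forall j, c <= s j) ->
  s i <= d -> window_le s (update s i d).
Proof.
move=> c0 cs sd.
have pi0 : 0 < pi :> R by exact: pi_gt0.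
(* With this k, exp (- (2 pi k v)^2 / 2) is exp (- pi (d - s_i) v^2), the missing Gaussian
   factor. *)
pose k := Num.sqrt ((d - s i) / (2 * pi)).
have k2 : 2 * pi * k ^+ 2 = d - s i.
  by rewrite sqr_sqrtr ?divr_ge0 ?subr_ge0 ?mulr_ge0 ?(ltW pi0)// mulrC divfK// mulf_neq0// gt_eqF.
(* The phases recentre the modulations at a, so that the averaged factor depends on t - a only. *)
apply: (@window_le_walk _ _ c 1 (fun _ _ => 0)
  (fun N eps => walk (step k N) eps *: delta_mx 0 i)
  (fun a N eps => cis (- (2 * pi * walk (step k N) eps * a 0 i)))) => //.
- by move=> j; rewrite /update; case: eqP => [_|_ //]; exact: le_trans (cs i) sd.
- by move=> *; exact: normc_cis.
- move=> m; have [M HM] := walk_moment_delta i k m; exists M => N.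
  by rewrite normr0 addr0; under eq_bigr do rewrite mul1r; exact: HM.
move=> a b t; pose th := 2 * pi * (t 0 i - a 0 i).
have SE N : \sum_(eps : {ffun 'I_N.+1 -> bool})
    ((2^-1 ^+ N.+1)%:C * cis (- (2 * pi * walk (step k N) eps * a 0 i))) *
    tfshift (a + 0) (b + walk (step k N) eps *: delta_mx 0 i) (gauss s) t =
    tfshift a b (gauss s) t * (cos (step (th * k) N) ^+ N.+1)%:C.
  rewrite -[step (th * k) N]/(th * k / _) -mulrA -/(step k N) -walk_cis mulr_sumr.
  apply: eq_bigr => eps _; rewrite addr0 /tfshift dotr_delta.
  set W := walk _ _.
  rewrite (_ : th * W = 2 * pi * (W * t 0 i) - 2 * pi * W * a 0 i); last first.
    by rewrite /th; ring.
  by rewrite [2 * pi * (_ + _)]mulrDr !cisD; ring.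
under eq_fun do rewrite SE mul1r.
rewrite (_ : tfshift a b (gauss (update s i d)) t =
  tfshift a b (gauss s) t * (expR (- ((th * k) ^+ 2 / 2)))%:C); last first.
  have tE (z : 'rV[R]_n -> R[i]) : tfshift a b z t = cis (2 * pi * dotr b t) * z (t - a) by [].
  rewrite !tE -[RHS]mulrA; congr (_ * _).
  have gE (w : 'I_n -> R) y : gauss w y = (expR (- pi * wquad w y))%:C by [].
  rewrite !gE -realcM -expRD wquad_update -k2 !mxE /th.
  by congr (expR _)%:C; field.
by apply: normc_cvg_scale; exact: cos_expr_cvg.
Qed.

Lemma window_le_widen s i (c d : R) : 0 < c -> (forall j, c <= s j) ->
  c <= d -> d <= s i -> window_le s (update s i d).
Proof.
move=> c0 cs cd ds.
have pi0 : 0 < pi :> R by exact: pi_gt0.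
have d0 : 0 < d by apply: lt_le_trans cd.
have s0 : 0 < s i by apply: lt_le_trans ds.
(* Chosen so that exp (- v^2 / (4 r)) and exp (- v^2 / (4 r')) are the factors of coordinate i in
   the two windows. *)
pose r := (4 * pi * s i)^-1; pose r' := (4 * pi * d)^-1.
have r0 : 0 < r by rewrite invr_gt0 !mulr_gt0.
have r'0 : 0 < r' by rewrite invr_gt0 !mulr_gt0.
have rr' : r <= r' by rewrite lef_pV2 ?posrE ?mulr_gt0// ler_wpM2l// mulr_ge0// ltW.
pose k := Num.sqrt (2 * (r' - r)).
have k2 : r + k ^+ 2 / 2 = r'.
  by rewrite sqr_sqrtr ?mulr_ge0 ?subr_ge0// [2 * _]mulrC mulfK// addrC subrK.
apply: (@window_le_walk _ _ c (gaussFT r' 0 / gaussFT r 0)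
  (fun N eps => walk (step k N) eps *: delta_mx 0 i) (fun _ _ => 0)
  (fun _ _ _ => 1)) => //.
- by move=> j; rewrite /update; case: eqP.
- by rewrite divr_gt0// gaussFT0_gt0.
- by move=> *; exact: normc1.
- move=> m; have [M HM] := walk_moment_delta i k m; exists M => N.
  by rewrite normr0 addr0; under eq_bigr do rewrite mulr1; exact: HM.
move=> a b t; pose v := t - a.
(* The modulation and the factors of the other coordinates, untouched by the walk. *)
pose z : R[i] := cis (2 * pi * dotr b t) *
  (expR (- pi * (wquad s v - s i * v 0 i ^+ 2)))%:C.
have SE N : \sum_(eps : {ffun 'I_N.+1 -> bool})
    ((2^-1 ^+ N.+1)%:C * 1) *
    tfshift (a + walk (step k N) eps *: delta_mx 0 i) (b + 0) (gauss s) t =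
    z * (\sum_(eps : {ffun 'I_N.+1 -> bool})
      2^-1 ^+ N.+1 * expR (- (v 0 i - walk (step k N) eps) ^+ 2 / (4 * r)))%:C.
  rewrite (big_morph (fun x : R => x%:C) (id1 := 0) (op1 := +%R))//; last first.
    by move=> x y; apply: complex_eqP => //=; rewrite addr0.
  rewrite mulr_sumr; apply: eq_bigr => eps _; rewrite addr0 mulr1 /tfshift /z /gauss.
  set W := walk _ _.
  have -> : t - (a + W *: delta_mx 0 i) = v - W *: delta_mx 0 i by rewrite opprD addrA.
  rewrite wquad_shift [in RHS]realcM.
  have -> : expR (- pi * (wquad s v - s i * v 0 i ^+ 2 + s i * (v 0 i - W) ^+ 2)) =
      expR (- pi * (wquad s v - s i * v 0 i ^+ 2)) * expR (- (v 0 i - W) ^+ 2 / (4 * r)).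
    rewrite -expRD; congr expR; rewrite /r.
    by move: pi pi0 => P P0; field; rewrite !gt_eqF.
  by rewrite realcM; ring.
under eq_fun do rewrite SE.
rewrite (_ : _ * tfshift a b _ t = z * (gaussFT r' 0 / gaussFT r 0 *
  expR (- v 0 i ^+ 2 / (4 * r')))%:C); last first.
  rewrite /tfshift /z /gauss -/v wquad_update !realcM.
  have -> : expR (- pi * (wquad s v + (d - s i) * v 0 i ^+ 2)) =
      expR (- pi * (wquad s v - s i * v 0 i ^+ 2)) * expR (- v 0 i ^+ 2 / (4 * r')).
    rewrite -expRD; congr expR; rewrite /r'.
    by move: pi pi0 => P P0; field; rewrite !gt_eqF.
  by rewrite realcM; ring.
apply: normc_cvg_scale; rewrite -k2; exact: gaussian_walk_cvg.
Qed.

Lemma window_le_trans s1 s2 s3 :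
  window_le s1 s2 -> window_le s2 s3 -> window_le s1 s3.
Proof. by move=> h12 h23 u p q tu p1 q1 fin; apply: h23 => //; exact: h12. Qed.

Lemma window_le_all s s' (c : R) : 0 < c ->
  (forall i, c <= s i) -> (forall i, c <= s' i) -> window_le s s'.
Proof.
move=> c0 cs cs'.
(* Hybrid weights: the first m coordinates have already been changed. All weights stay at least [c],
   so every intermediate window is a Schwartz function. *)
pose sk (m : nat) : 'I_n -> R := fun i => if (i < m)%N then s' i else s i.
have csk m i : c <= sk m i by rewrite /sk; case: ifP.
have : window_le s (sk n).
  elim: {-2}n (leqnn n) => [|m IHm] mn.
    by have -> : sk 0%N = s by apply/funext.
  apply: (window_le_trans (IHm (ltnW mn))).
  pose i := Ordinal mn.
  have -> : sk m.+1 = update (sk m) i (s' i).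
    apply/funext => j; rewrite /update /sk ltnS leq_eqVlt.
    have -> : (val j == m) = (j == i) by [].
    by case: eqP => [->|].
  have [h|h] := leP (sk m i) (s' i); first exact: window_le_narrow c0 _ h.
  by apply: (window_le_widen c0) => //; exact: ltW.
by have -> : sk n = s' by apply/funext => i; rewrite /sk ltn_ord.
Qed.

End window_change.

(** * Weyl symbols *)

Section symbol_operator.
Context {R : realType}.

Lemma mixed_norm_scale n (F G : 'rV[R]_n -> 'rV[R]_n -> R[i]) (K : R) p q :
  (1 <= p)%E -> (1 <= q)%E -> 0 <= K ->
  measurable_fun setT (fun x : 'rV[R]_n * 'rV[R]_n => normc (G x.1 x.2)) ->
  (forall a b, normc (F a b) = K * normc (G a b)) ->
  (mixed_norm p q F = K%:E * mixed_norm p q G)%E.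
Proof.
move=> p1 q1 K0 mG FG.
pose G' (x : 'rV[R]_n * 'rV[R]_n) := (normc (G x.1 x.2))%:E.
have mG' : measurable_fun setT G' by exact/measurable_EFinP.
have G'0 x : (0 <= G' x)%E by rewrite lee_fin normc_ge0.
rewrite /mixed_norm -Lnorm_ge0Z//; last 2 first.
- exact: (measurable_Lnorm_l (lebesgue_rV n) p1 mG' G'0).
- by move=> b; exact: Lnorm_ge0.
congr (Lnorm _ _ _); apply/funext => b.
rewrite -Lnorm_ge0Z//; last 2 first.
- exact: (measurableT_comp mG' (g := fun a => (a, b))).
- by move=> a; rewrite lee_fin normc_ge0.
by congr (Lnorm _ _ _); apply/funext => a; rewrite FG EFinM.
Qed.

Lemma scale_fin_lty (K : R) (x : \bar R) : 0 < K ->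
  (K%:E * x < +oo)%E <-> (x < +oo)%E.
Proof.
by move=> K0; case: x => [x| |]; rewrite -?EFinM ?ltry// ?gt0_muley// gt0_muleNy// ltNyy.
Qed.

Lemma gaussianE n : @gaussian R n =
  fun t => (2 `^ (n%:R / 4))%:C * gauss (fun=> 1) t.
Proof.
apply/funext => t; rewrite /gaussian /gauss realcM.
congr (_ * (expR (_ * _))%:C); rewrite /dotr /wquad.
by apply: eq_bigr => i _; rewrite mul1r expr2.
Qed.

Lemma tfshift_gaussian n (a b : 'rV[R]_n) : tfshift a b (@gaussian R n) =
  fun t => (2 `^ (n%:R / 4))%:C * tfshift a b (gauss (fun=> 1)) t.
Proof. by apply/funext => t; rewrite gaussianE /tfshift mulrCA. Qed.

Lemma schwartz_gauss_shift n (a b : 'rV[R]_n) (c : R) : 0 < c ->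
  schwartz (tfshift a b (gauss (fun=> c))).
Proof. by move=> c0; apply: (schwartz_tfshift_gauss _ _ c0) => i. Qed.

Lemma schwartz_tfshift_gaussian n (a b : 'rV[R]_n) :
  schwartz (tfshift a b (@gaussian R n)).
Proof. by rewrite tfshift_gaussian; apply: schwartzZ; exact: schwartz_gauss_shift. Qed.

Lemma modulation_spaceE n p q (u : ('rV[R]_n -> R[i]) -> R[i]) :
  (1 <= p)%E -> (1 <= q)%E -> tempered_distribution u ->
  modulation_space p q u <-> (mixed_norm p q (stft (gauss (fun=> 2%R)) u) < +oo)%E.
Proof.
move=> p1 q1 tu.
pose k : R := 2 `^ (n%:R / 4); have k0 : 0 < k by exact: powR_gt0.
have -> : modulation_space p q u <-> (mixed_norm p q (stft (@gaussian R n) u) < +oo)%E.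
  by split=> [[]|].
rewrite (@mixed_norm_scale _ _ (stft (gauss (fun=> 1)) u) k p q)//; last 3 first.
- exact: ltW.
- exact: (measurable_stft_gauss tu (ltr01 : 0 < 1 :> R)).
- move=> a b; rewrite /stft tfshift_gaussian temperedZ//; last exact: schwartz_gauss_shift.
  by rewrite normcM normc_conj normc_real ger0_norm// ltW.
rewrite scale_fin_lty//; split.
  by apply: (window_le_all (c := 1)) => // i; rewrite ler1n.
by apply: (window_le_all (c := 1)) => // i; rewrite ler1n.
Qed.

Section symplectic.
Variable d : nat.

Definition swap_halves (i : 'I_(d + d)) : 'I_(d + d) :=
  match fintype.split i with inl j => rshift d j | inr j => lshift d j end.

Lemma swap_halvesL j : swap_halves (lshift d j) = rshift d j.
Proof. by rewrite /swap_halves (unsplitK (inl j)). Qed.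

Lemma swap_halvesR j : swap_halves (rshift d j) = lshift d j.
Proof. by rewrite /swap_halves (unsplitK (inr j)). Qed.

Lemma swap_halvesK : involutive swap_halves.
Proof.
move=> i; rewrite -(splitK i); case: (fintype.split i) => j /=.
  by rewrite swap_halvesL swap_halvesR.
by rewrite swap_halvesR swap_halvesL.
Qed.

Definition half_sign (i : 'I_(d + d)) : bool :=
  match fintype.split i with inl _ => false | inr _ => true end.

Lemma half_signL j : half_sign (lshift d j) = false.
Proof. by rewrite /half_sign (unsplitK (inl j)). Qed.

Lemma half_signR j : half_sign (rshift d j) = true.
Proof. by rewrite /half_sign (unsplitK (inr j)). Qed.

(* [symplectic_shift z b = z + (b_2, - b_1)] for [b = (b_1, b_2)]. *)
Definition symplectic_shift (z : 'rV[R]_(d + d)) : 'rV[R]_(d + d) -> 'rV[R]_(d + d) :=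
  signed_perm_shift z half_sign (perm (inv_inj swap_halvesK)).

Lemma symplectic_shiftE z b : symplectic_shift z b =
  z + row_mx (rsubmx b) (- lsubmx b).
Proof.
apply/rowP => i; rewrite !mxE permE -(splitK i).
case: (fintype.split i) => j /=; rewrite ?row_mxEl ?row_mxEr ?half_signL ?half_signR
  ?swap_halvesL ?swap_halvesR ?(unsplitK (inl j)) ?(unsplitK (inr j)) !mxE.
  by rewrite expr0 mul1r.
by rewrite expr1 mulN1r.
Qed.

Section gabor_symbol.
Variable T : ('rV[R]_d -> R[i]) -> ('rV[R]_d -> R[i]) -> R[i].
Variable sigma : ('rV[R]_(d + d) -> R[i]) -> R[i].
Hypothesis Tsigma : weyl_symbol T sigma.

Let tsigma : tempered_distribution sigma. Proof. by case: Tsigma. Qed.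

Let V (x : 'rV[R]_(d + d) * 'rV[R]_(d + d)) : \bar R :=
  (normc (stft (gauss (fun=> 2)) sigma x.1 x.2))%:E.

Let mV : measurable_fun setT V.
Proof.
apply/measurable_EFinP; exact: (measurable_stft_gauss tsigma (ltr0n R 2)).
Qed.

Let V0 x : (0 <= V x)%E. Proof. by rewrite lee_fin normc_ge0. Qed.

(** [symplectic_shift 0] is J itself; both norms are iterated norms of this function, in opposite
    orders. *)
Let A (x : 'rV[R]_(d + d) * 'rV[R]_(d + d)) : \bar R :=
  V (x.1 + 2^-1 *: symplectic_shift 0 x.2, x.2).

Let A0 x : (0 <= A x)%E. Proof. exact: V0. Qed.

Let mA : measurable_fun setT A.
Proof.
apply: (measurableT_comp mV); apply: measurable_fun_pair; last exact: measurable_snd.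
apply: measurable_fun_rVP => i.
rewrite (_ : _ \o _ = fun x : 'rV[R]_(d + d) * 'rV[R]_(d + d) =>
  rV_coord i x.1 + 2^-1 * rV_coord i (symplectic_shift 0 x.2)); last first.
  by apply/funext => x; rewrite /rV_coord /= !mxE.
apply: measurable_funD.
  exact: (measurableT_comp (measurable_rV_coord i) measurable_fst).
apply: measurable_funM => //; apply: (measurableT_comp (measurable_rV_coord i)).
exact: (measurableT_comp (measurable_signed_perm_shift _ _ _) measurable_snd).
Qed.

Lemma gabor_matrixE w z : normc (gabor_matrix T w z) =
  wigner_cst d * normc (stft (gauss (fun=> 2)) sigma (2^-1 *: (z + w))
    (row_mx (rsubmx z - rsubmx w) (lsubmx w - lsubmx z))).
Proof.
have [_ TE] := Tsigma.
rewrite /gabor_matrix TE; try exact: schwartz_tfshift_gaussian.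
rewrite wigner_gaussian temperedZ//; last exact: schwartz_gauss_shift.
rewrite normcM normc_conj normcM normc_cexp expR0 mulr1 normc_real ger0_norm//.
exact/ltW/wigner_cst_gt0.
Qed.

(** For w = z + J b, the frequency J (z - w) = - J (J b) is b, because the square of J is -1. *)
Lemma gabor_matrix_symplectic z b :
  normc (gabor_matrix T (symplectic_shift z b) z) =
  wigner_cst d * normc (stft (gauss (fun=> 2)) sigma
    (z + 2^-1 *: symplectic_shift 0 b) b).
Proof.
have [zL zR] : lsubmx (symplectic_shift z b) = lsubmx z + rsubmx b /\
    rsubmx (symplectic_shift z b) = rsubmx z - lsubmx b.
  by rewrite symplectic_shiftE !linearD /= row_mxKl row_mxKr.
rewrite gabor_matrixE zL zR.
have -> : row_mx (rsubmx z - (rsubmx z - lsubmx b))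
    (lsubmx z + rsubmx b - lsubmx z) = b.
  by rewrite opprB addrC subrK addrC addrA addNr add0r hsubmxK.
suff -> : 2^-1 *: (z + symplectic_shift z b) = z + 2^-1 *: symplectic_shift 0 b by [].
rewrite !symplectic_shiftE add0r addrA scalerDr; congr (_ + _).
have -> : z + z = (2 : R) *: z by rewrite scaler_nat mulr2n.
by rewrite scalerA mulVf ?pnatr_eq0// scale1r.
Qed.

Lemma measurable_gabor_matrix z :
  measurable_fun setT (fun w => (normc (gabor_matrix T w z))%:E).
Proof.
under eq_fun do rewrite gabor_matrixE EFinM.
apply: measurable_funeM.
apply: (measurableT_comp mV (g := fun w => (2^-1 *: (z + w),
  row_mx (rsubmx z - rsubmx w) (lsubmx w - lsubmx z)))).
apply: measurable_fun_pair.
  apply: measurable_fun_rVP => i.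
  rewrite (_ : _ \o _ = fun w : 'rV[R]_(d + d) => 2^-1 * (z 0 i + rV_coord i w)); last first.
    by apply/funext => w; rewrite /rV_coord /= !mxE.
  apply: measurable_funM => //; apply: measurable_funD => //.
  exact: measurable_rV_coord.
(* The map from w to J (z - w) is again a signed permutation with a translation, with the signs
   opposite to those of J. *)
rewrite (_ : (fun w => _) = signed_perm_shift (row_mx (rsubmx z) (- lsubmx z))
  (fun i => ~~ half_sign i) (perm (inv_inj swap_halvesK))).
  exact: measurable_signed_perm_shift.
apply/funext => w; apply/rowP => i; rewrite [RHS]mxE permE -(splitK i).
case: (fintype.split i) => j /=; rewrite ?row_mxEl ?row_mxEr ?half_signL ?half_signR
  ?swap_halvesL ?swap_halvesR !mxE /=.
  by rewrite expr1 mulN1r.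
by rewrite expr0 mul1r addrC.
Qed.

Lemma mixed_norm_gabor p q : (1 <= p)%E -> (1 <= q)%E ->
  mixed_norm q p (gabor_matrix T) = ((wigner_cst d)%:E *
    Lnorm (lebesgue_rV (d + d)) p (fun z =>
      Lnorm (lebesgue_rV (d + d)) q (fun b => A (z, b))))%E.
Proof.
move=> p1 q1.
rewrite -Lnorm_ge0Z//; last 3 first.
- exact/ltW/wigner_cst_gt0.
- exact: (measurable_Lnorm_r (lebesgue_rV (d + d)) q1 mA A0).
- by move=> z; exact: Lnorm_ge0.
rewrite /mixed_norm; congr (Lnorm _ _ _); apply/funext => z.
have mTz := measurable_gabor_matrix z.
rewrite -(@measure_preserving_Lnorm _ _ _ (lebesgue_rV (d + d)) _ _ (symplectic_shift z))//; last 3 first.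
- exact: measurable_signed_perm_shift.
- by move=> X mX; exact: lebesgue_rV_signed_perm_shift.
- by move=> w; rewrite lee_fin normc_ge0.
transitivity (Lnorm (lebesgue_rV (d + d)) q
    (fun b => (wigner_cst d)%:E * A (z, b))%E).
  by congr (Lnorm _ _ _); apply/funext => b; rewrite /= gabor_matrix_symplectic EFinM.
have mAz : measurable_fun setT (fun b => A (z, b)).
  exact: measurableT_comp mA (pair1_measurable z).
by apply: (Lnorm_ge0Z _ q1) => //; exact/ltW/wigner_cst_gt0.
Qed.

Lemma mixed_norm_symbol p q : (1 <= p)%E -> (1 <= q)%E ->
  mixed_norm p q (stft (gauss (fun=> 2)) sigma) =
    Lnorm (lebesgue_rV (d + d)) q (fun b =>
      Lnorm (lebesgue_rV (d + d)) p (fun z => A (z, b))).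
Proof.
move=> p1 q1; rewrite /mixed_norm; congr (Lnorm _ _ _); apply/funext => b.
rewrite /A /=.
rewrite (@Lnorm_translate _ _ (fun z => V (z, b)) (2^-1 *: symplectic_shift 0 b))//.
exact: measurableT_comp mV (pair2_measurable b).
Qed.

Lemma operator_norm_lty p q : (1 <= p)%E -> (1 <= q)%E ->
  (mixed_norm q p (gabor_matrix T) < +oo)%E <->
  (Lnorm (lebesgue_rV (d + d)) p (fun z =>
    Lnorm (lebesgue_rV (d + d)) q (fun b => A (z, b))) < +oo)%E.
Proof.
by move=> p1 q1; rewrite mixed_norm_gabor// scale_fin_lty//; exact: wigner_cst_gt0.
Qed.

Lemma operator_to_symbol p q : (1 <= p)%E -> (p <= q)%E ->
  (mixed_norm q p (gabor_matrix T) < +oo)%E -> modulation_space p q sigma.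
Proof.
move=> p1 pq; have q1 := le_trans p1 pq.
move=> /(operator_norm_lty p1 q1) Too.
apply/(modulation_spaceE p1 q1 tsigma); rewrite (mixed_norm_symbol p1 q1).
exact: le_lt_trans (Minkowski_mixed (lebesgue_rV _) (lebesgue_rV _) p1 pq mA A0) Too.
Qed.

Lemma symbol_to_operator p q : (1 <= q)%E -> (q <= p)%E ->
  modulation_space p q sigma -> (mixed_norm q p (gabor_matrix T) < +oo)%E.
Proof.
move=> q1 qp; have p1 := le_trans q1 qp.
move=> /(modulation_spaceE p1 q1 tsigma); rewrite (mixed_norm_symbol p1 q1) => soo.
apply/(operator_norm_lty p1 q1); apply: le_lt_trans soo.
(* With the variables exchanged, the smaller exponent q again belongs to the inner norm on the
   left-hand side of Minkowski's inequality. *)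
pose A' (x : 'rV[R]_(d + d) * 'rV[R]_(d + d)) := A (x.2, x.1).
have mA' : measurable_fun setT A'.
  apply: (measurableT_comp mA (g := fun x => (x.2, x.1))).
  exact: measurable_fun_pair measurable_snd measurable_fst.
exact: (Minkowski_mixed (lebesgue_rV _) (lebesgue_rV _) q1 qp mA' (fun=> A0 _)).
Qed.

End gabor_symbol.
End symplectic.
End symbol_operator.

Theorem theorem1p7 (R : realType) (d : nat)
    (T : ('rV[R]_d -> R[i]) -> ('rV[R]_d -> R[i]) -> R[i])
    (sigma : ('rV[R]_(d + d) -> R[i]) -> R[i]) :
  schwartz_operator T -> weyl_symbol T sigma ->
  (forall p q : \bar R, (1 <= p)%E -> (p <= q)%E ->
     operator_modulation_space q p T -> modulation_space p q sigma) /\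
  (forall p q : \bar R, (1 <= q)%E -> (q <= p)%E ->
     modulation_space p q sigma -> operator_modulation_space q p T).
Proof.
move=> sT Tsigma; split=> p q p1 pq.
  by case=> _; exact: (operator_to_symbol Tsigma).
by move=> sp; split=> //; exact: (symbol_to_operator Tsigma).
Qed.
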